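(* Let $(R,A,\phi,\{a_{i,j,l}\}_{i,j,l\in I})$ and $(R',A',\phi',\{a'_{i,j,l}\}_{i,j,l\in I'})$ be two admissible data over $\mathbb F$, with $I=\{1,\dots,n\}$, $I'=\{1,\dots,n'\}$, bases $\{r_i\}_{i\in I}$, $\{r'_i\}_{i\in I'}$, idempotents $\{e_i\}_{i\in I}$, $\{e'_i\}_{i\in I'}$ and structure vectors $\mathbf c_{ij}$, $\mathbf c'_{ij}$ respectively, and let $\widehat{\mathcal C}$, $\widehat{\mathcal C'}$ be the associated tensor categories, with tensor products denoted $\otimes_{\widehat{\mathcal C}}$, $\otimes_{\widehat{\mathcal C'}}$. Then $\widehat{\mathcal C}$ and $\widehat{\mathcal C'}$ are tensor equivalent if and only if $n'=n$ (so $I'=I$) and there is a permutation $\sigma$ of $I$ such that the following conditions hold: (1) The additive group homomorphism $R\to R'$ given by $r_i\mapsto r'_{\sigma(i)}$, $i\in I$, is a ring isomorphism. (2) There is an $\mathbb F$-algebra isomorphism $\delta:A\to A'$ with $\delta(e_i)=e'_{\sigma(i)}$ for all $i\in I$. (3) There exist a nonzero scalar $\alpha\in\mathbb F$ and a family of invertible elements $\varphi_{i,j}$ of the algebras $M_{\mathbf c'_{\sigma(i)\sigma(j)}}(A')$, $i,j\in I$, such that, with $\delta$ the isomorphism of (2) (applied entrywise to matrices), for all $i,j,l,i',j'\in I$, $x\in e_{i'}Ae_i$, $y\in e_{j'}Ae_j$: (a) $\varphi_{1,i}=\varphi_{i,1}=\alpha E'_{\mathbf e_{\sigma(i)}}=\alpha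 e'_{\sigma(i)}$; (b) $\varphi_{i',j'}\bigl(\delta(x)\otimes_{\widehat{\mathcal C'}}\delta(y)\bigr)=P_\sigma(\mathbf c_{i'j'})\,\delta(x\otimes_{\widehat{\mathcal C}}y)\,P_\sigma(\mathbf c_{ij})^T\varphi_{i,j}$; (c) $$\sum_{t=1}^n\sum_{1\le k\le c_{ijt}}\delta(a_{i,j,l})\,\delta(X^{\mathbf c_{ij}}_{t,k}\otimes_{\widehat{\mathcal C}}e_l)\,P_\sigma(\mathbf c_{tl})^T\varphi_{t,l}\,\bigl((Y'^{\,\mathbf c'_{\sigma(i)\sigma(j)}}_{\sigma(t),k}\varphi_{i,j})\otimes_{\widehat{\mathcal C'}}e'_{\sigma(l)}\bigr)$$ $$=\sum_{t=1}^n\sum_{1\le k\le c_{jlt}}\delta(e_i\otimes_{\widehat{\mathcal C}}X^{\mathbf c_{jl}}_{t,k})\,P_\sigma(\mathbf c_{it})^T\varphi_{i,t}\,\bigl(e'_{\sigma(i)}\otimes_{\widehat{\mathcal C'}}(Y'^{\,\mathbf c'_{\sigma(j)\sigma(l)}}_{\sigma(t),k}\varphi_{j,l})\bigr)\,a'_{\sigma(i),\sigma(j),\sigma(l)}.$$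
   Context: **Matrices.** $\mathbb F$ is an algebraically closed field, $\mathbb N=\{0,1,2,\dots\}$, $I=\{1,\dots,n\}$. Let $A$ be an $\mathbb F$-algebra with orthogonal idempotents $e_1,\dots,e_n$ summing to $1$. For $\mathbf m=(m_1,\dots,m_n)\in\mathbb N^I$ put $|\mathbf m|=\sum_i m_i$; $\mathbf 0=(0,\dots,0)$ and $\mathbf e_i\in\mathbb N^I$ is the $i$-th standard vector. For nonzero $\mathbf m,\mathbf s$, an $(\mathbf m,\mathbf s)$-type matrix over $A$ is a $|\mathbf m|\times|\mathbf s|$ block matrix $X=(X_{ij})_{i,j\in I}$ with $X_{ij}\in M_{m_i\times s_j}(e_iAe_j)$ (block rows with $m_i=0$ and block columns with $s_j=0$ are absent). If $\mathbf m=\mathbf 0$ or $\mathbf s=\mathbf 0$, the only $(\mathbf m,\mathbf s)$-type matrix is the zero matrix of size $\max(1,|\mathbf m|)\times\max(1,|\mathbf s|)$. $M_{\mathbf m\times\mathbf s}(A)$ is the $\mathbb F$-space of $(\mathbf m,\mathbf s)$-type matrices; $M_{\mathbf m}(A)=M_{\mathbf m\times\mathbf m}(A)$ is an algebra under matrix multiplication with unity $E_{\mathbf m}$, the block diagonal matrix whose $i$-th diagonal block is $e_i$ times the identity matrix of size $m_i$; $E_{\mathbf 0}=0$. A $1\times1$ matrix is identified with its entry, so $M_{\mathbf e_i\times\mathbf e_j}(A)=e_iAe_j$. **Annihilators.** An $(\mathbf m,\mathbf s)$-type matrix $X$ is column-independent if for every $\mathbf l$ and every $(\mathbf s,\mathbf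 l)$-type $Y$, $XY=0$ implies $Y=0$; it is row-independent if for every $\mathbf l$ and every $(\mathbf l,\mathbf m)$-type $Y$, $YX=0$ implies $Y=0$. An $(\mathbf s,\mathbf t)$-type $Y$ is a right universal annihilator of $X$ if $XY=0$ and for every $(\mathbf s,\mathbf l)$-type $M$ with $XM=0$ there is a unique $(\mathbf t,\mathbf l)$-type $Z$ with $M=YZ$. A $(\mathbf t,\mathbf m)$-type $Y$ is a left universal annihilator of $X$ if $YX=0$ and for every $(\mathbf l,\mathbf m)$-type $M$ with $MX=0$ there is a unique $(\mathbf l,\mathbf t)$-type $Z$ with $M=ZY$. **Admissible algebra.** A finite dimensional $\mathbb F$-algebra $A$ with a complete set of orthogonal primitive idempotents $\{e_i\}_{i\in I}$ is called admissible if: (KS) $e_iAe_jAe_i\subseteq\mathrm{rad}(e_iAe_i)$ for all $i\ne j$; (Dec) every $(\mathbf m,\mathbf s)$-type matrix is a product $X_1X_2$ of a column-independent $(\mathbf m,\mathbf t)$-type matrix $X_1$ and a row-independent $(\mathbf t,\mathbf s)$-type matrix $X_2$; (RUA) every $(\mathbf m,\mathbf s)$-type matrix has a right universal annihilator; (LUA) every $(\mathbf m,\mathbf s)$-type matrix has a left universal annihilator; (CI) if $X$ is column-independent and $Y$ is a left universal annihilator of $X$, then $X$ is a right universal annihilator of $Y$; (RI) if $X$ is row-independent and $Y$ is a right universal annihilator of $X$, then $X$ is a left universal annihilator of $Y$. **Ring and algebra map.** $R$ is a $\mathbb Z_+$-ring with finite unital $\mathbb Z_+$-basis $\{r_i\}_{i\in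 I}$, i.e. a ring free over $\mathbb Z$ with basis $\{r_i\}$, $r_1=1$, $r_ir_j=\sum_k c_{ijk}r_k$ with $c_{ijk}\in\mathbb N$; assume $r_ir_j\neq0$ for all $i,j$. Put $\mathbf c_{ij}=(c_{ij1},\dots,c_{ijn})\in\mathbb N^I$. Let $M(R,A,I)=\bigoplus_{i,i',j,j'\in I}M_{\mathbf c_{i'j'}\times\mathbf c_{ij}}(A)$, an algebra in which the product of $X$ in the summand $M_{\mathbf c_{i'j'}\times\mathbf c_{ij}}(A)$ and $Y$ in the summand $M_{\mathbf c_{i''j''}\times\mathbf c_{i_1j_1}}(A)$ is the matrix product if $(i,j)=(i'',j'')$ and $0$ otherwise. $\phi:A\otimes_{\mathbb F}A\to M(R,A,I)$ is an $\mathbb F$-algebra map with ($\phi$1) $\phi(e_i\otimes e_j)=E_{\mathbf c_{ij}}\in M_{\mathbf c_{ij}}(A)$ and ($\phi$2) $\phi(e_1\otimes a)=a\in M_{\mathbf c_{1i}\times\mathbf c_{1j}}(A)$, $\phi(a\otimes e_1)=a\in M_{\mathbf c_{i1}\times\mathbf c_{j1}}(A)$ for $a\in e_iAe_j$ (note $\mathbf c_{1i}=\mathbf c_{i1}=\mathbf e_i$). Hence $\phi$ maps $e_{i'}Ae_i\otimes e_{j'}Ae_j$ into $M_{\mathbf c_{i'j'}\times\mathbf c_{ij}}(A)$. **The product $\widehat\otimes$.** $\mathbf m\widehat\otimes\mathbf s=\sum_{i,j}m_is_j\mathbf c_{ij}$; this is associative on $\mathbb N^I$ with unit $\mathbf e_1$.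 Let $X=(x_{pp'})\in M_{\mathbf s_1\times\mathbf m_1}(A)$, $Y=(y_{qq'})\in M_{\mathbf s_2\times\mathbf m_2}(A)$. If $\mathbf m_1\widehat\otimes\mathbf m_2=\mathbf 0$ or $\mathbf s_1\widehat\otimes\mathbf s_2=\mathbf 0$, $X\widehat\otimes Y$ is the zero element of $M_{(\mathbf s_1\widehat\otimes\mathbf s_2)\times(\mathbf m_1\widehat\otimes\mathbf m_2)}(A)$. Otherwise, let $X\otimes_{\mathbb F}Y$ be the $|\mathbf s_1||\mathbf s_2|\times|\mathbf m_1||\mathbf m_2|$ matrix over $A\otimes A$ whose entry in row $(q-1)|\mathbf s_1|+p$ and column $(q'-1)|\mathbf m_1|+p'$ is $x_{pp'}\otimes y_{qq'}$. Apply $\phi$ to every entry, getting a matrix of blocks $(Z_{lk})$ with $Z_{lk}\in M_{\mathbf h_l\times\mathbf t_k}(A)$ for suitable $\mathbf h_l,\mathbf t_k$ among the $\mathbf c_{ij}$ (an entry in $e_{i'}Ae_i\otimes e_{j'}Ae_j$ gives a block of type $(\mathbf c_{i'j'},\mathbf c_{ij})$). Then $X\widehat\otimes Y=\Pi(\phi(X\otimes_{\mathbb F}Y))\in M_{(\mathbf s_1\widehat\otimes\mathbf s_2)\times(\mathbf m_1\widehat\otimes\mathbf m_2)}(A)$, where $\Pi$ permutes rows so that first come all rows of idempotent type $1$ (from block row $l=1$, then $l=2$, ..., keeping the order inside each block), then all rows of type $2$, etc., and permutes columns in the same way. **Elementary matrices.** For $m_i>0$, $1\le k\le m_i$, $Y^{\mathbf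 m}_{i,k}\in M_{\mathbf e_i\times\mathbf m}(A)$ is the row with $e_i$ in position $k+\sum_{l<i}m_l$ and $0$ elsewhere, and $X^{\mathbf m}_{i,k}\in M_{\mathbf m\times\mathbf e_i}(A)$ is its transpose. **Associator system.** A family $a_{i,j,l}\in M_{\mathbf e_i\widehat\otimes\mathbf e_j\widehat\otimes\mathbf e_l}(A)$ ($i,j,l\in I$) satisfies (Ass) if: (1) each $a_{i,j,l}$ is invertible in $M_{\mathbf e_i\widehat\otimes\mathbf e_j\widehat\otimes\mathbf e_l}(A)$; (2) $(x\widehat\otimes(y\widehat\otimes z))a_{i,j,l}=a_{i',j',l'}((x\widehat\otimes y)\widehat\otimes z)$ for all $x\in e_{i'}Ae_i$, $y\in e_{j'}Ae_j$, $z\in e_{l'}Ae_l$; (3) $a_{i,1,j}=E_{\mathbf c_{ij}}$; (4) for all $i_1,i_2,i_3,i_4\in I$, $$\sum_{j=1}^n\sum_{1\le k\le c_{i_2i_3j}}\bigl(e_{i_1}\widehat\otimes a_{i_2,i_3,i_4}(X^{\mathbf c_{i_2i_3}}_{j,k}\widehat\otimes e_{i_4})\bigr)a_{i_1,j,i_4}\bigl((e_{i_1}\widehat\otimes Y^{\mathbf c_{i_2i_3}}_{j,k})a_{i_1,i_2,i_3}\widehat\otimes e_{i_4}\bigr)$$ $$=\sum_{j,j'=1}^n\sum_{1\le k\le c_{i_3i_4j}}\sum_{1\le k'\le c_{i_1i_2j'}}\bigl(e_{i_1}\widehat\otimes(e_{i_2}\widehat\otimes X^{\mathbf c_{i_3i_4}}_{j,k})\bigr)a_{i_1,i_2,j}\bigl(X^{\mathbf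 c_{i_1i_2}}_{j',k'}\widehat\otimes Y^{\mathbf c_{i_3i_4}}_{j,k}\bigr)a_{j',i_3,i_4}\bigl((Y^{\mathbf c_{i_1i_2}}_{j',k'}\widehat\otimes e_{i_3})\widehat\otimes e_{i_4}\bigr).$$ For $\mathbf m,\mathbf s,\mathbf t\in\mathbb N^I$ put $a_{\mathbf m,\mathbf s,\mathbf t}=0=E_{\mathbf 0}$ if $\mathbf m\widehat\otimes\mathbf s\widehat\otimes\mathbf t=\mathbf 0$, and otherwise $$a_{\mathbf m,\mathbf s,\mathbf t}=\sum_{i,j,l:\,m_is_jt_l>0}\sum_{k_1=1}^{m_i}\sum_{k_2=1}^{s_j}\sum_{k_3=1}^{t_l}\bigl(X^{\mathbf m}_{i,k_1}\widehat\otimes(X^{\mathbf s}_{j,k_2}\widehat\otimes X^{\mathbf t}_{l,k_3})\bigr)a_{i,j,l}\bigl((Y^{\mathbf m}_{i,k_1}\widehat\otimes Y^{\mathbf s}_{j,k_2})\widehat\otimes Y^{\mathbf t}_{l,k_3}\bigr).$$ **Admissible datum.** $(R,A,\phi,\{a_{i,j,l}\})$ is an admissible datum if $R$ is a $\mathbb Z_+$-ring with finite unital $\mathbb Z_+$-basis $\{r_i\}_{i\in I}$ such that $r_1=1$ and $r_ir_j\neq0$ for all $i,j\in I$, $A$ is an admissible algebra with $\dim_{\mathbb F}(e_1Ae_1)=1$, $\phi:A\otimes_{\mathbb F}A\to M(R,A,I)$ is an $\mathbb F$-algebra map satisfying ($\phi$1) and ($\phi$2), and $\{a_{i,j,l}\}$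 satisfies (Ass). **The tensor category $\widehat{\mathcal C}$.** Objects: $\mathbb N^I$; $\mathrm{Hom}_{\widehat{\mathcal C}}(\mathbf m,\mathbf s)=M_{\mathbf s\times\mathbf m}(A)$; composition is matrix multiplication. It is a tensor (i.e. $\mathbb F$-linear monoidal) category with tensor product $\widehat\otimes$ (written $\otimes_{\widehat{\mathcal C}}$ in the claim), unit object $\mathbf e_1$, associativity constraint $a_{\mathbf m,\mathbf s,\mathbf t}:(\mathbf m\widehat\otimes\mathbf s)\widehat\otimes\mathbf t\to\mathbf m\widehat\otimes(\mathbf s\widehat\otimes\mathbf t)$ and identity unit constraints. $\widehat{\mathcal C'}$ is built in the same way from the primed datum; $E'_{\mathbf m}$, $X'^{\mathbf m}_{i,k}$, $Y'^{\mathbf m}_{i,k}$ denote the matrices $E_{\mathbf m}$, $X^{\mathbf m}_{i,k}$, $Y^{\mathbf m}_{i,k}$ formed over $A'$ with the idempotents $e'_i$. **Permutation matrices.** For a permutation $\sigma$ of $I$ and $\mathbf m\in\mathbb N^I$, $\mathbf m^\sigma=(m_{\sigma^{-1}(1)},\dots,m_{\sigma^{-1}(n)})$, so $\mathbf e_i^\sigma=\mathbf e_{\sigma(i)}$. For $\mathbf m\ne\mathbf 0$, $P_\sigma(\mathbf m)=(P_{ij})_{i,j\in I}$ is the $|\mathbf m|\times|\mathbf m|$ block permutation matrix whose $(i,j)$ block has size $m_{\sigma^{-1}(i)}\times m_j$ and equals the identity matrix $I_{m_j}$ if $j=\sigma^{-1}(i)$ and $0$ otherwise (blocks of zero height or width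 are absent); $P_\sigma(\mathbf 0)=0$. $^T$ denotes transpose. **Tensor equivalence.** Two tensor categories are tensor equivalent if there is a tensor functor $(F,\varphi_0,\varphi_2)$ between them (with $\varphi_0:\mathbf 1\to F(\mathbf 1)$ an isomorphism and $\varphi_2(U,W):F(U)\otimes F(W)\to F(U\otimes W)$ natural isomorphisms compatible with associativity and unit constraints) such that $F$ is an equivalence of categories. All functors are assumed $\mathbb F$-linear. *)

(* Defs.v *)
From HB Require Import structures.
From mathcomp Require Import all_boot all_order all_fingroup all_algebra all_field.
Set Implicit Arguments.
Unset Strict Implicit.
Unset Printing Implicit Defensive.
Import GRing.Theory.
Local Open Scope ring_scope.

Section TensorProduct.
Variables (F : fieldType) (A B : falgType F).

(* A tensor B over F, by coordinates in bases of A and B: the (i, j) entry is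
   the coefficient of (vbasis {:A})`_i tensor (vbasis {:B})`_j. *)
Definition tensor : Type := 'M[F]_(\dim {:A}, \dim {:B}).

HB.instance Definition _ := GRing.Lmodule.on tensor.

Definition tens (a : A) (b : B) : tensor :=
  \matrix_(i, j) (coord (vbasis {:A}) i a * coord (vbasis {:B}) j b).

Definition tens_one : tensor := tens 1 1.

Definition tens_mul (x y : tensor) : tensor :=
  \sum_i \sum_j \sum_k \sum_l (x i j * y k l) *:
     tens ((vbasis {:A})`_i * (vbasis {:A})`_k)
          ((vbasis {:B})`_j * (vbasis {:B})`_l).

Lemma tens_linearl (b : B) : linear (tens^~ b).
Proof.
by move=> c a a'; apply/matrixP=> i j; rewrite !mxE linearP /= mulrDl mulrA.
Qed.

Lemma tens_linearr (a : A) : linear (tens a).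
Proof.
move=> c b b'; apply/matrixP=> i j.
by rewrite !mxE linearP /= mulrDr !mulrA [_ * c]mulrC.
Qed.

Lemma tens_suml (I : Type) (r : seq I) (P : pred I) (c : I -> F) f b :
  tens (\sum_(i <- r | P i) c i *: f i) b =
  \sum_(i <- r | P i) c i *: tens (f i) b.
Proof.
apply: (big_rec2 (fun x y => tens x b = y)) => [|i x y _ <-].
  by apply/matrixP=> i j; rewrite !mxE linear0 mul0r.
exact: tens_linearl.
Qed.

Lemma tens_sumr (I : Type) (r : seq I) (P : pred I) (c : I -> F) a f :
  tens a (\sum_(i <- r | P i) c i *: f i) =
  \sum_(i <- r | P i) c i *: tens a (f i).
Proof.
apply: (big_rec2 (fun x y => tens a x = y)) => [|i x y _ <-].
  by apply/matrixP=> i j; rewrite !mxE linear0 mulr0.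
exact: tens_linearr.
Qed.

Lemma tens_span (x : tensor) :
  x = \sum_i \sum_j x i j *: tens (vbasis {:A})`_i (vbasis {:B})`_j.
Proof.
apply/matrixP=> i j; rewrite summxE (bigD1 i) //= summxE (bigD1 j) //=.
rewrite !mxE !coord_free ?(basis_free (vbasisP _)) // !eqxx !mulr1.
rewrite !big1 ?addr0 // => [i' ne_i | j' ne_j].
  rewrite summxE big1 // => j' _; rewrite !mxE coord_free ?(basis_free (vbasisP _)) //.
  by rewrite (negPf ne_i) mul0r mulr0.
by rewrite !mxE !coord_free ?(basis_free (vbasisP _)) // (negPf ne_j) !mulr0.
Qed.

Lemma tens_mulDl : left_distributive tens_mul +%R.
Proof.
move=> x y z; rewrite /tens_mul -big_split; apply: eq_bigr => i _ /=.
rewrite -big_split; apply: eq_bigr => j _ /=.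
rewrite -big_split; apply: eq_bigr => k _ /=.
by rewrite -big_split; apply: eq_bigr => l _ /=; rewrite mxE mulrDl scalerDl.
Qed.

Lemma tens_mulDr : right_distributive tens_mul +%R.
Proof.
move=> x y z; rewrite /tens_mul -big_split; apply: eq_bigr => i _ /=.
rewrite -big_split; apply: eq_bigr => j _ /=.
rewrite -big_split; apply: eq_bigr => k _ /=.
by rewrite -big_split; apply: eq_bigr => l _ /=; rewrite mxE mulrDr scalerDl.
Qed.

Lemma tens_mulZl c x y : tens_mul (c *: x) y = c *: tens_mul x y.
Proof.
rewrite /tens_mul; do 4![rewrite scaler_sumr; apply: eq_bigr => ? _].
by rewrite mxE scalerA !mulrA.
Qed.

Lemma tens_mulZr c x y : tens_mul x (c *: y) = c *: tens_mul x y.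
Proof.
rewrite /tens_mul; do 4![rewrite scaler_sumr; apply: eq_bigr => ? _].
by rewrite mxE scalerA mulrCA.
Qed.

Lemma tens_mulE a b a' b' :
  tens_mul (tens a b) (tens a' b') = tens (a * a') (b * b').
Proof.
have Ea (u : A) : u = \sum_i coord (vbasis {:A}) i u *: (vbasis {:A})`_i.
  exact/coord_vbasis/memvf.
have Eb (u : B) : u = \sum_i coord (vbasis {:B}) i u *: (vbasis {:B})`_i.
  exact/coord_vbasis/memvf.
rewrite [in RHS](Ea a) mulr_suml.
under eq_bigr do rewrite -scalerAl.
rewrite tens_suml /tens_mul; apply: eq_bigr => i _.
rewrite [in RHS](Eb b) mulr_suml.
under [in RHS]eq_bigr do rewrite -scalerAl.
rewrite tens_sumr scaler_sumr; apply: eq_bigr => j _.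
rewrite [in RHS](Ea a') mulr_sumr.
under [in RHS]eq_bigr do rewrite -scalerAr.
rewrite tens_suml !scaler_sumr; apply: eq_bigr => k _.
rewrite [in RHS](Eb b') mulr_sumr.
under [in RHS]eq_bigr do rewrite -scalerAr.
rewrite tens_sumr !scaler_sumr; apply: eq_bigr => l _.
by rewrite !mxE !scalerA !mulrA.
Qed.

Lemma tens_ind (P : tensor -> Prop) :
  P 0 -> (forall c a b y, P y -> P (c *: tens a b + y)) -> forall x, P x.
Proof.
move=> P0 PD x; rewrite [x]tens_span pair_big /=.
by elim/big_rec: _ => // i y _; apply: PD.
Qed.

Lemma tens_mul0 x : tens_mul 0 x = 0.
Proof. by rewrite -[X in tens_mul X _](scale0r 0) tens_mulZl scale0r. Qed.

Lemma tens_mulr0 x : tens_mul x 0 = 0.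
Proof. by rewrite -[X in tens_mul _ X](scale0r 0) tens_mulZr scale0r. Qed.

Lemma tens_mulA : associative tens_mul.
Proof.
move=> x y z; elim/tens_ind: x => [|c a b x IH]; first by rewrite !tens_mul0.
rewrite !tens_mulDl !tens_mulZl {}IH; congr (_ *: _ + _).
elim/tens_ind: y => [|d a' b' y IH].
  by rewrite !(tens_mulr0, tens_mul0).
rewrite !(tens_mulDl, tens_mulDr) !(tens_mulZl, tens_mulZr) {}IH.
congr (_ *: _ + _).
elim/tens_ind: z => [|f a'' b'' z IH]; first by rewrite !tens_mulr0.
by rewrite !tens_mulDr !tens_mulZr {}IH !tens_mulE !mulrA.
Qed.

Lemma tens_mul1x : left_id tens_one tens_mul.
Proof.
move=> x; elim/tens_ind: x => [|c a b x IH]; first by rewrite tens_mulr0.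
by rewrite tens_mulDr tens_mulZr IH tens_mulE !mul1r.
Qed.

Lemma tens_mulx1 : right_id tens_one tens_mul.
Proof.
move=> x; elim/tens_ind: x => [|c a b x IH]; first by rewrite tens_mul0.
by rewrite tens_mulDl tens_mulZl IH tens_mulE !mulr1.
Qed.

Lemma tens_one_neq0 : tens_one != 0.
Proof.
have Cn0 (V : falgType F) : exists i, coord (vbasis {:V}) i 1 != 0.
  apply/existsP; apply: contra_neqT (oner_neq0 V) => /existsPn h.
  rewrite (coord_vbasis (memvf 1)) big1 // => i _.
  by have:= h i; rewrite negbK => /eqP->; rewrite scale0r.
have [[i ni] [j nj]] := (Cn0 A, Cn0 B).
apply/eqP=> /matrixP/(_ i j)/eqP.
by rewrite !mxE mulf_eq0 (negPf ni) (negPf nj).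
Qed.

HB.instance Definition _ := GRing.Zmodule_isNzRing.Build tensor
  tens_mulA tens_mul1x tens_mulx1 tens_mulDl tens_mulDr tens_one_neq0.
HB.instance Definition _ := GRing.Lmodule_isLalgebra.Build F tensor
  (fun c x y => esym (tens_mulZl c x y)).
HB.instance Definition _ := GRing.Lalgebra_isAlgebra.Build F tensor
  (fun c x y => esym (tens_mulZr c x y)).

End TensorProduct.

Section Vectors.
Variable n : nat.

Definition nvec := {ffun 'I_n.+1 -> nat}.

Definition mdim (m : nvec) : nat := \sum_i m i.

Definition ee (i : 'I_n.+1) : nvec := [ffun k => (k == i) : nat].

(* A row index p < |m| is of idempotent type [ty p]; it is the [pos p]-th row
   of that type, and [idx k] is the k-th row of type i. *)
Definition ty (m : nvec) (p : 'I_(mdim m)) : 'I_n.+1 := tagnat.sig1 p.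
Definition pos (m : nvec) (p : 'I_(mdim m)) : 'I_(m (ty p)) := tagnat.sig2 p.
Definition idx (m : nvec) (i : 'I_n.+1) (k : 'I_(m i)) : 'I_(mdim m) :=
  tagnat.Rank i k.

Lemma ty_idx (m : nvec) i (k : 'I_(m i)) : ty (idx k) = i.
Proof. exact: tagnat.Rank1K. Qed.

Lemma mdim_ee i : mdim (ee i) = 1%N.
Proof.
rewrite /mdim (bigD1 i) //= ffunE eqxx big1 ?addn0 // => j.
by rewrite ffunE => /negPf->.
Qed.

Lemma big_mdim (m : nvec) (f : 'I_n.+1 -> nat) :
  (\sum_(p < mdim m) f (ty p) = \sum_i m i * f i)%N.
Proof.
transitivity (\sum_i \sum_(k < m i) f i)%N; last first.
  by apply: eq_bigr => i _; rewrite sum_nat_const card_ord.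
rewrite sig_big_dep /= (reindex _ tagnat.sig_bij_on) /=.
by apply: eq_bigr.
Qed.

Variable c : 'I_n.+1 -> 'I_n.+1 -> nvec.

Definition hatv (m s : nvec) : nvec :=
  [ffun k => (\sum_i \sum_j m i * s j * c i j k)%N].

Lemma hatv_blocks (m s : nvec) k :
  (hatv m s k = \sum_(q < mdim s) \sum_(p < mdim m) c (ty p) (ty q) k)%N.
Proof.
rewrite (big_mdim _ (fun j => \sum_(p < mdim m) c (ty p) j k)%N) ffunE.
rewrite exchange_big; apply: eq_bigr => j _ /=.
rewrite (big_mdim _ (fun i => c i j k)) big_distrr; apply: eq_bigr => i _ /=.
by rewrite mulnCA mulnA.
Qed.

Lemma hatv_ee i j : hatv (ee i) (ee j) = c i j.
Proof.
apply/ffunP=> k; rewrite ffunE (bigD1 i) //= (bigD1 j) //= !ffunE !eqxx mul1n.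
rewrite !big1 ?addn0 ?mul1n // => [i' /negPf ni|j' /negPf nj].
  by rewrite big1 // => j' _; rewrite !ffunE ni.
by rewrite !ffunE nj.
Qed.

(* Rows of X hat-tensor Y: the u-th row, of type [ty u], is the [hrow u]-th row
   of the block row coming from row [hp u] of X and row [hq u] of Y. Inside a
   type, the block rows are ordered lexicographically by (hq, hp). *)
Section Rows.
Variables (m s : nvec) (u : 'I_(mdim (hatv m s))).
Definition hcell := cast_ord (hatv_blocks m s (ty u)) (pos u).
Definition hq : 'I_(mdim s) := tagnat.sig1 hcell.
Definition hp : 'I_(mdim m) := tagnat.sig1 (tagnat.sig2 hcell).
Definition hrow : 'I_(mdim (c (ty hp) (ty hq))) :=
  idx (tagnat.sig2 (tagnat.sig2 hcell)).

Lemma ty_hrow : ty hrow = ty u.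
Proof. exact: ty_idx. Qed.
End Rows.

End Vectors.

Section ZplusRing.
Variables (n : nat) (R : nzRingType) (r : 'I_n.+1 -> R).
Variable c : 'I_n.+1 -> 'I_n.+1 -> nvec n.

Record zplus_ring : Prop := ZplusRing {
  zplus_basis : forall x : R,
    exists! z : {ffun 'I_n.+1 -> int}, x = \sum_i r i *~ z i;
  zplus_one : r ord0 = 1;
  zplus_mul : forall i j, r i * r j = \sum_k r k *+ c i j k;
  zplus_neq0 : forall i j, r i * r j != 0
}.

Hypothesis zR : zplus_ring.

Lemma zplus_inj (m s : nvec n) :
  \sum_k r k *+ m k = \sum_k r k *+ s k -> m = s.
Proof.
move=> eq_ms; have [z [_ zU]] := zplus_basis zR (\sum_k r k *+ m k).
have Ez (t : nvec n) : \sum_k r k *+ m k = \sum_k r k *+ t k ->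
    z = [ffun k => Posz (t k)].
  by move=> Et; apply: zU; rewrite Et; apply: eq_bigr => k _; rewrite ffunE.
have /ffunP E : [ffun k => Posz (m k)] = [ffun k => Posz (s k)].
  by rewrite -(Ez m) // -(Ez s).
by apply/ffunP=> k; have:= E k; rewrite !ffunE => -[].
Qed.

Lemma sum_ee i : \sum_k r k *+ ee i k = r i.
Proof.
rewrite (bigD1 i) //= ffunE eqxx big1 ?addr0 // => j.
by rewrite ffunE => /negPf->.
Qed.

Lemma zplus_c1l i : c ord0 i = ee i.
Proof. by apply: zplus_inj; rewrite -zplus_mul // zplus_one // mul1r sum_ee. Qed.

Lemma zplus_c1r i : c i ord0 = ee i.
Proof. by apply: zplus_inj; rewrite -zplus_mul // zplus_one // mulr1 sum_ee. Qed.

Lemma hatv1l m : hatv c (ee ord0) m = m.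
Proof.
apply/ffunP=> k; rewrite ffunE (bigD1 ord0) //= [X in (_ + X)%N]big1.
  rewrite addn0 (bigD1 k) //= big1 => [|j nj].
    by rewrite zplus_c1l !ffunE !eqxx mul1n muln1 addn0.
  by rewrite zplus_c1l !ffunE [k == j]eq_sym (negPf nj) muln0.
by move=> i /negPf ni; rewrite big1 // => j _; rewrite !ffunE ni.
Qed.

Lemma hatv1r m : hatv c m (ee ord0) = m.
Proof.
apply/ffunP=> k; rewrite ffunE exchange_big (bigD1 ord0) //= [X in (_ + X)%N]big1.
  rewrite addn0 (bigD1 k) //= big1 => [|j nj].
    by rewrite zplus_c1r !ffunE !eqxx !muln1 addn0.
  by rewrite zplus_c1r !ffunE [k == j]eq_sym (negPf nj) muln0.
by move=> i /negPf ni; rewrite big1 // => j _; rewrite !ffunE ni muln0.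
Qed.

Lemma hatv_unitr i j : hatv c (ee i) (hatv c (ee ord0) (ee j)) = c i j.
Proof. by rewrite hatv1l hatv_ee. Qed.

Lemma hatv_unitl i j : hatv c (hatv c (ee i) (ee ord0)) (ee j) = c i j.
Proof. by rewrite hatv1r hatv_ee. Qed.

End ZplusRing.

Section TypedMatrices.
Variables (F : fieldType) (A : falgType F) (n : nat) (e : 'I_n.+1 -> A).

(* e_i A e_j *)
Definition corner (i j : 'I_n.+1) : {vspace A} := (<[e i]> * {:A} * <[e j]>)%VS.

Definition mtyped (m s : nvec n) (X : 'M[A]_(mdim m, mdim s)) : bool :=
  [forall p, forall q, X p q \in corner (ty p) (ty q)].

Definition Emx (m : nvec n) : 'M[A]_(mdim m) :=
  \matrix_(p, q) (e (ty p) *+ (p == q)).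

(* The 1 x 1 matrix identified with x in e_i A e_j; note [mdim_ee]. *)
Definition mx1 (i j : 'I_n.+1) (x : A) : 'M[A]_(mdim (ee i), mdim (ee j)) :=
  const_mx x.

Definition Xmx (m : nvec n) (i : 'I_n.+1) (k : 'I_(m i)) :
    'M[A]_(mdim m, mdim (ee i)) :=
  \matrix_(p, q) (e i *+ (p == idx k)).

Definition Ymx (m : nvec n) (i : 'I_n.+1) (k : 'I_(m i)) :
    'M[A]_(mdim (ee i), mdim m) :=
  \matrix_(q, p) (e i *+ (p == idx k)).

Definition mcast (m m' s s' : nvec n) (em : m = m') (es : s = s')
    (X : 'M[A]_(mdim m, mdim s)) : 'M[A]_(mdim m', mdim s') :=
  castmx (congr1 (@mdim n) em, congr1 (@mdim n) es) X.

Definition minvertible (m s : nvec n) (X : 'M[A]_(mdim m, mdim s)) : Prop :=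
  mtyped X /\ exists Y : 'M[A]_(mdim s, mdim m),
    [/\ mtyped Y, X *m Y = Emx m & Y *m X = Emx s].

Definition col_independent (m s : nvec n) (X : 'M[A]_(mdim m, mdim s)) : Prop :=
  mtyped X /\ forall (l : nvec n) (Y : 'M[A]_(mdim s, mdim l)),
    mtyped Y -> X *m Y = 0 -> Y = 0.

Definition row_independent (m s : nvec n) (X : 'M[A]_(mdim m, mdim s)) : Prop :=
  mtyped X /\ forall (l : nvec n) (Y : 'M[A]_(mdim l, mdim m)),
    mtyped Y -> Y *m X = 0 -> Y = 0.

Definition right_univ_annihilator (m s t : nvec n)
    (X : 'M[A]_(mdim m, mdim s)) (Y : 'M[A]_(mdim s, mdim t)) : Prop :=
  [/\ mtyped Y, X *m Y = 0 &
      forall (l : nvec n) (M : 'M[A]_(mdim s, mdim l)),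
        mtyped M -> X *m M = 0 ->
        exists! Z : 'M[A]_(mdim t, mdim l), mtyped Z /\ M = Y *m Z].

Definition left_univ_annihilator (m s t : nvec n)
    (X : 'M[A]_(mdim m, mdim s)) (Y : 'M[A]_(mdim t, mdim m)) : Prop :=
  [/\ mtyped Y, Y *m X = 0 &
      forall (l : nvec n) (M : 'M[A]_(mdim l, mdim m)),
        mtyped M -> M *m X = 0 ->
        exists! Z : 'M[A]_(mdim l, mdim t), mtyped Z /\ M = Z *m Y].

Definition primitive_idempotent (x : A) : Prop :=
  [/\ x != 0, x * x = x &
      forall f g : A, f * f = f -> g * g = g -> f * g = 0 -> g * f = 0 ->
        x = f + g -> f = 0 \/ g = 0].

Definition left_ideal (i : 'I_n.+1) (L : {vspace A}) : Prop :=
  (L <= corner i i)%VS /\ (corner i i * L <= L)%VS.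

Definition maximal_left_ideal (i : 'I_n.+1) (L : {vspace A}) : Prop :=
  [/\ left_ideal i L, L <> corner i i &
      forall L' : {vspace A}, left_ideal i L' -> (L <= L')%VS ->
        L' = L \/ L' = corner i i].

(* The Jacobson radical of e_i A e_i; a left ideal of this algebra is the same
   thing as a left ideal which is a subspace, since the algebra is unital. *)
Definition rad_corner (i : 'I_n.+1) (x : A) : Prop :=
  x \in corner i i /\
  forall L : {vspace A}, maximal_left_ideal i L -> x \in L.

Record admissible_algebra : Prop := AdmissibleAlgebra {
  adm_primitive : forall i, primitive_idempotent (e i);
  adm_orthogonal : forall i j, i != j -> e i * e j = 0;
  adm_complete : \sum_i e i = 1;
  adm_KS : forall i j, i != j ->
    forall x, x \in (corner i j * corner j i)%VS -> rad_corner i x;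
  adm_Dec : forall (m s : nvec n) (X : 'M[A]_(mdim m, mdim s)), mtyped X ->
    exists (t : nvec n) (X1 : 'M[A]_(mdim m, mdim t))
           (X2 : 'M[A]_(mdim t, mdim s)),
      [/\ col_independent X1, row_independent X2 & X = X1 *m X2];
  adm_RUA : forall (m s : nvec n) (X : 'M[A]_(mdim m, mdim s)), mtyped X ->
    exists (t : nvec n) (Y : 'M[A]_(mdim s, mdim t)),
      right_univ_annihilator X Y;
  adm_LUA : forall (m s : nvec n) (X : 'M[A]_(mdim m, mdim s)), mtyped X ->
    exists (t : nvec n) (Y : 'M[A]_(mdim t, mdim m)),
      left_univ_annihilator X Y;
  adm_CI : forall (m s t : nvec n) (X : 'M[A]_(mdim m, mdim s))
      (Y : 'M[A]_(mdim t, mdim m)),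
    col_independent X -> left_univ_annihilator X Y ->
    right_univ_annihilator Y X;
  adm_RI : forall (m s t : nvec n) (X : 'M[A]_(mdim m, mdim s))
      (Y : 'M[A]_(mdim s, mdim t)),
    row_independent X -> right_univ_annihilator X Y ->
    left_univ_annihilator Y X
}.

(* Only the idempotent relations are needed for matrices to form a category. *)
Hypothesis e_idem : forall i, e i * e i = e i.

Lemma cornerP i j x : reflect (x = e i * x * e j) (x \in corner i j).
Proof.
apply: (iffP idP) => [|->]; last by rewrite !memv_mul ?memv_line ?memvf.
have line k u : u \in <[e k]>%VS -> u = e k * u /\ u = u * e k.
  by case/vlineP=> l ->; rewrite -scalerAr -scalerAl e_idem.
suff /subvP h : (corner i j <= lker (\1 - (amulr (e j) \o amull (e i)))%VF)%VS.
  move=> /h; rewrite memv_ker !lfun_simp.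
  by rewrite /= subr_eq0 => /eqP.
apply/prodvP=> u v hu hv; rewrite memv_ker !lfun_simp.
rewrite /= subr_eq0.
have [_ Ev] := line _ _ hv; rewrite -!mulrA -Ev mulrA.
suff /subvP h : (<[e i]> * {:A} <= lker (\1 - amull (e i))%VF)%VS.
  have:= h _ hu; rewrite memv_ker !lfun_simp /= subr_eq0.
  by move=> /eqP<-.
apply/prodvP=> u' w hu' _; rewrite memv_ker !lfun_simp /=.
by have [Eu _] := line _ _ hu'; rewrite mulrA -Eu subrr.
Qed.
Lemma corner_id i : e i \in corner i i.
Proof. by apply/cornerP; rewrite !e_idem. Qed.

Lemma mtypedP (m s : nvec n) (X : 'M[A]_(mdim m, mdim s)) :
  reflect (forall p q, X p q \in corner (ty p) (ty q)) (mtyped X).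
Proof.
apply: (iffP forallP) => [h p|h p]; first by apply/forallP/h.
by apply/forallP=> q; apply: h.
Qed.

Lemma mtyped_mul (m s t : nvec n) (X : 'M[A]_(mdim m, mdim s))
    (Y : 'M[A]_(mdim s, mdim t)) : mtyped X -> mtyped Y -> mtyped (X *m Y).
Proof.
move=> /mtypedP tX /mtypedP tY; apply/mtypedP=> p q; rewrite mxE.
apply: memv_suml => k _; have /cornerP-> := tX p k; have /cornerP-> := tY k q.
by rewrite -mulrA -!(mulrA (e _)) !mulrA; apply/cornerP;
  rewrite !mulrA e_idem -!mulrA e_idem.
Qed.

Lemma mtyped_E (m : nvec n) : mtyped (Emx m).
Proof.
apply/mtypedP=> p q; rewrite mxE.
by case: eqP => [->|_]; [apply: corner_id | apply: mem0v].
Qed.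

Lemma mulEmx (m s : nvec n) (X : 'M[A]_(mdim m, mdim s)) :
  mtyped X -> Emx m *m X = X.
Proof.
move=> /mtypedP tX; apply/matrixP=> p q; rewrite mxE (bigD1 p) //= mxE eqxx.
have /cornerP-> := tX p q; rewrite !mulrA e_idem big1 ?addr0 // => k nk.
by rewrite mxE eq_sym (negPf nk) mul0r.
Qed.

Lemma mulmxE (m s : nvec n) (X : 'M[A]_(mdim m, mdim s)) :
  mtyped X -> X *m Emx s = X.
Proof.
move=> /mtypedP tX; apply/matrixP=> p q; rewrite mxE (bigD1 q) //= mxE eqxx.
have /cornerP-> := tX p q; rewrite -!mulrA e_idem big1 ?addr0 // => k nk.
by rewrite mxE (negPf nk) mulr0.
Qed.

Lemma ty_ee (i : 'I_n.+1) (p : 'I_(mdim (ee i))) : ty p = i.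
Proof.
have: (0 < ee i (ty p))%N by exact: leq_ltn_trans (leq0n _) (ltn_ord (pos p)).
by rewrite ffunE; case: eqP.
Qed.

Lemma mtyped_X (m : nvec n) i (k : 'I_(m i)) : mtyped (Xmx k).
Proof.
apply/mtypedP=> p q; rewrite mxE ty_ee.
case: eqP => [->|_]; last exact: mem0v.
by rewrite ty_idx; apply: corner_id.
Qed.

Lemma mtyped_Y (m : nvec n) i (k : 'I_(m i)) : mtyped (Ymx k).
Proof.
apply/mtypedP=> q p; rewrite mxE ty_ee.
case: eqP => [->|_]; last exact: mem0v.
by rewrite ty_idx; apply: corner_id.
Qed.

Lemma mtyped_cast (m m' s s' : nvec n) (em : m = m') (es : s = s')
    (X : 'M[A]_(mdim m, mdim s)) : mtyped X -> mtyped (mcast em es X).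
Proof. by case: m' / em; case: s' / es; rewrite /mcast castmx_id. Qed.

Fact mtyped_zmod_closed (m s : nvec n) : zmod_closed (@mtyped m s).
Proof.
split=> [|X Y /mtypedP tX /mtypedP tY]; apply/mtypedP=> p q; rewrite !mxE.
  exact: mem0v.
exact: memvB.
Qed.

HB.instance Definition _ (m s : nvec n) :=
  GRing.isZmodClosed.Build 'M[A]_(mdim m, mdim s) (@mtyped m s)
    (mtyped_zmod_closed m s).

Lemma mtyped_sum (m s : nvec n) (K : Type) (w : seq K) (P : pred K)
    (f : K -> 'M[A]_(mdim m, mdim s)) :
  (forall k, P k -> mtyped (f k)) -> mtyped (\sum_(k <- w | P k) f k).
Proof.
move=> tf; apply/mtypedP=> p q; rewrite summxE.
by apply: memv_suml => k Pk; have /mtypedP := tf k Pk.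
Qed.

Record tmx (m s : nvec n) := TMx {
  tmxval :> 'M[A]_(mdim m, mdim s);
  tmxP : mtyped tmxval
}.

HB.instance Definition _ (m s : nvec n) := [isSub for @tmxval m s].
HB.instance Definition _ (m s : nvec n) := [Choice of tmx m s by <:].
HB.instance Definition _ (m s : nvec n) :=
  [SubChoice_isSubZmodule of tmx m s by <:].

Fact mtyped_scale (m s : nvec n) (k : F) (X : tmx m s) : mtyped (k%:A *: \val X).
Proof.
apply/mtypedP=> p q; rewrite mxE mulr_algl; apply: memvZ.
exact: (mtypedP _ (tmxP X)).
Qed.

Definition tmx_scale (m s : nvec n) (k : F) (X : tmx m s) : tmx m s :=
  TMx (mtyped_scale k X).

Section TmxLmodule.
Variables m s : nvec n.

Fact tmx_scaleA a b (X : tmx m s) :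
  tmx_scale a (tmx_scale b X) = tmx_scale (a * b) X.
Proof.
by apply: val_inj; apply/matrixP=> p q; rewrite !mxE !mulr_algl scalerA.
Qed.

Fact tmx_scale1 : left_id 1 (@tmx_scale m s).
Proof.
by move=> X; apply: val_inj; apply/matrixP=> p q; rewrite !mxE mulr_algl scale1r.
Qed.

Fact tmx_scaleDr : right_distributive (@tmx_scale m s) +%R.
Proof.
move=> a X Y; apply: val_inj; apply/matrixP=> p q.
by rewrite !mxE !mulr_algl scalerDr.
Qed.

Fact tmx_scaleDl X : {morph (@tmx_scale m s)^~ X : a b / a + b}.
Proof.
move=> a b; apply: val_inj; apply/matrixP=> p q.
by rewrite !mxE !mulr_algl scalerDl.
Qed.

HB.instance Definition _ := GRing.Zmodule_isLmodule.Build F (tmx m s)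
  tmx_scaleA tmx_scale1 tmx_scaleDr tmx_scaleDl.
End TmxLmodule.

End TypedMatrices.

Section TensorOfMatrices.
Variables (F : fieldType) (A : falgType F) (n : nat) (e : 'I_n.+1 -> A).
Variable c : 'I_n.+1 -> 'I_n.+1 -> nvec n.

(* Families (Z i' j' i j) of blocks of M(R, A, I); [alg_map] requires the
   blocks to be matrices over A of type (c i' j', c i j). *)
Definition MRAI : Type :=
  forall i' j' i j : 'I_n.+1, 'M[A]_(mdim (c i' j'), mdim (c i j)).

(* Z is X, sitting in the summand with indices (i', j', i, j). *)
Definition in_summand (Z : MRAI) (i' j' i j : 'I_n.+1)
    (X : 'M[A]_(mdim (c i' j'), mdim (c i j))) : Prop :=
  Z i' j' i j = X /\
  forall k' l' k l, (k', l', k, l) != (i', j', i, j) -> Z k' l' k l = 0.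

Variable phi : tensor A A -> MRAI.

Record alg_map : Prop := AlgMap {
  am_typed : forall x i' j' i j, mtyped e (phi x i' j' i j);
  am_linear : forall (k : F) x y i' j' i j,
    phi (k *: x + y) i' j' i j = k%:A *: phi x i' j' i j + phi y i' j' i j;
  am_mul : forall x y i' j' i j,
    phi (x * y) i' j' i j =
    \sum_k \sum_l phi x i' j' k l *m phi y k l i j;
  am_one : forall i j, phi 1 i j i j = Emx e (c i j);
  am_one0 : forall i' j' i j, (i', j') != (i, j) -> phi 1 i' j' i j = 0
}.

Definition phi1 : Prop :=
  forall i j, in_summand (phi (tens (e i) (e j))) (Emx e (c i j)).

(* [const_mx a] is the 1 x 1 matrix a, as c 1 i = c i 1 = e_i. *)
Definition phi2 : Prop :=
  forall i j a, a \in corner e i j ->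
    in_summand (phi (tens (e ord0) a))
      (const_mx a : 'M_(mdim (c ord0 i), mdim (c ord0 j))) /\
    in_summand (phi (tens a (e ord0)))
      (const_mx a : 'M_(mdim (c i ord0), mdim (c j ord0))).

Definition hatmx (s1 m1 s2 m2 : nvec n) (X : 'M[A]_(mdim s1, mdim m1))
    (Y : 'M[A]_(mdim s2, mdim m2)) :
    'M[A]_(mdim (hatv c s1 s2), mdim (hatv c m1 m2)) :=
  \matrix_(u, v)
    phi (tens (X (hp u) (hp v)) (Y (hq u) (hq v)))
        (ty (hp u)) (ty (hq u)) (ty (hp v)) (ty (hq v)) (hrow u) (hrow v).

Local Notation "m '*o' s" := (hatv c m s) (at level 40, left associativity).
Local Notation "X '*t' Y" := (hatmx X Y) (at level 40, left associativity).
Local Notation X := (Xmx e).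
Local Notation Y := (Ymx e).
Local Notation id1 i := (mx1 i i (e i)).

(* The associativity of *o is not an equality of types, so that a_{i,j,l} has
   its rows indexed by e_i *o (e_j *o e_l) and its columns by
   (e_i *o e_j) *o e_l. For the same reason [ee i *o ee j] is used in place of
   [c i j], see [hatv_ee]. *)
Definition assoc_family : Type := forall i j l : 'I_n.+1,
  'M[A]_(mdim (ee i *o (ee j *o ee l)), mdim (ee i *o ee j *o ee l)).

Variables (R : nzRingType) (r : 'I_n.+1 -> R) (zR : zplus_ring r c).

Record assoc_system (a : assoc_family) : Prop := AssocSystem {
  as_inv : forall i j l, minvertible e (a i j l);
  as_nat : forall i j l i' j' l' x y z,
    x \in corner e i' i -> y \in corner e j' j -> z \in corner e l' l ->
    (mx1 i' i x *t (mx1 j' j y *t mx1 l' l z)) *m a i j l =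
    a i' j' l' *m (mx1 i' i x *t mx1 j' j y *t mx1 l' l z);
  as_unit : forall i j,
    mcast (hatv_unitr zR i j) (hatv_unitl zR i j) (a i ord0 j) = Emx e (c i j);
  as_pentagon : forall i1 i2 i3 i4,
    \sum_j \sum_(k < (ee i2 *o ee i3) j)
       (id1 i1 *t (a i2 i3 i4 *m (X k *t id1 i4))) *m a i1 j i4 *m
       (((id1 i1 *t Y k) *m a i1 i2 i3) *t id1 i4) =
    \sum_j \sum_j'
      \sum_(k < (ee i3 *o ee i4) j) \sum_(k' < (ee i1 *o ee i2) j')
       (id1 i1 *t (id1 i2 *t X k)) *m a i1 i2 j *m (X k' *t Y k) *m
       a j' i3 i4 *m (Y k' *t id1 i3 *t id1 i4)
}.

Definition assoc_mx (a : assoc_family) (m s t : nvec n) :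
    'M[A]_(mdim (m *o (s *o t)), mdim (m *o s *o t)) :=
  \sum_i \sum_j \sum_l
    \sum_(k1 < m i) \sum_(k2 < s j) \sum_(k3 < t l)
      (X k1 *t (X k2 *t X k3)) *m a i j l *m (Y k1 *t Y k2 *t Y k3).

Lemma mtyped_hat (s1 m1 s2 m2 : nvec n) (X : 'M[A]_(mdim s1, mdim m1))
    (Y : 'M[A]_(mdim s2, mdim m2)) : alg_map -> mtyped e (X *t Y).
Proof.
move=> phi_alg; apply/mtypedP=> u v; rewrite mxE.
have /mtypedP/(_ (hrow u) (hrow v)) := am_typed phi_alg
  (tens (X (hp u) (hp v)) (Y (hq u) (hq v)))
  (ty (hp u)) (ty (hq u)) (ty (hp v)) (ty (hq v)).
by rewrite !ty_hrow.
Qed.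

Lemma mtyped_assoc (a : assoc_family) (m s t : nvec n) :
  (forall i, e i * e i = e i) -> alg_map -> assoc_system a ->
  mtyped e (assoc_mx a m s t).
Proof.
move=> e_idem phi_alg a_ass; rewrite /assoc_mx.
do 6![apply: mtyped_sum => ? _].
apply: mtyped_mul => //; last exact: mtyped_hat.
apply: mtyped_mul => //; first exact: mtyped_hat.
exact: (proj1 (as_inv a_ass _ _ _)).
Qed.

End TensorOfMatrices.

Section LinearCategories.
Variable F : fieldType.

Record lincat := LinCat {
  ob :> Type;
  chom : ob -> ob -> lmodType F;
  cidm : forall U, chom U U;
  ccomp : forall U V W, chom V W -> chom U V -> chom U W;
  comp1m : forall U V (f : chom U V), ccomp (cidm V) f = f;
  compm1 : forall U V (f : chom U V), ccomp f (cidm U) = f;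
  compA : forall U V W Z (f : chom W Z) (g : chom V W) (h : chom U V),
    ccomp f (ccomp g h) = ccomp (ccomp f g) h;
  comp_linearl : forall U V W (h : chom U V), linear ((@ccomp U V W)^~ h);
  comp_linearr : forall U V W (f : chom V W), linear (@ccomp U V W f)
}.
Arguments cidm {l} U.
Arguments ccomp {l U V W}.

Definition is_iso (C : lincat) (U V : C) (f : chom U V) : Prop :=
  exists g : chom V U, ccomp g f = cidm U /\ ccomp f g = cidm V.

Record lfunctor (C D : lincat) := LFunctor {
  fob :> C -> D;
  fmap : forall U V : C, {linear chom U V -> chom (fob U) (fob V)};
  fmap_id : forall U, fmap U U (cidm U) = cidm (fob U);
  fmap_comp : forall U V W (f : chom V W) (g : chom U V),
    fmap U W (ccomp f g) = ccomp (fmap V W f) (fmap U V g)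
}.
Arguments fmap {C D} l {U V}.

Definition lfunctor_id (C : lincat) : lfunctor C C :=
  @LFunctor C C id (fun U V => idfun : {linear chom U V -> chom U V})
    (fun U => erefl) (fun U V W f g => erefl).

Lemma lfunctor_comp_id (B C D : lincat) (G : lfunctor C D) (H : lfunctor B C) U :
  fmap G (fmap H (cidm U)) = cidm (G (H U)).
Proof. by rewrite !fmap_id. Qed.

Lemma lfunctor_comp_comp (B C D : lincat) (G : lfunctor C D) (H : lfunctor B C)
    U V W (f : chom V W) (g : chom U V) :
  fmap G (fmap H (ccomp f g)) = ccomp (fmap G (fmap H f)) (fmap G (fmap H g)).
Proof. by rewrite !fmap_comp. Qed.

Definition lfunctor_comp (B C D : lincat) (G : lfunctor C D)
    (H : lfunctor B C) : lfunctor B D :=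
  @LFunctor B D (fun U => G (H U))
    (fun U V => fmap G \o fmap H : {linear chom U V -> chom (G (H U)) (G (H V))})
    (lfunctor_comp_id G H) (lfunctor_comp_comp G H).

Definition nat_isomorphic (C D : lincat) (G H : lfunctor C D) : Prop :=
  exists eta : forall U : C, chom (G U) (H U),
    (forall U, is_iso (eta U)) /\
    (forall (U V : C) (f : chom U V),
      ccomp (eta V) (fmap G f) = ccomp (fmap H f) (eta U)).

Definition is_equivalence (C D : lincat) (G : lfunctor C D) : Prop :=
  exists H : lfunctor D C,
    nat_isomorphic (lfunctor_comp H G) (lfunctor_id C) /\
    nat_isomorphic (lfunctor_comp G H) (lfunctor_id D).

(* The structure carried by a tensor category. The axioms relating its pieces
   (bifunctoriality, pentagon, triangle) do not occur in the definitions of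
   tensor functors and of tensor equivalence, and are not recorded. *)
Record tensor_cat := TensorCat {
  tcat :> lincat;
  tunit : tcat;
  tob : tcat -> tcat -> tcat;
  tmap : forall U V W Z : tcat,
    chom U V -> chom W Z -> chom (tob U W) (tob V Z);
  tassoc : forall U V W : tcat, chom (tob (tob U V) W) (tob U (tob V W));
  tlunit : forall U : tcat, chom (tob tunit U) U;
  trunit : forall U : tcat, chom (tob U tunit) U
}.
Arguments tmap {t U V W Z}.

Record tensor_functor (C D : tensor_cat) (G : lfunctor C D)
    (phi0 : chom (tunit D) (G (tunit C)))
    (phi2 : forall U W : C, chom (tob (G U) (G W)) (G (tob U W))) : Prop := {
  tf_iso0 : is_iso phi0;
  tf_iso2 : forall U W, is_iso (phi2 U W);
  tf_nat : forall (U U' W W' : C) (f : chom U U') (g : chom W W'),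
    ccomp (phi2 U' W') (tmap (fmap G f) (fmap G g)) =
    ccomp (fmap G (tmap f g)) (phi2 U W);
  tf_assoc : forall U V W : C,
    ccomp (fmap G (tassoc U V W))
      (ccomp (phi2 (tob U V) W) (tmap (phi2 U V) (cidm (G W)))) =
    ccomp (phi2 U (tob V W))
      (ccomp (tmap (cidm (G U)) (phi2 V W)) (tassoc (G U) (G V) (G W)));
  tf_lunit : forall U : C,
    tlunit (G U) =
    ccomp (fmap G (tlunit U)) (ccomp (phi2 (tunit C) U) (tmap phi0 (cidm (G U))));
  tf_runit : forall U : C,
    trunit (G U) =
    ccomp (fmap G (trunit U)) (ccomp (phi2 U (tunit C)) (tmap (cidm (G U)) phi0))
}.

Definition tensor_equivalent (C D : tensor_cat) : Prop :=
  exists (G : lfunctor C D) phi0 phi2,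
    @tensor_functor C D G phi0 phi2 /\ is_equivalence G.

End LinearCategories.

(* n is [dn], the indices 1, ..., n are shifted to 0, ..., n - 1. *)
Record admissible_datum (F : fieldType) := AdmissibleDatum {
  dpred : nat;
  dR : nzRingType;
  dr : 'I_dpred.+1 -> dR;
  dc : 'I_dpred.+1 -> 'I_dpred.+1 -> nvec dpred;
  dA : falgType F;
  de : 'I_dpred.+1 -> dA;
  dphi : tensor dA dA -> MRAI dA dc;
  da : assoc_family dA dc;
  d_ring : zplus_ring dr dc;
  d_adm : admissible_algebra de;
  d_dim1 : \dim (corner de ord0 ord0) = 1%N;
  d_alg : alg_map de dphi;
  d_phi1 : phi1 de dphi;
  d_phi2 : phi2 de dphi;
  d_ass : assoc_system de dphi d_ring da
}.
Arguments dr {F} a.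
Arguments dc {F} a.
Arguments de {F} a.
Arguments dphi {F} a.
Arguments da {F} a.

Definition dn (F : fieldType) (D : admissible_datum F) : nat := (dpred D).+1.

Section TensorCategoryOfDatum.
Variables (F : fieldType) (D : admissible_datum F).

Local Notation n := (dpred D).
Local Notation A := (dA D).
Local Notation e := (de D).
Local Notation "m '*o' s" := (hatv (dc D) m s) (at level 40, left associativity).

Lemma datum_idem i : e i * e i = e i.
Proof. by case: (adm_primitive (d_adm D) i). Qed.

Definition chat_hom (m s : nvec n) : lmodType F := tmx e s m.

Definition chat_id (m : nvec n) : chat_hom m m := TMx (mtyped_E datum_idem m).

Definition chat_comp (m s t : nvec n) (f : chat_hom s t) (g : chat_hom m s) :
    chat_hom m t :=
  TMx (mtyped_mul datum_idem (tmxP f) (tmxP g)).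

Lemma chat_comp1m m s (f : chat_hom m s) : chat_comp (chat_id s) f = f.
Proof. by apply: val_inj; apply: mulEmx datum_idem _ _ _ (tmxP f). Qed.

Lemma chat_compm1 m s (f : chat_hom m s) : chat_comp f (chat_id m) = f.
Proof. by apply: val_inj; apply: mulmxE datum_idem _ _ _ (tmxP f). Qed.

Lemma chat_compA m s t u (f : chat_hom t u) (g : chat_hom s t)
    (h : chat_hom m s) :
  chat_comp f (chat_comp g h) = chat_comp (chat_comp f g) h.
Proof. by apply: val_inj; apply: mulmxA. Qed.

Lemma chat_comp_linearl m s t (h : chat_hom m s) :
  linear ((@chat_comp m s t)^~ h).
Proof.
move=> k f g; apply: val_inj; apply/matrixP=> p q.
by rewrite /= mulmxDl -scalemxAl.
Qed.

Lemma chat_comp_linearr m s t (f : chat_hom s t) : linear (@chat_comp m s t f).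
Proof.
move=> k g h; apply: val_inj => /=; rewrite mulmxDr; congr (_ + _).
apply/matrixP=> p q; rewrite !mxE mulr_algl scaler_sumr.
by apply: eq_bigr => l _; rewrite mxE mulr_algl scalerAr.
Qed.

Definition chat_lincat : lincat F :=
  LinCat chat_comp1m chat_compm1 chat_compA chat_comp_linearl chat_comp_linearr.

Definition chat_tmap (m s m' s' : nvec n) (f : chat_hom m s)
    (g : chat_hom m' s') : chat_hom (m *o m') (s *o s') :=
  TMx (mtyped_hat (tmxval f) (tmxval g) (d_alg D)).

Definition chat_assoc (m s t : nvec n) :
    chat_hom (m *o s *o t) (m *o (s *o t)) :=
  TMx (mtyped_assoc m s t datum_idem (d_alg D) (d_ass D)).

(* E_m, where the columns are indexed by e_1 *o m, resp. m *o e_1 *)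
Definition chat_lunit (m : nvec n) : chat_hom (ee ord0 *o m) m :=
  TMx (mtyped_cast (erefl m) (esym (hatv1l (d_ring D) m)) (mtyped_E datum_idem m)).

Definition chat_runit (m : nvec n) : chat_hom (m *o ee ord0) m :=
  TMx (mtyped_cast (erefl m) (esym (hatv1r (d_ring D) m)) (mtyped_E datum_idem m)).

Definition chat : tensor_cat F :=
  @TensorCat F chat_lincat (ee ord0) (hatv (dc D)) chat_tmap chat_assoc
    chat_lunit chat_runit.

End TensorCategoryOfDatum.

Notation "m *o[ D ] s" := (hatv (dc D) m s)
  (at level 40, left associativity, format "m  *o[ D ]  s").
Notation "X *t[ D ] Y" := (hatmx (dphi D) X Y)
  (at level 40, left associativity, format "X  *t[ D ]  Y").
Notation Xmx_ D k := (Xmx (de D) k).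
Notation Ymx_ D k := (Ymx (de D) k).
Notation id1 D i := (mx1 i i (de D i)).

Section Permutations.
Variables (F : fieldType) (D D' : admissible_datum F).
Variables (En : dn D' = dn D) (s : {perm 'I_(dn D)}).

Definition psig (i : 'I_(dn D)) : 'I_(dn D') := cast_ord (esym En) (s i).
Definition psigV (i : 'I_(dn D')) : 'I_(dn D) := (s^-1)%g (cast_ord En i).

Lemma psigK : cancel psig psigV.
Proof. by move=> i; rewrite /psig /psigV cast_ordKV permK. Qed.

Lemma psigVK : cancel psigV psig.
Proof. by move=> i; rewrite /psig /psigV permKV cast_ordK. Qed.

Definition permv (m : nvec (dpred D)) : nvec (dpred D') :=
  [ffun i => m (psigV i)].

(* The block with row type i and column type j is the identity if
   j = sigma^-1 i, and 0 otherwise. *)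
Definition Pmx (m : nvec (dpred D)) : 'M[dA D']_(mdim (permv m), mdim m) :=
  \matrix_(u, v) ((ty v == psigV (ty u)) && (pos u == pos v :> nat))%:R.

Definition basis_perm_iso : Prop :=
  exists f : {rmorphism dR D -> dR D'},
    bijective f /\ forall i, f (dr D i) = dr D' (psig i).

Hypothesis H1 : basis_perm_iso.

Lemma permv_hat i j :
  permv (ee i *o[D] ee j) = ee (psig i) *o[D'] ee (psig j).
Proof.
rewrite !hatv_ee; have [f [_ fr]] := H1; apply: (zplus_inj (d_ring D')).
rewrite -(zplus_mul (d_ring D')) -!fr -rmorphM (zplus_mul (d_ring D)) rmorph_sum.
rewrite (reindex psig) /=; last by exists psigV => k _; [apply: psigK|apply: psigVK].
by apply: eq_bigr => k _; rewrite ffunE psigK rmorphMn /= fr.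
Qed.

Lemma permv_hat_sig i j t :
  (ee i *o[D] ee j) t = (ee (psig i) *o[D'] ee (psig j)) (psig t).
Proof. by rewrite -permv_hat [RHS]ffunE psigK. Qed.

(* P_sigma(c_{ij}), with rows indexed by
   c'_{sigma(i) sigma(j)} = c_{ij}^sigma *)
Definition Pc (i j : 'I_(dn D)) :
    'M[dA D']_(mdim (ee (psig i) *o[D'] ee (psig j)), mdim (ee i *o[D] ee j)) :=
  castmx (congr1 (@mdim _) (permv_hat i j), erefl) (Pmx (ee i *o[D] ee j)).

Definition psigk (i j t : 'I_(dn D)) (k : 'I_((ee i *o[D] ee j) t)) :
    'I_((ee (psig i) *o[D'] ee (psig j)) (psig t)) :=
  cast_ord (permv_hat_sig i j t) k.

End Permutations.

(* Main.v *)
From HB Require Import structures.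
Require Import Defs.
From mathcomp Require Import all_boot all_order all_fingroup all_algebra all_field.
From mathcomp Require Import zify.
Set Implicit Arguments.
Unset Strict Implicit.
Unset Printing Implicit Defensive.
Import GRing.Theory.
Local Open Scope ring_scope.

(** In the category of a datum every object m is a direct sum of the objects
    ee i: the identity of m is the sum of the products of the elementary
    columns and rows. Hence linear functors, natural transformations and tensor
    structures are determined by what they do on these generators, and their
    axioms can be tested there. The conditions of the theorem are the data and
    the axioms of a tensor functor, read on generators.

    A permutation sigma and an isomorphism delta of algebras define a linear
    functor [perm_functor], X |-> P_sigma delta(X) P_sigma^T, which maps ee i to
    ee (sigma i). A family of matrices phi_ij gives morphisms
    G(ee i) (x) G(ee j) -> G(ee i (x) ee j) ([gen_structure]). The intertwining
    condition says that they are natural ([gen_natural_iff]). The condition with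
    sums over t and k says that they satisfy the associativity axiom for ee i,
    ee j, ee l ([gen_assoc_iff]): the tensor structure at ee i (x) ee j and ee l
    is not among the phi's, and is expanded over the summands of ee i (x) ee j
    ([tensor_expandl]). The condition on phi_1i and phi_i1 is the unit axiom,
    for the isomorphism of unit objects given by the scalar alpha^-1
    ([gen_lunit_iff]). Conversely such a family extends to all objects
    ([tensor_ext]), and the extension inherits the axioms
    ([assoc_from_generators], [lunit_from_generators]). As delta is bijective,
    the functor is an equivalence.

    For the necessity, the point is that isomorphic objects are equal
    ([chat_skeletal]). Over an algebraically closed field the algebra e_i A e_i
    is local with residue field F, so it has a character; its kernel is a
    maximal left ideal, which by the condition KS contains e_i A e_j A e_i for
    i <> j. Applied to the blocks of type (i, i), the character therefore turns
    mutually inverse typed matrices into mutually inverse matrices over F, whose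
    sizes are m i and s i. Now let G0 be a tensor equivalence. It maps ee i to an
    object without idempotents other than 0 and 1, hence to a generator
    ee (sigma i) ([image_of_generator]); sigma is a permutation because a
    quasi-inverse of G0 has the same property. The values of G0 on the corners
    e_i A e_j assemble to delta ([induced]), and G0 is naturally isomorphic to
    the functor of sigma and delta ([full_iso_nat]), to which its tensor
    structure can be transported ([tensor_functor_transport]). The equality of
    structure constants comes from skeletality again, and the isomorphism of
    unit objects is a scalar since e_1 A e_1 has dimension 1.

    Underlying all this is the fact that the product of matrices is a bilinear
    bifunctor with natural constraints ([chat_bifunctorial]). *)

Local Notation compA := Defs.compA.
Local Notation "f \c g" := (ccomp f g) (at level 40, left associativity).
Local Notation "f \t g" := (tmap f g) (at level 39, left associativity).

(** * Linear categories *)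

Section LinearComposition.
Variables (F : fieldType) (C : lincat F).

Definition precomp (U V W : C) (h : chom U V) (f : chom V W) := f \c h.

HB.instance Definition _ (U V W : C) (h : chom U V) :=
  GRing.isLinear.Build F (chom V W) (chom U W) _ (precomp h) (comp_linearl h).
HB.instance Definition _ (U V W : C) (f : chom V W) :=
  GRing.isLinear.Build F (chom U V) (chom U W) _ (@ccomp F C U V W f)
    (comp_linearr f).

Lemma comp_suml (U V W : C) (K : Type) (r : seq K) (P : pred K)
    (f : K -> chom V W) (h : chom U V) :
  (\sum_(k <- r | P k) f k) \c h = \sum_(k <- r | P k) f k \c h.
Proof. exact: (raddf_sum (precomp h)). Qed.

Lemma comp_sumr (U V W : C) (K : Type) (r : seq K) (P : pred K)
    (f : chom V W) (h : K -> chom U V) :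
  f \c (\sum_(k <- r | P k) h k) = \sum_(k <- r | P k) f \c h k.
Proof. exact: raddf_sum. Qed.

Lemma compZl (U V W : C) a (f : chom V W) (h : chom U V) :
  (a *: f) \c h = a *: (f \c h).
Proof. exact: (linearZZ (precomp h)). Qed.

Lemma compZr (U V W : C) a (f : chom V W) (h : chom U V) :
  f \c (a *: h) = a *: (f \c h).
Proof. exact: linearZZ. Qed.

Lemma iso_monic (U V W : C) (f : chom V W) (g h : chom U V) :
  is_iso f -> f \c g = f \c h -> g = h.
Proof.
by case=> f' [f'f _] E; rewrite -[g]comp1m -[h]comp1m -f'f -!compA E.
Qed.

Lemma iso_epic (U V W : C) (f : chom U V) (g h : chom V W) :
  is_iso f -> g \c f = h \c f -> g = h.
Proof.
by case=> f' [_ ff'] E; rewrite -[g]compm1 -[h]compm1 -ff' !compA E.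
Qed.

Lemma iso_id (U : C) : is_iso (cidm U).
Proof. by exists (cidm U); rewrite comp1m. Qed.

Lemma iso_comp (U V W : C) (f : chom V W) (g : chom U V) :
  is_iso f -> is_iso g -> is_iso (f \c g).
Proof.
move=> [f' [f'f ff']] [g' [g'g gg']]; exists (g' \c f'); split.
  by rewrite !compA -(compA g') f'f compm1.
by rewrite !compA -(compA f) gg' compm1.
Qed.

Lemma iso_scale (U V : C) (f : chom U V) a :
  a != 0 -> is_iso f -> is_iso (a *: f).
Proof.
move=> a0 [f' [f'f ff']]; exists (a^-1 *: f').
by rewrite !compZl !compZr f'f ff' !scalerA mulVf // mulfV // !scale1r.
Qed.

(** The product of vectors is unital, and compatible with permutations, only up
    to provable equality; such equalities are handled as isomorphisms. *)
Definition ocast (U V : C) (E : U = V) : chom U V := ecast W (chom U W) E (cidm U).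

Lemma ocast_iso (U V : C) (E : U = V) : is_iso (ocast E).
Proof. by case: V / E; apply: iso_id. Qed.

Lemma ocast_comp (U V W : C) (E : U = V) (E' : V = W) :
  ocast E' \c ocast E = ocast (etrans E E').
Proof. by case: W / E'; rewrite comp1m. Qed.

Lemma ocastK (U V : C) (E : U = V) : ocast (esym E) \c ocast E = cidm U.
Proof. by case: V / E; rewrite comp1m. Qed.

Lemma ocastVK (U V : C) (E : U = V) : ocast E \c ocast (esym E) = cidm V.
Proof. by case: V / E; rewrite comp1m. Qed.

End LinearComposition.

Lemma fmap_ocast (F : fieldType) (C D : lincat F) (G : lfunctor C D) (U V : C)
    (E : U = V) :
  fmap G _ _ (ocast E) = ocast (congr1 G E).
Proof. by case: V / E; apply: fmap_id. Qed.

Lemma iso_fmap (F : fieldType) (C D : lincat F) (G : lfunctor C D) (U V : C)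
    (f : chom U V) :
  is_iso f -> is_iso (fmap G _ _ f).
Proof.
by case=> g [gf fg]; exists (fmap G _ _ g); rewrite -!fmap_comp gf fg !fmap_id.
Qed.

(** * Equivalences of linear categories *)

Section Equivalence.
Variables (F : fieldType) (C D : lincat F) (G : lfunctor C D).

Lemma equivalence_fully_faithful : is_equivalence G ->
  (forall U V (f g : chom U V), fmap G _ _ f = fmap G _ _ g -> f = g) /\
  (forall U V (h : chom (G U) (G V)), exists f, fmap G U V f = h).
Proof.
case=> H [[eta [eta_iso eta_nat]] [eps [eps_iso eps_nat]]].
have faithG U V (f g : chom U V) : fmap G _ _ f = fmap G _ _ g -> f = g.
  move=> E; apply: (iso_epic (eta_iso U)).
  by have := eta_nat _ _ f; rewrite /= E eta_nat /= => ->.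
have faithH U V (f g : chom U V) : fmap H _ _ f = fmap H _ _ g -> f = g.
  move=> E; apply: (iso_epic (eps_iso U)).
  by have := eps_nat _ _ f; rewrite /= E eps_nat /= => ->.
split=> // U V h; have [eta' [K1 K2]] := eta_iso U.
exists (eta V \c fmap H _ _ h \c eta'); apply: faithH.
apply: (iso_monic (eta_iso V)); have /= -> := eta_nat _ _ _.
by rewrite -compA K1 compm1.
Qed.

Variables (pre : D -> C) (eps : forall V, chom (G (pre V)) V).
Variables (epsV : forall V, chom V (G (pre V))).
Variables (Ginv : forall U V, chom (G U) (G V) -> chom U V).
Hypothesis epsK : forall V, epsV V \c eps V = cidm _.
Hypothesis epsVK : forall V, eps V \c epsV V = cidm _.
Hypothesis GK : forall U V (f : chom U V), Ginv (fmap G U V f) = f.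
Hypothesis GinvK : forall U V (h : chom (G U) (G V)), fmap G _ _ (Ginv h) = h.

Let Gfaithful U V (f g : chom U V) : fmap G _ _ f = fmap G _ _ g -> f = g.
Proof. by move=> E; rewrite -(GK f) E GK. Qed.

Let qinv (U V : D) (h : chom U V) : chom (pre U) (pre V) :=
  Ginv (epsV V \c h \c eps U).

Fact qinv_linear U V : linear (@qinv U V).
Proof.
move=> a f g; apply: Gfaithful; rewrite linearP !GinvK.
by rewrite comp_linearr comp_linearl.
Qed.

HB.instance Definition _ U V :=
  GRing.isLinear.Build F (chom U V) (chom (pre U) (pre V)) _ (@qinv U V)
    (@qinv_linear U V).

Fact qinv_id U : qinv (cidm U) = cidm _.
Proof. by apply: Gfaithful; rewrite GinvK fmap_id compm1 epsK. Qed.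

Fact qinv_comp U V W (f : chom V W) (g : chom U V) :
  qinv (f \c g) = qinv f \c qinv g.
Proof.
apply: Gfaithful; rewrite fmap_comp !GinvK !compA.
by rewrite -(compA _ (eps V)) epsVK compm1.
Qed.

(** A quasi-inverse from chosen preimages [pre V] of the objects, with
    isomorphisms [eps V]: on morphisms it is conjugation by [eps], followed by
    the inverse of G. *)
Lemma equivalence_of_fully_faithful : is_equivalence G.
Proof.
exists (@LFunctor F D C pre (fun U V => @qinv U V : {linear _ -> _}) qinv_id qinv_comp).
have isoE V : is_iso (eps V) by exists (epsV V).
split.
  exists (fun U => Ginv (eps (G U))); split=> [U | U V f].
    exists (Ginv (epsV (G U))).
    by split; apply: Gfaithful; rewrite fmap_comp !GinvK ?epsK ?epsVK !fmap_id.
  apply: Gfaithful; rewrite !fmap_comp !GinvK /=.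
  by rewrite !compA epsVK comp1m.
exists eps; split=> // U V f /=.
by rewrite GinvK !compA epsVK comp1m.
Qed.

End Equivalence.

(** * Tensor functors and generators *)

(** A [tensor_cat] carries structure without axioms; bilinearity and naturality
    are recorded separately. *)
Record bilinear_tensor (F : fieldType) (C : tensor_cat F) : Prop :=
    BilinearTensor {
  tmap_id : forall U W : C, cidm U \t cidm W = cidm (tob U W);
  tmap_comp : forall (U V W U' V' W' : C) (f : chom V W) (g : chom U V)
    (f' : chom V' W') (g' : chom U' V'),
    (f \c g) \t (f' \c g') = (f \t f') \c (g \t g');
  tmap_linearl : forall (U V W Z : C) (g : chom W Z),
    linear (fun f : chom U V => f \t g);
  tmap_linearr : forall (U V W Z : C) (f : chom U V),
    linear (fun g : chom W Z => f \t g)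
}.

Record bifunctorial (F : fieldType) (C : tensor_cat F) : Prop := Bifunctorial {
  bif_bilinear :> bilinear_tensor C;
  tassoc_nat : forall (U V W U' V' W' : C) (f : chom U U') (g : chom V V')
    (h : chom W W'),
    (f \t (g \t h)) \c tassoc U V W = tassoc U' V' W' \c (f \t g \t h);
  tlunit_nat : forall (U V : C) (f : chom U V),
    tlunit V \c (cidm _ \t f) = f \c tlunit U;
  trunit_nat : forall (U V : C) (f : chom U V),
    trunit V \c (f \t cidm _) = f \c trunit U
}.

(** A direct sum decomposition of U into generators, through the one relation
    by which everything natural in U is computed on the summands. *)
Record decomposition (F : fieldType) (C : lincat F) (I : Type) (e : I -> C)
    (U : C) := Decomposition {
  dec_ix : finType;
  dec_lab : dec_ix -> I;
  dec_in : forall k, chom (e (dec_lab k)) U;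
  dec_out : forall k, chom U (e (dec_lab k));
  dec_sum : \sum_k dec_in k \c dec_out k = cidm U
}.

Local Notation fm G f := (fmap G _ _ f).

Lemma fmap_sum (F : fieldType) (C D : lincat F) (G : lfunctor C D) (U V : C)
    (K : Type) (r : seq K) (P : pred K) (f : K -> chom U V) :
  fm G (\sum_(k <- r | P k) f k) = \sum_(k <- r | P k) fm G (f k).
Proof. exact: raddf_sum. Qed.

Section NaturalIsoFromGenerators.
Variables (F : fieldType) (C D : lincat F) (I : Type) (e : I -> C).
Variable dec : forall U, decomposition e U.

Lemma dec_fmap (G : lfunctor C D) U :
  \sum_k fm G (dec_in k) \c fm G (dec_out (d := dec U) k) = cidm (G U).
Proof.
rewrite -(fmap_id G) -(dec_sum (dec U)) fmap_sum.
by apply: eq_bigr => k _; rewrite fmap_comp.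
Qed.

(** What naturality imposes at U, given the components at generators. *)
Definition nat_ext (G G0 : lfunctor C D) (w : forall i, chom (G (e i)) (G0 (e i))) U :
    chom (G U) (G0 U) :=
  \sum_(k : dec_ix (dec U)) fm G0 (dec_in k) \c w (dec_lab k) \c fm G (dec_out k).

Section Naturality.
Variables (G G0 : lfunctor C D) (w : forall i, chom (G (e i)) (G0 (e i))).
Hypothesis w_nat : forall i j (x : chom (e i) (e j)), w j \c fm G x = fm G0 x \c w i.

Lemma nat_ext_gen_in U i (x : chom (e i) U) :
  nat_ext w U \c fm G x = fm G0 x \c w i.
Proof.
rewrite /nat_ext -[x in RHS]comp1m -(dec_sum (dec U)) !comp_suml fmap_sum comp_suml.
apply: eq_bigr => k _; rewrite -!compA -fmap_comp w_nat compA -fmap_comp.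
by rewrite !compA.
Qed.

Lemma nat_ext_natural U V (f : chom U V) :
  nat_ext w V \c fm G f = fm G0 f \c nat_ext w U.
Proof.
rewrite -[LHS]compm1 -(dec_fmap G U) !comp_sumr; apply: eq_bigr => k _.
by rewrite !compA -(compA _ (fm G f)) -fmap_comp nat_ext_gen_in fmap_comp.
Qed.
End Naturality.

Lemma inverse_natural (G G0 : lfunctor C D) (w : forall i, chom (G (e i)) (G0 (e i)))
    (w' : forall i, chom (G0 (e i)) (G (e i))) :
  (forall i j (x : chom (e i) (e j)), w j \c fm G x = fm G0 x \c w i) ->
  (forall i, w i \c w' i = cidm _) -> (forall i, w' i \c w i = cidm _) ->
  forall i j (x : chom (e i) (e j)), w' j \c fm G0 x = fm G x \c w' i.
Proof.
move=> w_nat wK w'K i j x.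
rewrite -[LHS]compm1 -(wK i) -compA (compA (fm G0 x)) -w_nat !compA.
by rewrite w'K comp1m.
Qed.

Lemma nat_extK (G G0 : lfunctor C D) (w : forall i, chom (G (e i)) (G0 (e i)))
    (w' : forall i, chom (G0 (e i)) (G (e i))) :
  (forall i j (x : chom (e i) (e j)), w j \c fm G x = fm G0 x \c w i) ->
  (forall i, w i \c w' i = cidm _) -> (forall i, w' i \c w i = cidm _) ->
  forall U, nat_ext w' U \c nat_ext w U = cidm (G U).
Proof.
move=> w_nat wK w'K U; rewrite /(nat_ext w) comp_sumr -(dec_fmap G U).
have w'_nat := inverse_natural w_nat wK w'K.
apply: eq_bigr => k _; rewrite !compA (nat_ext_gen_in w'_nat).
by rewrite -(compA (fm G _)) w'K compm1.
Qed.

End NaturalIsoFromGenerators.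

Section BifunctorTheory.
Variables (F : fieldType) (C : tensor_cat F) (bC : bilinear_tensor C).

Lemma tmap_suml (U V W Z : C) (K : Type) (r : seq K) (P : pred K)
    (f : K -> chom U V) (g : chom W Z) :
  (\sum_(k <- r | P k) f k) \t g = \sum_(k <- r | P k) (f k \t g).
Proof.
pose lf := GRing.isLinear.Build F _ _ _ _ (tmap_linearl bC (U := U) (V := V) g).
pose T : {linear _ -> _} := HB.pack (fun f : chom U V => f \t g) lf.
exact: (raddf_sum T).
Qed.

Lemma tmap_sumr (U V W Z : C) (K : Type) (r : seq K) (P : pred K)
    (f : chom U V) (g : K -> chom W Z) :
  f \t (\sum_(k <- r | P k) g k) = \sum_(k <- r | P k) (f \t g k).
Proof.
pose lf := GRing.isLinear.Build F _ _ _ _ (tmap_linearr bC (W := W) (Z := Z) f).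
pose T : {linear _ -> _} := HB.pack (fun g : chom W Z => f \t g) lf.
exact: (raddf_sum T).
Qed.

Lemma tmapZl (U V W Z : C) a (f : chom U V) (g : chom W Z) :
  (a *: f) \t g = a *: (f \t g).
Proof.
pose lf := GRing.isLinear.Build F _ _ _ _ (tmap_linearl bC (U := U) (V := V) g).
pose T : {linear _ -> _} := HB.pack (fun f : chom U V => f \t g) lf.
exact: (linearZZ T).
Qed.

Lemma tmapZr (U V W Z : C) a (f : chom U V) (g : chom W Z) :
  f \t (a *: g) = a *: (f \t g).
Proof.
pose lf := GRing.isLinear.Build F _ _ _ _ (tmap_linearr bC (W := W) (Z := Z) f).
pose T : {linear _ -> _} := HB.pack (fun g : chom W Z => f \t g) lf.
exact: (linearZZ T).
Qed.

Lemma iso_tmap (U V W Z : C) (f : chom U V) (g : chom W Z) :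
  is_iso f -> is_iso g -> is_iso (f \t g).
Proof.
move=> [f' [f'f ff']] [g' [g'g gg']]; exists (f' \t g').
by rewrite -!(tmap_comp bC) f'f g'g ff' gg' !(tmap_id bC).
Qed.

Lemma ocast_tmap (U V W Z : C) (E : U = V) (E' : W = Z) :
  ocast E \t ocast E' = ocast (etrans (congr1 (fun X => tob X W) E) (congr1 (tob V) E')).
Proof. by case: V / E; case: Z / E'; exact: (tmap_id bC U W). Qed.

Lemma tmap_compl (U V W Z : C) (f : chom V W) (g : chom U V) :
  (f \c g) \t cidm Z = (f \t cidm Z) \c (g \t cidm Z).
Proof. by rewrite -(tmap_comp bC) comp1m. Qed.

Lemma tmap_compr (U V W Z : C) (f : chom V W) (g : chom U V) :
  cidm Z \t (f \c g) = (cidm Z \t f) \c (cidm Z \t g).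
Proof. by rewrite -(tmap_comp bC) comp1m. Qed.

End BifunctorTheory.

Section Transport.
Variables (F : fieldType) (C D : tensor_cat F) (bD : bifunctorial D).
Variables (G G0 : lfunctor C D).
Variables (u : forall U, chom (G U) (G0 U)) (v : forall U, chom (G0 U) (G U)).
Hypothesis uK : forall U, v U \c u U = cidm _.
Hypothesis vK : forall U, u U \c v U = cidm _.
Hypothesis u_nat : forall U V (f : chom U V), u V \c fm G f = fm G0 f \c u U.

(** The structure on G is the one on G0 conjugated by the isomorphism u. *)
Lemma tensor_functor_transport phi0 phi2 :
  @tensor_functor F C D G0 phi0 phi2 ->
  @tensor_functor F C D G (v _ \c phi0)
    (fun U W => v _ \c phi2 U W \c (u U \t u W)).
Proof.
have v_nat U V (f : chom U V) : v V \c fm G0 f = fm G f \c v U.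
  by rewrite -[RHS]comp1m -(uK V) -!compA (compA (u V)) u_nat -!compA vK compm1.
have isoU U : is_iso (u U) by exists (v U).
have isoV U : is_iso (v U) by exists (u U).
case=> iso0 iso2 nat2 ass lu ru; split.
- exact: iso_comp.
- by move=> U W; do 2?apply: iso_comp => //; apply: (iso_tmap bD).
- move=> U U' W W' f g; rewrite -compA -(tmap_comp bD) !u_nat (tmap_comp bD).
  by rewrite !compA -v_nat -(compA (v _)) nat2 -!compA.
- move=> U V W; rewrite -[in LHS](compA _ (u (tob U V) \t u W)).
  have -> : (u (tob U V) \t u W) \c
            ((v _ \c phi2 U V \c (u U \t u V)) \t cidm (G W)) =
            (phi2 U V \t cidm _) \c (u U \t u V \t u W).
    by rewrite -!(tmap_comp bD) compm1 !compA vK !comp1m.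
  rewrite !compA -v_nat -!compA; congr (_ \c _).
  rewrite (compA (phi2 _ _)) (compA (fm G0 _)) ass -!compA; congr (_ \c _).
  rewrite -(tassoc_nat bD) !compA -!(tmap_comp bD) !comp1m compm1.
  by rewrite !compA vK comp1m.
- move=> U; apply: (iso_monic (isoU U)).
  rewrite -(tlunit_nat bD) lu !compA u_nat -!compA; congr (_ \c _).
  rewrite (compA (u _)) vK comp1m; congr (_ \c _).
  by rewrite -!(tmap_comp bD) !compA vK !(comp1m, compm1).
- move=> U; apply: (iso_monic (isoU U)).
  rewrite -(trunit_nat bD) ru !compA u_nat -!compA; congr (_ \c _).
  rewrite (compA (u _)) vK comp1m; congr (_ \c _).
  by rewrite -!(tmap_comp bD) !compA vK !(comp1m, compm1).
Qed.

End Transport.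
Section Generators.
Variables (F : fieldType) (C D : tensor_cat F).
Hypotheses (bC : bifunctorial C) (bD : bifunctorial D).
Variables (I : Type) (e : I -> C) (dec : forall U, decomposition e U).
Variable G : lfunctor C D.

Local Notation ix U := (dec_ix (dec U)).
Local Notation lab := (dec_lab).
Local Notation inn := (dec_in).
Local Notation out := (dec_out).

Definition natural_tensor (phi2 : forall U W : C, chom (tob (G U) (G W)) (G (tob U W))) :=
  forall (U U' W W' : C) (f : chom U U') (g : chom W W'),
    phi2 U' W' \c (fm G f \t fm G g) = fm G (f \t g) \c phi2 U W.

Local Notation dec_fm := (dec_fmap dec G).

Section NaturalStructure.
Variable phi2 : forall U W : C, chom (tob (G U) (G W)) (G (tob U W)).
Hypothesis phi2_nat : natural_tensor phi2.

(** At ee i (x) ee j this is the origin of the sums over t and k in the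
    associativity condition on matrices. *)
Lemma tensor_expandl U W : phi2 U W = \sum_(k : ix U)
  fm G (inn k \t cidm W) \c phi2 (e (lab k)) W \c (fm G (out k) \t cidm (G W)).
Proof.
rewrite -[LHS]compm1 -(tmap_id bD) -(dec_fm U) (tmap_suml bD) comp_sumr.
apply: eq_bigr => k _.
by rewrite (tmap_compl bD) compA -(fmap_id G W) phi2_nat fmap_id.
Qed.

Lemma tensor_expandr U W : phi2 U W = \sum_(k : ix W)
  fm G (cidm U \t inn k) \c phi2 U (e (lab k)) \c (cidm (G U) \t fm G (out k)).
Proof.
rewrite -[LHS]compm1 -(tmap_id bD) -(dec_fm W) (tmap_sumr bD) comp_sumr.
apply: eq_bigr => k _.
by rewrite (tmap_compr bD) compA -(fmap_id G U) phi2_nat fmap_id.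
Qed.

Definition assoc_left U V W :
    chom (tob (tob (G U) (G V)) (G W)) (G (tob U (tob V W))) :=
  fm G (tassoc U V W) \c (phi2 (tob U V) W \c (phi2 U V \t cidm (G W))).

Definition assoc_right U V W :
    chom (tob (tob (G U) (G V)) (G W)) (G (tob U (tob V W))) :=
  phi2 U (tob V W) \c ((cidm (G U) \t phi2 V W) \c tassoc (G U) (G V) (G W)).

Lemma assoc_left_nat U V W U' V' W' (f : chom U U') (g : chom V V')
    (h : chom W W') :
  assoc_left U' V' W' \c (fm G f \t fm G g \t fm G h) =
  fm G (f \t (g \t h)) \c assoc_left U V W.
Proof.
rewrite /assoc_left -!compA -(tmap_comp bD) phi2_nat comp1m.
rewrite -[fm G h]compm1 (tmap_comp bD) (compA (phi2 _ _)) phi2_nat.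
by rewrite !compA -!fmap_comp (tassoc_nat bC).
Qed.

Lemma assoc_right_nat U V W U' V' W' (f : chom U U') (g : chom V V')
    (h : chom W W') :
  assoc_right U' V' W' \c (fm G f \t fm G g \t fm G h) =
  fm G (f \t (g \t h)) \c assoc_right U V W.
Proof.
rewrite /assoc_right -!compA -(tassoc_nat bD) (compA (_ \t _)) -(tmap_comp bD).
rewrite phi2_nat comp1m -[fm G f]compm1 (tmap_comp bD) -(compA (_ \t _)).
by rewrite (compA (phi2 _ _)) phi2_nat !compA.
Qed.

(** Both sides of the associativity axiom are natural, so that it is enough to
    test it on generators. *)
Lemma assoc_from_generators :
  (forall i j l, assoc_left (e i) (e j) (e l) = assoc_right (e i) (e j) (e l)) ->
  forall U V W, assoc_left U V W = assoc_right U V W.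
Proof.
move=> agree U V W; rewrite -[LHS]compm1 -[RHS]compm1 -!(tmap_id bD).
rewrite -(dec_fm U) -(dec_fm V) -(dec_fm W).
rewrite !(tmap_suml bD, comp_sumr); apply: eq_bigr => i _.
rewrite !(tmap_sumr bD, tmap_suml bD, comp_sumr); apply: eq_bigr => j _.
rewrite !(tmap_sumr bD, tmap_suml bD, comp_sumr); apply: eq_bigr => l _.
by rewrite !(tmap_comp bD) !compA assoc_left_nat assoc_right_nat agree.
Qed.

Lemma lunit_from_generators phi0 :
  (forall i, tlunit (G (e i)) = fm G (tlunit (e i)) \c
     (phi2 (tunit C) (e i) \c (phi0 \t cidm (G (e i))))) ->
  forall U, tlunit (G U) =
    fm G (tlunit U) \c (phi2 (tunit C) U \c (phi0 \t cidm (G U))).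
Proof.
move=> agree U; rewrite -[LHS]compm1 -[RHS]compm1.
set R := fm G (tlunit U) \c _; rewrite -!(tmap_id bD).
rewrite -(dec_fm U) !(tmap_sumr bD, comp_sumr); apply: eq_bigr => k _.
rewrite !(tmap_compr bD) !compA /R; congr (_ \c _).
rewrite (tlunit_nat bD) agree -!compA -(tmap_comp bD) comp1m compm1.
rewrite -[in RHS](comp1m phi0) -[in RHS](compm1 (fm G (inn k))) (tmap_comp bD).
rewrite (compA (phi2 _ _)) -(fmap_id G (tunit C)) phi2_nat.
by rewrite !compA -!fmap_comp (tlunit_nat bC).
Qed.

Lemma runit_from_generators phi0 :
  (forall i, trunit (G (e i)) = fm G (trunit (e i)) \c
     (phi2 (e i) (tunit C) \c (cidm (G (e i)) \t phi0))) ->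
  forall U, trunit (G U) =
    fm G (trunit U) \c (phi2 U (tunit C) \c (cidm (G U) \t phi0)).
Proof.
move=> agree U; rewrite -[LHS]compm1 -[RHS]compm1.
set R := fm G (trunit U) \c _; rewrite -!(tmap_id bD).
rewrite -(dec_fm U) !(tmap_suml bD, comp_sumr); apply: eq_bigr => k _.
rewrite !(tmap_compl bD) !compA /R; congr (_ \c _).
rewrite (trunit_nat bD) agree -!compA -(tmap_comp bD) comp1m compm1.
rewrite -[in RHS](comp1m phi0) -[in RHS](compm1 (fm G (inn k))) (tmap_comp bD).
rewrite (compA (phi2 _ _)) -(fmap_id G (tunit C)) phi2_nat.
by rewrite !compA -!fmap_comp (trunit_nat bC).
Qed.

End NaturalStructure.

Definition natural_on_generators
    (phi : forall i j, chom (tob (G (e i)) (G (e j))) (G (tob (e i) (e j)))) :=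
  forall i j i' j' (x : chom (e i) (e i')) (y : chom (e j) (e j')),
    phi i' j' \c (fm G x \t fm G y) = fm G (x \t y) \c phi i j.

Section Extension.
Variable phi : forall i j, chom (tob (G (e i)) (G (e j))) (G (tob (e i) (e j))).
Variable psi : forall i j, chom (G (tob (e i) (e j))) (tob (G (e i)) (G (e j))).
Hypothesis phi_nat : natural_on_generators phi.
Hypothesis phiK : forall i j, psi i j \c phi i j = cidm _.
Hypothesis psiK : forall i j, phi i j \c psi i j = cidm _.

(** The only possible extension of phi, by naturality with respect to the
    inclusions and projections of the decompositions. *)
Definition tensor_ext U W : chom (tob (G U) (G W)) (G (tob U W)) :=
  \sum_(k : ix U) \sum_(l : ix W) fm G (inn k \t inn l) \c
    phi (lab k) (lab l) \c (fm G (out k) \t fm G (out l)).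

Definition tensor_extV U W : chom (G (tob U W)) (tob (G U) (G W)) :=
  \sum_(k : ix U) \sum_(l : ix W) (fm G (inn k) \t fm G (inn l)) \c
    psi (lab k) (lab l) \c fm G (out k \t out l).

Lemma dec_tob U W : cidm (tob U W) =
  \sum_(k : ix U) \sum_(l : ix W) (inn k \t inn l) \c (out k \t out l).
Proof.
rewrite -(tmap_id bC) -(dec_sum (dec U)) -(dec_sum (dec W)) (tmap_suml bC).
apply: eq_bigr => k _; rewrite (tmap_sumr bC); apply: eq_bigr => l _.
by rewrite -(tmap_comp bC).
Qed.

Lemma dec_tob_fm U W : cidm (tob (G U) (G W)) =
  \sum_(k : ix U) \sum_(l : ix W)
    (fm G (inn k) \t fm G (inn l)) \c (fm G (out k) \t fm G (out l)).
Proof.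
rewrite -(tmap_id bD) -!(dec_fmap dec G) (tmap_suml bD).
apply: eq_bigr => k _; rewrite (tmap_sumr bD); apply: eq_bigr => l _.
by rewrite -(tmap_comp bD).
Qed.

Lemma psi_nat i j i' j' (x : chom (e i) (e i')) (y : chom (e j) (e j')) :
  psi i' j' \c fm G (x \t y) = (fm G x \t fm G y) \c psi i j.
Proof.
rewrite -[LHS]compm1 -(psiK i j) -compA (compA (fm G _)) -phi_nat !compA.
by rewrite phiK comp1m.
Qed.

Lemma tensor_ext_gen i j : tensor_ext (e i) (e j) = phi i j.
Proof.
rewrite /tensor_ext -[RHS]compm1 dec_tob_fm !comp_sumr; apply: eq_bigr => k _.
by rewrite comp_sumr; apply: eq_bigr => l _; rewrite -phi_nat compA.
Qed.

Lemma tensor_ext_nat : natural_tensor tensor_ext.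
Proof.
move=> U U' W W' f g.
transitivity (\sum_(k' : ix U') \sum_(l' : ix W')
  \sum_(k : ix U) \sum_(l : ix W) fm G (inn k' \t inn l') \c
  fm G ((out k' \c f \c inn k) \t (out l' \c g \c inn l)) \c
  phi (lab k) (lab l) \c (fm G (out k) \t fm G (out l))).
  rewrite /tensor_ext comp_suml; apply: eq_bigr => k' _.
  rewrite comp_suml; apply: eq_bigr => l' _.
  rewrite -compA -(tmap_comp bD) -!fmap_comp.
  rewrite -[in LHS](compm1 (out k' \c f)) -[in LHS](compm1 (out l' \c g)).
  rewrite -(dec_sum (dec U)) -(dec_sum (dec W)).
  rewrite !comp_sumr !fmap_sum (tmap_suml bD) comp_sumr; apply: eq_bigr => k _.
  rewrite (tmap_sumr bD) comp_sumr; apply: eq_bigr => l _.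
  rewrite -(compA (fm G _) (fm G _)) -phi_nat -!compA -(tmap_comp bD).
  by rewrite -!fmap_comp !compA.
rewrite /tensor_ext -[in RHS](comp1m (f \t g)) dec_tob comp_suml fmap_sum comp_suml.
apply: eq_bigr => k' _; rewrite comp_suml fmap_sum comp_suml.
apply: eq_bigr => l' _; rewrite comp_sumr; apply: eq_bigr => k _.
rewrite comp_sumr; apply: eq_bigr => l _.
by rewrite !compA -!fmap_comp -!compA -!(tmap_comp bC) !compA.
Qed.

Lemma tensor_ext_iso U W : is_iso (tensor_ext U W).
Proof.
exists (tensor_extV U W); split.
  rewrite -[LHS]compm1 dec_tob_fm comp_sumr; apply: eq_bigr => k _.
  rewrite comp_sumr; apply: eq_bigr => l _; rewrite compA; congr (_ \c _).
  rewrite -compA tensor_ext_nat tensor_ext_gen compA /tensor_extV !comp_suml.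
  rewrite -[RHS]comp1m dec_tob_fm comp_suml; apply: eq_bigr => k' _.
  rewrite !comp_suml; apply: eq_bigr => l' _.
  rewrite -!compA; congr (_ \c _).
  rewrite (compA (fm G _)) -fmap_comp -(tmap_comp bC) compA psi_nat.
  by rewrite -compA phiK compm1 -(tmap_comp bD) !fmap_comp.
rewrite /tensor_extV comp_sumr -(fmap_id G) dec_tob fmap_sum; apply: eq_bigr => k _.
rewrite comp_sumr fmap_sum; apply: eq_bigr => l _.
by rewrite !compA tensor_ext_nat tensor_ext_gen -(compA (fm G _)) psiK compm1 fmap_comp.
Qed.

End Extension.

(** In the two sides of the associativity axiom for three generators, the tensor
    structure can be reduced to its values at pairs of generators. *)
Lemma assoc_leftE phi2 i j l : natural_tensor phi2 ->
  assoc_left phi2 (e i) (e j) (e l) =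
    \sum_(k : ix (tob (e i) (e j))) fm G (tassoc (e i) (e j) (e l)) \c
      fm G (inn k \t cidm (e l)) \c phi2 (e (lab k)) (e l) \c
      ((fm G (out k) \c phi2 (e i) (e j)) \t cidm (G (e l))).
Proof.
move=> phi2_nat; rewrite /assoc_left (tensor_expandl phi2_nat) comp_suml comp_sumr.
by apply: eq_bigr => k _; rewrite (tmap_compl bD) !compA.
Qed.

Lemma assoc_rightE phi2 i j l : natural_tensor phi2 ->
  assoc_right phi2 (e i) (e j) (e l) =
    \sum_(k : ix (tob (e j) (e l))) fm G (cidm (e i) \t inn k) \c
      phi2 (e i) (e (lab k)) \c
      (cidm (G (e i)) \t (fm G (out k) \c phi2 (e j) (e l))) \c
      tassoc (G (e i)) (G (e j)) (G (e l)).
Proof.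
move=> phi2_nat; rewrite /assoc_right (tensor_expandr phi2_nat) comp_suml.
by apply: eq_bigr => k _; rewrite (tmap_compr bD) !compA.
Qed.

End Generators.

Section AssociatorFromGenerators.
Variables (F : fieldType) (C : tensor_cat F) (bC : bilinear_tensor C).
Variables (I : Type) (e : I -> C) (dec : forall U, decomposition e U).

Local Notation ix U := (dec_ix (dec U)).
Local Notation lab := (dec_lab).
Local Notation inn := (dec_in).
Local Notation out := (dec_out).

Variable alpha : forall i j l,
  chom (tob (tob (e i) (e j)) (e l)) (tob (e i) (tob (e j) (e l))).
Hypothesis alpha_nat : forall i j l i' j' l' (x : chom (e i) (e i'))
  (y : chom (e j) (e j')) (z : chom (e l) (e l')),
  (x \t (y \t z)) \c alpha i j l = alpha i' j' l' \c (x \t y \t z).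
Hypothesis tassocE : forall U V W, tassoc U V W =
  \sum_(k1 : ix U) \sum_(k2 : ix V) \sum_(k3 : ix W)
    (inn k1 \t (inn k2 \t inn k3)) \c alpha (lab k1) (lab k2) (lab k3) \c
    (out k1 \t out k2 \t out k3).

(** Naturality for morphisms towards generators comes first: there the triple
    sum defining the associator collapses to a decomposition of the identity. *)
Lemma tassoc_to_gen U V W i j l (x : chom U (e i)) (y : chom V (e j))
    (z : chom W (e l)) :
  (x \t (y \t z)) \c tassoc U V W = alpha i j l \c (x \t y \t z).
Proof.
rewrite tassocE -[x in RHS]compm1 -[y in RHS]compm1 -[z in RHS]compm1.
rewrite -(dec_sum (dec U)) -(dec_sum (dec V)) -(dec_sum (dec W)).
rewrite !comp_sumr !(tmap_suml bC) comp_sumr; apply: eq_bigr => k1 _.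
rewrite (tmap_sumr bC _ _ (_ \c (_ \c out k1))) (tmap_suml bC) !comp_sumr.
apply: eq_bigr => k2 _; rewrite (tmap_sumr bC) !comp_sumr.
apply: eq_bigr => k3 _.
rewrite [LHS]compA [X in X \c _ = _]compA -!(tmap_comp bC) alpha_nat -[LHS]compA -!(tmap_comp bC).
by rewrite !compA.
Qed.

Lemma tassoc_nat_from_generators (U V W U' V' W' : C) (f : chom U U')
    (g : chom V V') (h : chom W W') :
  (f \t (g \t h)) \c tassoc U V W = tassoc U' V' W' \c (f \t g \t h).
Proof.
rewrite (tassocE U') -[LHS]comp1m -!(tmap_id bC).
rewrite -(dec_sum (dec U')) -(dec_sum (dec V')) -(dec_sum (dec W')).
rewrite (tmap_suml bC) !comp_suml; apply: eq_bigr => k1 _.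
rewrite (tmap_suml bC) (tmap_sumr bC) !comp_suml; apply: eq_bigr => k2 _.
rewrite !(tmap_sumr bC) !comp_suml; apply: eq_bigr => k3 _.
rewrite !(tmap_comp bC) -!compA; congr (_ \c _).
by rewrite compA -!(tmap_comp bC) tassoc_to_gen.
Qed.

Lemma tassoc_gen i j l : tassoc (e i) (e j) (e l) = alpha i j l.
Proof. by rewrite -[LHS]comp1m -!(tmap_id bC) tassoc_to_gen !(tmap_id bC) compm1. Qed.

End AssociatorFromGenerators.

(** * Indices of the product of vectors *)

Section HatIndices.
Variables (n : nat) (c : 'I_n.+1 -> 'I_n.+1 -> nvec n).

Section BigSums.
Variables (R : Type) (idx0 : R) (op : Monoid.com_law idx0).

Lemma big_tagnat n' (p : 'I_n' -> nat) (h : {i & 'I_(p i)} -> R) :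
  \big[op/idx0]_(w < \sum_i p i) h (tagnat.sig w) =
  \big[op/idx0]_i \big[op/idx0]_(k < p i) h (Tagged (fun i => 'I_(p i)) k).
Proof.
rewrite sig_big_dep [RHS](reindex (@tagnat.sig _ p)) /=; last exact: tagnat.sig_bij_on.
by apply: eq_bigr => w _; case: (tagnat.sig w).
Qed.

Lemma big_nvec (m : nvec n) (f : 'I_(mdim m) -> R) :
  \big[op/idx0]_(w < mdim m) f w = \big[op/idx0]_i \big[op/idx0]_(k < m i) f (idx k).
Proof.
rewrite -(big_tagnat (fun s : {i & 'I_(m i)} => f (idx (tagged s)))).
apply: eq_bigr => w _; congr f; rewrite /idx -tagnat.rankE.
exact/esym/tagnat.sigK.
Qed.

Lemma big_ee i (f : 'I_(mdim (ee i : nvec n)) -> R) p0 :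
  \big[op/idx0]_p f p = f p0.
Proof.
have E := mdim_ee i; move: f p0; rewrite E => f p0.
by rewrite big_ord1 [p0]ord1.
Qed.

(** The rows of a product correspond to triples (p, q, r), where r is a row of
    the block that comes from the rows p and q of the factors. *)
Lemma big_hat (m s : nvec n)
    (g : forall p q, 'I_(mdim (c (ty p) (ty q))) -> R) :
  \big[op/idx0]_(u < mdim (hatv c m s)) g (hp u) (hq u) (hrow u) =
  \big[op/idx0]_(p < mdim m) \big[op/idx0]_(q < mdim s)
    \big[op/idx0]_r g p q r.
Proof.
pose h (x : {i & 'I_(hatv c m s i)}) :=
  let cell := cast_ord (hatv_blocks c m s (tag x)) (tagged x) in
  g (tagnat.sig1 (tagnat.sig2 cell)) (tagnat.sig1 cell)
    (idx (tagnat.sig2 (tagnat.sig2 cell))).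
transitivity (\big[op/idx0]_(u < mdim (hatv c m s)) h (tagnat.sig u)).
  by [].
rewrite (big_tagnat h) /h.
transitivity (\big[op/idx0]_i \big[op/idx0]_(q < mdim s)
   \big[op/idx0]_(p < mdim m) \big[op/idx0]_(r < c (ty p) (ty q) i) g p q (idx r)).
  apply: eq_bigr => i _ /=.
  rewrite (reindex (cast_ord (esym (hatv_blocks c m s i)))) /=; last first.
    by exists (cast_ord (hatv_blocks c m s i)) => k _; rewrite ?cast_ordK ?cast_ordKV.
  under eq_bigr do rewrite cast_ordKV.
  pose h1 (x : {q : 'I_(mdim s) & 'I_(\sum_(p < mdim m) c (ty p) (ty q) i)}) :=
    g (tagnat.sig1 (tagged x)) (tag x) (idx (tagnat.sig2 (tagged x))).
  rewrite (big_tagnat h1); apply: eq_bigr => q _; rewrite /h1 /=.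
  by rewrite (big_tagnat
    (fun x : {p : 'I_(mdim m) & 'I_(c (ty p) (ty q) i)} => g (tag x) q (idx (tagged x)))).
rewrite exchange_big /= [RHS]exchange_big; apply: eq_bigr => q _ /=.
rewrite exchange_big; apply: eq_bigr => p _ /=.
by rewrite [RHS]big_nvec.
Qed.

End BigSums.

Definition htriple (m s : nvec n) (u : 'I_(mdim (hatv c m s))) :
    {pq : 'I_(mdim m) * 'I_(mdim s) & 'I_(mdim (c (ty pq.1) (ty pq.2)))} :=
  Tagged (fun pq => 'I_(mdim (c (ty pq.1) (ty pq.2)))) (i := (hp u, hq u)) (hrow u).

(** With the indicator function of the triple of v for g, [big_hat] counts the
    rows that have this triple, and finds exactly one. *)
Lemma htriple_inj (m s : nvec n) : injective (@htriple m s).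
Proof.
move=> u v E; apply/eqP; apply/contraT => nuv.
have := big_hat addn (fun p q r => (Tagged (fun pq => 'I_(mdim (c (ty pq.1) (ty pq.2)))) (i := (p, q)) r == htriple v : nat)).
rewrite (bigD1 u) //= (bigD1 v) /=; last by rewrite eq_sym.
rewrite -!/(htriple _) E eqxx pair_big sig_big_dep.
rewrite [RHS](bigD1 (htriple v)) //= [X in _ = (_ + X)%N -> _]big1 => [|[[p q] r] ne].
  by rewrite -!/(htriple _) eqxx.
by rewrite /= (negPf ne).
Qed.

End HatIndices.
Lemma mono_ord_id a b (f : 'I_a -> 'I_b) : a = b ->
  {homo f : i j / (i < j)%N} -> forall i, f i = i :> nat.
Proof.
move=> Eab f_mono.
have low k (Hk : (k < a)%N) : (k <= f (Ordinal Hk))%N.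
  elim: k Hk => // k IH Hk; apply: leq_ltn_trans (IH (ltnW Hk)) _.
  exact: f_mono.
have up d k (Hk : (k < a)%N) : (k + d < a)%N -> (f (Ordinal Hk) + d < b)%N.
  elim: d k Hk => [|d IH] k Hk lt_kd; first by rewrite addn0.
  have Hk1 : (k.+1 < a)%N by lia.
  have := IH _ Hk1; have := f_mono (Ordinal Hk) (Ordinal Hk1) (ltnSn k); lia.
by case=> k Hk; have := low k Hk; have := up (a - k.+1)%N k Hk; rewrite /=; lia.
Qed.

Section UnitIndices.
Variables (n : nat) (c : 'I_n.+1 -> 'I_n.+1 -> nvec n) (m : nvec n).

Lemma ty_mono (s : nvec n) (u v : 'I_(mdim s)) : (u <= v)%N -> (ty u <= ty v)%N.
Proof. by move=> le_uv; have := @tagnat.le_sig1 _ s u v; rewrite !leEord; apply. Qed.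

Lemma sig2_mono n' (p : 'I_n' -> nat) (u v : 'I_(\sum_i p i)) :
  (u <= v)%N -> tagnat.sig1 u = tagnat.sig1 v ->
  (tagnat.sig2 u <= tagnat.sig2 v)%N.
Proof.
rewrite {1}(tagnat.rect u) {1}(tagnat.rect v).
move: (tagnat.sig1 u) (tagnat.sig2 u) (tagnat.sig1 v) (tagnat.sig2 v).
by move=> i k i' k' + E; rewrite E in k *; rewrite leq_add2l.
Qed.

Lemma lt_of_ty (s : nvec n) (u v : 'I_(mdim s)) : (ty u < ty v)%N -> (u < v)%N.
Proof. by rewrite !ltnNge; apply/contra/ty_mono. Qed.

Lemma hcell_mono (m1 m2 : nvec n) (u v : 'I_(mdim (hatv c m1 m2))) :
  (u <= v)%N -> ty u = ty v -> (hcell u <= hcell v)%N.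
Proof. exact: sig2_mono. Qed.

Lemma hq_mono (m1 m2 : nvec n) (u v : 'I_(mdim (hatv c m1 m2))) :
  (u <= v)%N -> ty u = ty v -> (hq u <= hq v)%N.
Proof.
move=> le_uv E; have := hcell_mono le_uv E; rewrite /hq.
move: (hcell u) (hcell v); rewrite E => x y le_xy.
by have := @tagnat.le_sig1 _ _ x y; rewrite !leEord; apply.
Qed.

Lemma hp_mono (m1 m2 : nvec n) (u v : 'I_(mdim (hatv c m1 m2))) :
  (u <= v)%N -> ty u = ty v -> hq u = hq v -> (hp u <= hp v)%N.
Proof.
move=> le_uv E; have := hcell_mono le_uv E; rewrite /hp /hq.
move: (hcell u) (hcell v); rewrite E => x y le_xy Eq.
have := sig2_mono le_xy Eq.
move: (tagnat.sig2 x) (tagnat.sig2 y); rewrite Eq => x' y' le_xy'.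
by have := @tagnat.le_sig1 _ _ x' y'; rewrite !leEord; apply.
Qed.

Lemma ee_uniq i (p q : 'I_(mdim (ee i : nvec n))) : p = q.
Proof. by move: p q; rewrite mdim_ee => p q; rewrite ord1 [q]ord1. Qed.

(** Rows of a product are sorted by type, then by q, then by p. If the first
    factor has a single row, u |-> hq u preserves types and is increasing, so it
    is the identity. *)
Lemma hq_unit (u : 'I_(mdim (hatv c (ee ord0) m))) :
  (forall i, c ord0 i = ee i) -> hatv c (ee ord0) m = m -> hq u = u :> nat.
Proof.
move=> c0 Em.
have tyq (v : 'I_(mdim (hatv c (ee ord0) m))) : ty (hq v) = ty v :> 'I_n.+1.
  by rewrite -(ty_hrow v); move: (hrow v); rewrite (ty_ee (hp v)) c0 => r; rewrite (ty_ee r).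
apply: (@mono_ord_id _ _ (fun u => hq u)) => [|v w lt_vw]; first by rewrite Em.
have := ty_mono (ltnW lt_vw); rewrite leq_eqVlt => /orP[/eqP/val_inj E|]; last first.
  by rewrite -!tyq => /lt_of_ty.
rewrite ltn_neqAle (hq_mono (ltnW lt_vw) E) andbT.
apply: contraTneq lt_vw => /val_inj Eq; rewrite -leqNgt.
suff -> : v = w by [].
apply: htriple_inj; rewrite /htriple.
have Ep : hp v = hp w by apply: ee_uniq.
move: (hrow v) (hrow w); rewrite Eq Ep => r r'; congr Tagged.
by move: r r'; rewrite /= (ty_ee (hp w)) c0; apply: ee_uniq.
Qed.

(** The same argument with p, as q takes only one value. *)
Lemma hp_unit (u : 'I_(mdim (hatv c m (ee ord0)))) :
  (forall i, c i ord0 = ee i) -> hatv c m (ee ord0) = m -> hp u = u :> nat.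
Proof.
move=> c0 Em.
have typ (v : 'I_(mdim (hatv c m (ee ord0)))) : ty (hp v) = ty v :> 'I_n.+1.
  by rewrite -(ty_hrow v); move: (hrow v); rewrite (ty_ee (hq v)) c0 => r; rewrite (ty_ee r).
apply: (@mono_ord_id _ _ (fun u => hp u)) => [|v w lt_vw]; first by rewrite Em.
have := ty_mono (ltnW lt_vw); rewrite leq_eqVlt => /orP[/eqP/val_inj E|]; last first.
  by rewrite -!typ => /lt_of_ty.
have Eq : hq v = hq w by apply: ee_uniq.
rewrite ltn_neqAle (hp_mono (ltnW lt_vw) E) // andbT.
apply: contraTneq lt_vw => /val_inj Ep; rewrite -leqNgt.
suff -> : v = w by [].
apply: htriple_inj; rewrite /htriple.
move: (hrow v) (hrow w); rewrite Eq Ep => r r'; congr Tagged.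
by move: r r'; rewrite /= (ty_ee (hq w)) c0; apply: ee_uniq.
Qed.

End UnitIndices.
(** * The product of matrices is a bilinear bifunctor *)

Section HatMatrices.
Variables (F : fieldType) (A : falgType F) (n : nat) (e : 'I_n.+1 -> A).
Variable c : 'I_n.+1 -> 'I_n.+1 -> nvec n.
Variable phi : tensor A A -> MRAI A c.
Hypothesis e_idem : forall i, e i * e i = e i.
Hypothesis phi_alg : alg_map e phi.
Hypothesis phi_1 : phi1 e phi.

Local Notation "X '*t' Y" := (hatmx phi X Y) (at level 40, left associativity).

Lemma phi_lin (k : F) x y i' j' i j :
  phi (k *: x + y) i' j' i j = k%:A *: phi x i' j' i j + phi y i' j' i j.
Proof. exact: am_linear phi_alg _ _ _ _ _ _ _. Qed.

Lemma phi_D x y i' j' i j :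
  phi (x + y) i' j' i j = phi x i' j' i j + phi y i' j' i j.
Proof. by rewrite -[x]scale1r phi_lin !scale1r. Qed.

Lemma phi_0 i' j' i j : phi 0 i' j' i j = 0.
Proof. by apply: (addrI (phi 0 i' j' i j)); rewrite -phi_D !addr0. Qed.

Lemma phi_sum (K : Type) (r : seq K) (P : pred K) (f : K -> tensor A A) i' j' i j :
  phi (\sum_(k <- r | P k) f k) i' j' i j = \sum_(k <- r | P k) phi (f k) i' j' i j.
Proof.
by apply: (big_morph (fun x => phi x i' j' i j)) => [x y|]; rewrite (phi_D, phi_0).
Qed.

Lemma tens_sum2 (K L : finType) (f : K -> A) (g : L -> A) :
  tens (\sum_k f k) (\sum_l g l) = \sum_k \sum_l tens (f k) (g l).
Proof.
under eq_bigr do rewrite -[f _]scale1r.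
rewrite tens_suml; apply: eq_bigr => k _; rewrite scale1r.
under eq_bigr do rewrite -[g _]scale1r.
by rewrite tens_sumr; apply: eq_bigr => l _; rewrite scale1r.
Qed.

Lemma tens_0l (a : A) : tens (0 : A) a = 0.
Proof. by apply/matrixP=> i j; rewrite !mxE linear0 mul0r. Qed.

Lemma tens_0r (a : A) : tens a (0 : A) = 0.
Proof. by apply/matrixP=> i j; rewrite !mxE linear0 mulr0. Qed.

(** As phi is multiplicative and maps e_i (x) e_j to the unit matrix of one
    summand, it maps x (x) y into one summand. *)
Lemma phi_off x y i' j' i j k l i0 j0 :
  x \in corner e i' i -> y \in corner e j' j -> (k, l) != (i, j) ->
  phi (tens x y) i0 j0 k l = 0.
Proof.
move=> /(cornerP e_idem) Ex /(cornerP e_idem) Ey ne_kl.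
have -> : tens x y = tens x y * tens (e i) (e j).
  have Exi : x * e i = x by rewrite Ex -mulrA e_idem.
  have Eyj : y * e j = y by rewrite Ey -mulrA e_idem.
  by rewrite [RHS]tens_mulE Exi Eyj.
rewrite (am_mul phi_alg) big1 // => a _; rewrite big1 // => b _.
have [_ ->] := phi_1 i j; first by rewrite mulmx0.
by apply: contra ne_kl => /eqP[_ _ -> ->].
Qed.

(** The sum over the rows of the middle object splits by [big_hat] into the sum
    over p and q, which comes from bilinearity of x (x) y, and the sum over r,
    which is the product of two blocks and hence comes from multiplicativity of
    phi. *)
Lemma hat_comp (m1 m2 m3 s1 s2 s3 : nvec n)
    (X1 : 'M[A]_(mdim m1, mdim m2)) (X2 : 'M[A]_(mdim m2, mdim m3))
    (Y1 : 'M[A]_(mdim s1, mdim s2)) (Y2 : 'M[A]_(mdim s2, mdim s3)) :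
  mtyped e X1 -> mtyped e Y1 ->
  (X1 *m X2) *t (Y1 *m Y2) = (X1 *t Y1) *m (X2 *t Y2).
Proof.
move=> /mtypedP tX1 /mtypedP tY1.
apply/matrixP=> u v; rewrite !mxE tens_sum2 phi_sum summxE.
under [RHS]eq_bigr do rewrite !mxE.
rewrite [RHS](big_hat _ (fun p q r =>
  phi (tens (X1 (hp u) p) (Y1 (hq u) q)) (ty (hp u)) (ty (hq u))
    (ty p) (ty q) (hrow u) r *
  phi (tens (X2 p (hp v)) (Y2 q (hq v))) (ty p) (ty q)
    (ty (hp v)) (ty (hq v)) r (hrow v))).
apply: eq_bigr => p _; rewrite phi_sum summxE; apply: eq_bigr => q _.
rewrite -[tens (_ * _) _]tens_mulE (am_mul phi_alg) summxE (bigD1 (ty p)) //=.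
rewrite [X in _ + X]big1 ?addr0 => [|i ni]; last first.
  rewrite summxE big1 // => j _.
  by rewrite (phi_off _ _ (tX1 _ _) (tY1 _ _)) ?mul0mx ?mxE // xpair_eqE (negPf ni).
rewrite summxE (bigD1 (ty q)) //= [X in _ + X]big1 ?addr0 => [|j nj].
  by rewrite mxE.
by rewrite (phi_off _ _ (tX1 _ _) (tY1 _ _)) ?mul0mx ?mxE // xpair_eqE (negPf nj) andbF.
Qed.

Lemma hat_E m s : Emx e m *t Emx e s = Emx e (hatv c m s).
Proof.
apply/matrixP=> u v; rewrite !mxE -(inj_eq (@htriple_inj _ _ _ _)) -(ty_hrow u).
rewrite /htriple; move: (hp u) (hq u) (hp v) (hq v) (hrow u) (hrow v).
move=> p q p' q' r r'.
have [E|ne] := eqVneq (p, q) (p', q'); last first.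
  rewrite -tag_eqE /tag_eq /= (negPf ne) /= mulr0n.
  have [Ep|np] := eqVneq p p'; last by rewrite mulr0n tens_0l phi_0 mxE.
  have [Eq|nq] := eqVneq q q'; last by rewrite mulr0n tens_0r phi_0 mxE.
  by rewrite Ep Eq eqxx in ne.
case: E r' => <- <- r'; rewrite !eqxx !mulr1n eq_Tagged /=.
by have [-> _] := phi_1 (ty p) (ty q); rewrite mxE.
Qed.

Lemma hat_linearl (m1 m2 s1 s2 : nvec n) (k : F)
    (X X' : 'M[A]_(mdim m1, mdim m2)) (Y : 'M[A]_(mdim s1, mdim s2)) :
  (k%:A *: X + X') *t Y = k%:A *: (X *t Y) + X' *t Y.
Proof.
apply/matrixP=> u v; rewrite !mxE mulr_algl [tens _ _]tens_linearl phi_lin.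
by rewrite !mxE.
Qed.

Lemma hat_linearr (m1 m2 s1 s2 : nvec n) (k : F)
    (X : 'M[A]_(mdim m1, mdim m2)) (Y Y' : 'M[A]_(mdim s1, mdim s2)) :
  X *t (k%:A *: Y + Y') = k%:A *: (X *t Y) + X *t Y'.
Proof.
apply/matrixP=> u v; rewrite !mxE mulr_algl [tens _ _]tens_linearr phi_lin.
by rewrite !mxE.
Qed.

Hypothesis phi_2 : phi2 e phi.
Hypothesis c1l : forall i, c ord0 i = ee i.
Hypothesis c1r : forall i, c i ord0 = ee i.

Lemma hat_unitl (m s : nvec n) (Y : 'M[A]_(mdim m, mdim s)) u v :
  mtyped e Y -> (Emx e (ee ord0) *t Y) u v = Y (hq u) (hq v).
Proof.
move=> /mtypedP tY; rewrite mxE [Emx _ _ _ _]mxE.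
have -> : (hp u == hp v) = true by rewrite (ee_uniq (hp u) (hp v)) eqxx.
move: (hrow u) (hrow v); rewrite (ty_ee (hp u)) (ty_ee (hp v)) => r r'.
by have [[-> _] _] := phi_2 (tY (hq u) (hq v)); rewrite mxE.
Qed.

Lemma hat_unitr (m s : nvec n) (Y : 'M[A]_(mdim m, mdim s)) u v :
  mtyped e Y -> (Y *t Emx e (ee ord0)) u v = Y (hp u) (hp v).
Proof.
move=> /mtypedP tY; rewrite mxE [Emx _ _ _ _]mxE.
have -> : (hq u == hq v) = true by rewrite (ee_uniq (hq u) (hq v)) eqxx.
move: (hrow u) (hrow v); rewrite (ty_ee (hq u)) (ty_ee (hq v)) => r r'.
by have [_ [-> _]] := phi_2 (tY (hp u) (hp v)); rewrite mxE.
Qed.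

End HatMatrices.
(** * The tensor category of a datum *)

Section ChatTheory.
Variables (F : fieldType) (D : admissible_datum F).

Local Notation n := (dpred D).
Local Notation A := (dA D).
Local Notation e := (de D).
Local Notation chom := (@chom F (chat D)).

Lemma tmxval_sum (m s : nvec n) (K : Type) (r : seq K) (P : pred K)
    (f : K -> tmx e m s) :
  tmxval (\sum_(k <- r | P k) f k) = \sum_(k <- r | P k) tmxval (f k).
Proof. exact: (big_morph (@tmxval _ _ _ e m s)). Qed.

Lemma big_tagged (V : nmodType) (m : nvec n) (f : {i & 'I_(m i)} -> V) :
  \sum_s f s = \sum_i \sum_(k < m i) f (Tagged (fun i => 'I_(m i)) k).
Proof. by rewrite sig_big_dep; apply: eq_bigr => -[]. Qed.

Definition inc (m : nvec n) (s : {i & 'I_(m i)}) : chom (ee (tag s)) m :=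
  TMx (mtyped_X (datum_idem (D := D)) (tagged s)).

Definition prj (m : nvec n) (s : {i & 'I_(m i)}) : chom m (ee (tag s)) :=
  TMx (mtyped_Y (datum_idem (D := D)) (tagged s)).

Lemma inc_prj (m : nvec n) : \sum_s inc s \c prj s = cidm (m : chat D).
Proof.
apply: val_inj => /=; rewrite tmxval_sum big_tagged.
transitivity (\sum_i \sum_(k < m i) \matrix_(a, b)
    ((e (ty (idx k)) *+ (a == idx k)) * (e (ty (idx k)) *+ (b == idx k)))).
  apply: eq_bigr => i _; apply: eq_bigr => k _ /=; apply/matrixP=> a b.
  have p0 : 'I_(mdim (ee i : nvec n)) by rewrite mdim_ee; apply: ord0.
  by rewrite !mxE (big_ee _ _ p0) !mxE ty_idx.
rewrite -(big_nvec _ (fun w => \matrix_(a, b) ((e (ty w) *+ (a == w)) * (e (ty w) *+ (b == w))))).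
apply/matrixP=> a b; rewrite summxE (bigD1 a) //= big1 ?addr0 => [|w nw].
  by rewrite !mxE eqxx mulrnAr datum_idem eq_sym.
by rewrite mxE eq_sym (negPf nw) mul0r.
Qed.

Definition chat_dec (m : chat D) :
    decomposition (C := chat D) (fun i => ee i : nvec n) m :=
  @Decomposition F (chat D) _ (fun i => ee i : nvec n) m _ _ _ _ (inc_prj m).

Definition da_hom i j l :
    chom (ee i *o[D] ee j *o[D] ee l) (ee i *o[D] (ee j *o[D] ee l)) :=
  TMx (proj1 (as_inv (d_ass D) i j l)).

Lemma chat_bilinear : bilinear_tensor (chat D).
Proof.
have idem := datum_idem (D := D).
split.
- by move=> U W; apply: val_inj => /=; exact: (hat_E (d_alg D) (@d_phi1 F D)).
- move=> U V W U' V' W' f g f' g'; apply: val_inj => /=.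
  exact: (hat_comp idem (d_alg D) (@d_phi1 F D) _ _ (tmxP f) (tmxP f')).
- by move=> U V W Z g k f f'; apply: val_inj => /=; apply: (hat_linearl (d_alg D)).
- by move=> U V W Z g k f f'; apply: val_inj => /=; apply: (hat_linearr (d_alg D)).
Qed.

Lemma hom_ee i j (x : chom (ee i) (ee j)) : exists2 a, a \in corner e j i &
  tmxval x = mx1 j i a.
Proof.
have p0 k : 'I_(mdim (ee k : nvec n)) by rewrite mdim_ee; apply: ord0.
exists (tmxval x (p0 j) (p0 i)).
  by have /mtypedP/(_ (p0 j) (p0 i)) := tmxP x; rewrite !ty_ee.
apply/matrixP=> a b; rewrite mxE.
by rewrite (ee_uniq a (p0 j)) (ee_uniq b (p0 i)).
Qed.

Lemma da_hom_nat i j l i' j' l' (x : chom (ee i) (ee i')) (y : chom (ee j) (ee j'))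
    (z : chom (ee l) (ee l')) :
  (x \t (y \t z)) \c da_hom i j l = da_hom i' j' l' \c (x \t y \t z).
Proof.
apply: val_inj => /=.
have [[a Ca ->] [b Cb ->] [d Cd ->]] := And3 (hom_ee x) (hom_ee y) (hom_ee z).
exact: (as_nat (d_ass D)).
Qed.

Lemma chat_assocE (U V W : chat D) : tassoc U V W =
  \sum_(k1 : dec_ix (chat_dec U)) \sum_(k2 : dec_ix (chat_dec V))
    \sum_(k3 : dec_ix (chat_dec W))
      (dec_in k1 \t (dec_in k2 \t dec_in k3)) \c
      da_hom (dec_lab k1) (dec_lab k2) (dec_lab k3) \c
      (dec_out k1 \t dec_out k2 \t dec_out k3).
Proof.
apply: val_inj => /=; rewrite tmxval_sum big_tagged; apply: eq_bigr => i _.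
under eq_bigr do rewrite exchange_big.
rewrite exchange_big; apply: eq_bigr => k1 _ /=.
rewrite tmxval_sum big_tagged; apply: eq_bigr => j _.
rewrite exchange_big; apply: eq_bigr => k2 _ /=.
by rewrite tmxval_sum big_tagged; apply: eq_bigr => l _; apply: eq_bigr => k3 _.
Qed.

Lemma tassoc_ee i j l : tassoc (ee i : chat D) (ee j : chat D) (ee l : chat D) = da_hom i j l.
Proof. exact: (@tassoc_gen _ _ chat_bilinear _ _ chat_dec da_hom da_hom_nat chat_assocE). Qed.

(** A square with casts as two of its sides commutes as soon as the entries of
    the other two sides at equal positions agree. *)
Lemma ocast_square (m m' s s' : nvec n) (E : m = m') (E' : s = s')
    (f : chom s m) (g : chom s' m') :
  (forall (u : 'I_(mdim m)) (v : 'I_(mdim s)) (u' : 'I_(mdim m'))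
     (v' : 'I_(mdim s')), u = u' :> nat -> v = v' :> nat ->
    tmxval f u v = tmxval g u' v') ->
  ocast (C := chat D) E \c f = g \c ocast (C := chat D) E'.
Proof.
case: m' / E g => g; case: s' / E' g => g Efg; rewrite comp1m compm1.
by apply: val_inj; apply/matrixP=> u v; apply: Efg.
Qed.

Lemma chat_lunitE (m : chat D) : tlunit m = ocast (C := chat D) (hatv1l (d_ring D) m).
Proof.
apply: val_inj => /=.
have -> (s : chat D) (E : s = m) :
    tmxval (ocast E) = mcast (erefl m) (esym E) (Emx e m).
  by case: m / E; rewrite /mcast castmx_id.
by rewrite /mcast; congr castmx; congr pair; apply: eq_irrelevance.
Qed.

Lemma chat_runitE (m : chat D) : trunit m = ocast (C := chat D) (hatv1r (d_ring D) m).
Proof.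
apply: val_inj => /=.
have -> (s : chat D) (E : s = m) :
    tmxval (ocast E) = mcast (erefl m) (esym E) (Emx e m).
  by case: m / E; rewrite /mcast castmx_id.
by rewrite /mcast; congr castmx; congr pair; apply: eq_irrelevance.
Qed.

Lemma chat_bifunctorial : bifunctorial (chat D).
Proof.
have c1l i := zplus_c1l (d_ring D) i; have c1r i := zplus_c1r (d_ring D) i.
split; first exact: chat_bilinear.
- exact: (@tassoc_nat_from_generators _ _ chat_bilinear _ _ chat_dec da_hom da_hom_nat chat_assocE).
- move=> U V f; rewrite !chat_lunitE; apply: ocast_square => u v u' v' Eu Ev.
  rewrite /= (hat_unitl (@d_phi2 F D) _ _ (tmxP f)).
  by congr (tmxval f _ _); apply: val_inj; rewrite /= hq_unit // (hatv1l (d_ring D)).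
- move=> U V f; rewrite !chat_runitE; apply: ocast_square => u v u' v' Eu Ev.
  rewrite /= (hat_unitr (@d_phi2 F D) _ _ (tmxP f)).
  by congr (tmxval f _ _); apply: val_inj; rewrite /= hp_unit // (hatv1r (d_ring D)).
Qed.

End ChatTheory.

(** * Local algebras over an algebraically closed field *)

Section LocalAlgebra.
Variables (F : closedFieldType) (B : falgType F).

(** The powers of x with exponents 0, ..., dim B are linearly dependent. *)
Lemma annihilating_poly (x : B) : exists2 p : {poly F}, p != 0 & horner_alg x p = 0.
Proof.
set d := \dim {:B}.
pose M := \matrix_(i < d.+1, j < d) coord (vbasis {:B}) j (x ^+ i).
have : kermx M != 0.
  by rewrite kermx_eq0 -row_leq_rank -ltnNge ltnS rank_leq_col.
case/rowV0Pn=> v /sub_kermxP vM v0; exists (rVpoly v).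
  by apply: contra_neq v0 => E; rewrite -[v]rVpolyK E linear0.
rewrite [v]row_sum_delta linear_sum rmorph_sum /=.
transitivity (\sum_(i < d.+1) \sum_(j < d) (v 0 i * M i j) *: (vbasis {:B})`_j).
  apply: eq_bigr => i _; rewrite linearZ /= rVpoly_delta linearZ /= rmorphXn /=.
  rewrite horner_algX mulr_algl {1}(coord_vbasis (memvf (x ^+ i))) scaler_sumr.
  by apply: eq_bigr => j _; rewrite scalerA mxE.
rewrite exchange_big big1 // => j _; rewrite -scaler_suml.
have /rowP/(_ j) := vM; rewrite mxE [RHS]mxE => ->.
by rewrite scale0r.
Qed.

Hypothesis idem01 : forall f : B, f * f = f -> f = 0 \/ f = 1.

(** Fitting's lemma. Write an annihilating polynomial as q X^m with q(0) <> 0; a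
    Bezout relation between q and a power of X yields an idempotent in F[x],
    which is 0 or 1 by hypothesis. *)
Lemma unit_or_nilpotent (x : B) : x \is a GRing.unit \/ exists k, x ^+ k = 0.
Proof.
have [p p0 px] := annihilating_poly x.
have [m [q q0 Ep]] := multiplicity_XsubC p 0.
(* The exponent m.+1 ensures that f = 1 provides an inverse of x even when
   m = 0. *)
have /Bezout_eq1_coprimepP[[u v] /= uv1] : coprimep ('X ^+ m.+1) q.
  by rewrite coprimep_expl // coprimep_sym coprimepX; move: q0; rewrite p0.
have ev r s : horner_alg x (r * s) = horner_alg x r * horner_alg x s := rmorphM _ r s.
have evX k : horner_alg x ('X ^+ k) = x ^+ k by rewrite rmorphXn /= horner_algX.
have qX0 : horner_alg x ('X ^+ m.+1 * q) = 0.
  by rewrite exprS -mulrA [_ * q]mulrC ev; move: px; rewrite Ep subr0 => ->; rewrite mulr0.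
pose f := horner_alg x (u * 'X ^+ m.+1).
have Ef : f = 1 - horner_alg x (v * q).
  by rewrite -[X in X - _](rmorph1 (horner_alg x)) -uv1 rmorphD addrK.
have ff : f * f = f.
  rewrite {2}Ef mulrBr mulr1 -ev.
  have -> : u * 'X ^+ m.+1 * (v * q) = u * v * ('X ^+ m.+1 * q) by rewrite mulrACA.
  by rewrite ev qX0 mulr0 subr0.
case: (idem01 ff) => f01; [right | left].
  exists m.+1; rewrite -evX -[LHS]mulr1.
  have -> : 1 = horner_alg x (v * q) by apply/eqP; rewrite -subr_eq0 -Ef f01.
  by rewrite -ev mulrCA ev qX0 mulr0.
apply/unitrP; exists (horner_alg x (u * 'X ^+ m)).
rewrite -{2 3}(horner_algX x) -!ev -f01 /f; split; congr horner_alg.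
  by rewrite -mulrA -exprSr.
by rewrite mulrC -mulrA -exprSr.
Qed.

Lemma mul_nonunit (x y : B) : x \isn't a GRing.unit \/ y \isn't a GRing.unit ->
  x * y \isn't a GRing.unit.
Proof.
have nil_inv (z w : B) k : z ^+ k = 0 -> z * w != 1 /\ w * z != 1.
  move=> zk0; split; apply/eqP=> zw1.
    have : z ^+ k * w ^+ k = 1.
      elim: k {zk0} => [|k IH]; first by rewrite mulr1.
      by rewrite exprSr exprS mulrA -[_ * z * w]mulrA zw1 mulr1.
    by rewrite zk0 mul0r => /eqP; rewrite eq_sym oner_eq0.
  have : w ^+ k * z ^+ k = 1.
    elim: k {zk0} => [|k IH]; first by rewrite mulr1.
    by rewrite exprSr exprS mulrA -[_ * w * z]mulrA zw1 mulr1.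
  by rewrite zk0 mulr0 => /eqP; rewrite eq_sym oner_eq0.
move=> H; apply/negP=> Uxy; case: H => /negP nU.
  case: (unit_or_nilpotent x) => // -[k xk0].
  have [+ _] := nil_inv x (y * (x * y)^-1) k xk0.
  by rewrite mulrA divrr // eqxx.
case: (unit_or_nilpotent y) => // -[k yk0].
have [_ +] := nil_inv y ((x * y)^-1 * x) k yk0.
by rewrite -mulrA mulVr // eqxx.
Qed.

(** If x + y is a unit, z = (x + y)^-1 x is a nonunit, hence nilpotent, so that
    (x + y)^-1 y = 1 - z is a unit. *)
Lemma add_nonunit (x y : B) : x \isn't a GRing.unit -> y \isn't a GRing.unit ->
  x + y \isn't a GRing.unit.
Proof.
move=> nUx nUy; apply/negP=> U.
have : (x + y)^-1 * x \isn't a GRing.unit by apply: mul_nonunit; right.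
case: (unit_or_nilpotent ((x + y)^-1 * x)) => [-> //|[k zk0] _].
have : (x + y)^-1 * y \isn't a GRing.unit by apply: mul_nonunit; right.
have -> : (x + y)^-1 * y = 1 - (x + y)^-1 * x.
  by rewrite -(mulVr U) mulrDr addrAC subrr add0r.
move/negP; apply; apply/unitrP.
exists (\sum_(i < k) ((x + y)^-1 * x) ^+ i).
have E := subrX1 ((x + y)^-1 * x) k.
set z := _ * x in zk0 E *.
have comm : GRing.comm (1 - z) (\sum_(i < k) z ^+ i).
  apply/commr_sym/commrB; first exact: commr1.
  by apply/commr_sym/commr_sum => i _; apply: commrX.
have E1 : (1 - z) * (\sum_(i < k) z ^+ i) = 1.
  by rewrite -opprB mulNr -E zk0 sub0r opprK.
by rewrite -comm E1.
Qed.

(** An annihilating polynomial is a product of linear factors, which cannot all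
    take unit values at x, as their product is 0. *)
Lemma eigenvalue_exists (x : B) : exists a : F, x - a%:A \isn't a GRing.unit.
Proof.
have [p p0 px] := annihilating_poly x.
have [r Ep] := closed_field_poly_normal p.
have [/hasP[a _ nU]|/hasPn allU] := boolP (has (fun a => x - a%:A \isn't a GRing.unit) r).
  by exists a.
have : horner_alg x p \is a GRing.unit.
  rewrite Ep linearZ /= rmorph_prod /= mulr_algl scaler_unit ?unitfE ?lead_coef_eq0 //.
  rewrite big_seq; elim/big_rec: _ => [|a y ra Uy]; first exact: unitr1.
  rewrite unitrMl // rmorphB /= horner_algX horner_algC.
  by have := allU a ra; rewrite negbK.
by rewrite px unitr0.
Qed.

(** The reduction modulo the radical, with values in the residue field F: the
    only eigenvalue of x. *)
Definition local_char (x : B) : F := xchoose (eigenvalue_exists x).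

Lemma local_charP x : x - (local_char x)%:A \isn't a GRing.unit.
Proof. exact: (xchooseP (eigenvalue_exists x)). Qed.

Lemma opp_nonunit (x : B) : x \isn't a GRing.unit -> - x \isn't a GRing.unit.
Proof. by rewrite unitrN. Qed.

Lemma local_char_uniq x a : x - a%:A \isn't a GRing.unit -> local_char x = a.
Proof.
move=> nU; apply/eqP; rewrite -subr_eq0; apply: contraT => ne.
have : ((local_char x - a)%:A : B) \isn't a GRing.unit.
  have -> : (local_char x - a)%:A = (x - a%:A) - (x - (local_char x)%:A).
    by rewrite scalerBl opprB [RHS]addrC addrA subrK.
  exact: add_nonunit nU (opp_nonunit (local_charP x)).
by rewrite scaler_unit ?unitfE // unitr1.
Qed.

Lemma local_charD x y : local_char (x + y) = local_char x + local_char y.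
Proof.
apply: local_char_uniq; have := add_nonunit (local_charP x) (local_charP y).
by rewrite scalerDl opprD addrACA.
Qed.

Lemma local_charM x y : local_char (x * y) = local_char x * local_char y.
Proof.
apply: local_char_uniq.
have -> : x * y - (local_char x * local_char y)%:A =
    x * (y - (local_char y)%:A) + (x - (local_char x)%:A) * (local_char y)%:A.
  by rewrite mulrBr mulrBl addrA subrK -scalerAl mul1r scalerA.
by apply: add_nonunit; apply: mul_nonunit; [right|left]; apply: local_charP.
Qed.

Lemma local_charZ a x : local_char (a *: x) = a * local_char x.
Proof.
rewrite -mulr_algl local_charM; congr (_ * _); apply: local_char_uniq.
by rewrite subrr unitr0.
Qed.

Lemma local_char1 : local_char 1 = 1.
Proof. by apply: local_char_uniq; rewrite scale1r subrr unitr0. Qed.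

End LocalAlgebra.
Section CornerCharacter.
Variables (F : closedFieldType) (A : falgType F) (n : nat) (e : 'I_n.+1 -> A).
Hypothesis adm : admissible_algebra e.

Let e_idem i : e i * e i = e i.
Proof. by case: (adm_primitive adm i). Qed.

Let cP i j x : reflect (x = e i * x * e j) (x \in corner e i j) := cornerP e_idem i j x.

Lemma corner_mul i j k x y :
  x \in corner e i j -> y \in corner e j k -> x * y \in corner e i k.
Proof.
move=> /cP-> /cP->; apply/cP.
by rewrite !mulrA e_idem -[RHS]mulrA e_idem.
Qed.

Lemma corner_l i j x : x \in corner e i j -> e i * x = x.
Proof. by move=> /cP->; rewrite !mulrA e_idem. Qed.

Lemma corner_r i j x : x \in corner e i j -> x * e j = x.
Proof. by move=> /cP->; rewrite -!mulrA e_idem. Qed.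

Lemma corner_mem i j x : e i * x * e j \in corner e i j.
Proof. by apply/cP; rewrite !mulrA e_idem -[RHS]mulrA e_idem. Qed.

Section OneCorner.
Variable i : 'I_n.+1.

Fact corner_is_aspace : is_aspace (corner e i i).
Proof.
apply/andP; split.
  apply/has_algidP; exists (e i); split; first exact: corner_id.
    by case: (adm_primitive adm i).
  by move=> u Cu; rewrite (corner_l Cu) (corner_r Cu).
by apply/prodvP => u v; apply: corner_mul.
Qed.

Let B : {aspace A} := ASpace corner_is_aspace.
Let inB (x : A) : subvs_of B := Subvs (corner_mem i i x).

Let val1 : val (1 : subvs_of B) = e i.
Proof.
have Be : e i \in B by exact: corner_id.
have El : algid B * e i = e i := algidl Be.
have Er : algid B * e i = algid B := corner_r (memv_algid B).
by rewrite -[RHS]El Er.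
Qed.

Let idem01 (f : subvs_of B) : f * f = f -> f = 0 \/ f = 1.
Proof.
move=> ff; have [_ _ prim] := adm_primitive adm i.
have vff : val f * val f = val f by rewrite -{3}ff.
have fe : val f * e i = val f by apply: corner_r (valP f).
have ef : e i * val f = val f by apply: corner_l (valP f).
case: (prim (val f) (e i - val f)).
- by [].
- by rewrite mulrBl !mulrBr e_idem ef fe vff subrr subr0.
- by rewrite mulrBr fe vff subrr.
- by rewrite mulrBl ef vff subrr.
- by rewrite addrC subrK.
- by move=> f0; left; apply: val_inj.
- move/eqP; rewrite subr_eq0 => /eqP E; right; apply: val_inj.
  by rewrite val1.
Qed.

Definition corner_char (x : A) : F := local_char (inB x).

Lemma corner_char_linear : linear (corner_char : A -> F^o).
Proof.
move=> a x y; rewrite /corner_char.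
have -> : inB (a *: x + y) = a *: inB x + inB y.
  by apply: val_inj; rewrite /= mulrDr mulrDl -scalerAr -scalerAl.
by rewrite local_charD // local_charZ.
Qed.

HB.instance Definition _ :=
  GRing.isLinear.Build F A F^o _ corner_char corner_char_linear.

Lemma corner_char0 : corner_char 0 = 0.
Proof. exact: raddf0. Qed.

Lemma corner_char_sum (K : Type) (r : seq K) (P : pred K) (f : K -> A) :
  corner_char (\sum_(k <- r | P k) f k) = \sum_(k <- r | P k) corner_char (f k).
Proof. exact: raddf_sum. Qed.

Lemma corner_charM x y : x \in corner e i i -> y \in corner e i i ->
  corner_char (x * y) = corner_char x * corner_char y.
Proof.
move=> Cx Cy; rewrite /corner_char -(local_charM idem01).
suff -> : inB (x * y) = inB x * inB y by [].
apply: val_inj; rewrite [LHS]/= -[RHS]/((e i * x * e i) * (e i * y * e i)).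
rewrite !(corner_l Cx, corner_r Cx, corner_l Cy, corner_r Cy).
by rewrite (corner_l (corner_mul Cx Cy)) (corner_r (corner_mul Cx Cy)).
Qed.

Lemma corner_char1 : corner_char (e i) = 1.
Proof.
rewrite /corner_char -(local_char1 idem01); congr local_char; apply: val_inj.
by rewrite val1 /= !e_idem.
Qed.

(** The kernel of the character is a maximal left ideal of the corner. *)
Lemma corner_char_rad x : rad_corner e i x -> corner_char x = 0.
Proof.
case=> Cx rad.
pose L := (corner e i i :&: lker (linfun (corner_char : A -> F^o)))%VS.
have memL y : (y \in L) = (y \in corner e i i) && (corner_char y == 0).
  by rewrite memv_cap memv_ker lfunE.
suff : maximal_left_ideal e i L by move/rad; rewrite memL => /andP[_ /eqP].
split.
- split; first exact: capvSl.
  apply/prodvP=> u v Cu; rewrite !memL => /andP[Cv /eqP v0].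
  by rewrite (corner_mul Cu Cv) corner_charM // v0 mulr0 eqxx.
- move=> E; have := corner_id e_idem i; rewrite -E memL corner_char1.
  by rewrite oner_eq0 andbF.
move=> L' [sub_L' id_L'] LL'.
have [L'L|] := boolP (L' <= L)%VS.
  by left; apply/eqP; rewrite eqEsubv L'L LL'.
case/subvPn=> y L'y; have Cy := subvP sub_L' _ L'y.
rewrite memL Cy /= => y0; right; apply/eqP; rewrite eqEsubv sub_L' /=.
apply/subvP=> z Cz; rewrite -[z](subrK ((corner_char z / corner_char y) *: y)).
apply: memvD; last exact: memvZ.
apply: (subvP LL'); rewrite memL memvB ?memvZ //=.
rewrite raddfB /= subr_eq0 (linearZZ (corner_char : {linear A -> F^o})).
by rewrite /GRing.scale /= divfK.
Qed.

Lemma corner_char_off j x y : i != j -> x \in corner e i j -> y \in corner e j i ->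
  corner_char (x * y) = 0.
Proof.
move=> ij Cx Cy; apply: corner_char_rad; apply: (adm_KS adm ij).
exact: memv_mul.
Qed.

End OneCorner.
End CornerCharacter.
(** * Skeletality *)

Section Skeletal.
Variables (F : closedFieldType) (D : admissible_datum F).

Local Notation n := (dpred D).
Local Notation e := (de D).
Local Notation chom := (@chom F (chat D)).

(** The diagonal block of type i, modulo the radical of the corner. *)
Definition residue (i : 'I_n.+1) (m s : nvec n) (X : tmx e m s) :
    'M[F]_(m i, s i) :=
  \matrix_(k, k') corner_char (d_adm D) i (tmxval X (idx k) (idx k')).

(** The products that pass through a type j <> i are killed by the character,
    by the condition KS. *)
Lemma residue_comp i (m s t : nvec n) (f : chom s t) (g : chom m s) :
  residue i (f \c g) = residue i f *m residue i g.
Proof.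
apply/matrixP=> k k'; rewrite !mxE /=.
rewrite corner_char_sum big_nvec.
have typed (a b : nvec n) (x : tmx e a b) p q := mtypedP _ _ (tmxP x) p q.
rewrite (bigD1 i) //= [X in _ + X]big1 ?addr0 => [|j nj].
  apply: eq_bigr => l _; rewrite !mxE corner_charM //.
    by have := typed _ _ f (idx k) (idx l); rewrite !ty_idx.
  by have := typed _ _ g (idx l) (idx k'); rewrite !ty_idx.
rewrite big1 // => l _; apply: (@corner_char_off _ _ _ _ _ i j); first by rewrite eq_sym.
  by have := typed _ _ f (idx k) (idx l); rewrite !ty_idx.
by have := typed _ _ g (idx l) (idx k'); rewrite !ty_idx.
Qed.

Lemma residue1 i (m : nvec n) : residue i (cidm (m : chat D)) = 1%:M.
Proof.
apply/matrixP=> k k'; rewrite !mxE ty_idx.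
rewrite (inj_eq (f := @idx _ m i)); last first.
  by move=> a b /eqP; rewrite -val_eqE /= tagnat.eq_Rank eqxx => /eqP/val_inj.
case: eqP => _; first by rewrite corner_char1.
exact: corner_char0.
Qed.

(** The residues of mutually inverse morphisms are mutually inverse matrices over
    a field, of sizes m i by s i, whence m i = s i. *)
Lemma chat_skeletal (m s : chat D) (f : chom m s) : is_iso f -> m = s.
Proof.
case=> g [gf fg]; apply/ffunP=> i; apply/eqP; rewrite eqn_leq.
have gf1 : residue i g *m residue i f = 1%:M by rewrite -residue_comp gf residue1.
have fg1 : residue i f *m residue i g = 1%:M by rewrite -residue_comp fg residue1.
by rewrite (mulmx1_min gf1) (mulmx1_min fg1).
Qed.

Lemma ee_inj : injective (@ee n).
Proof. by move=> i j /ffunP/(_ i); rewrite !ffunE eqxx; case: eqP. Qed.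

Lemma corner0_scalar x : x \in corner e ord0 ord0 -> exists a, x = a *: e ord0.
Proof.
have idem := datum_idem (D := D).
suff -> : corner e ord0 ord0 = <[e ord0]>%VS by move/vlineP.
apply/esym/eqP; rewrite eqEdim d_dim1 dim_vline.
have [-> _ _] := adm_primitive (d_adm D) ord0.
by rewrite andbT -memvE corner_id.
Qed.

End Skeletal.

(** * The functor of a permutation and of an isomorphism of algebras *)

Lemma pos_idx n (m : nvec n) i (k : 'I_(m i)) : pos (idx k) = k :> nat.
Proof. by rewrite /pos /idx tagnat.Rank2K. Qed.

Lemma idx_pos n (m : nvec n) (u : 'I_(mdim m)) : idx (pos u) = u.
Proof. exact: tagnat.sig2K. Qed.

Lemma eq_idx n (m : nvec n) i i' (k : 'I_(m i)) (k' : 'I_(m i')) :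
  (idx k == idx k') = (i == i') && (k == k' :> nat).
Proof. exact: tagnat.eq_Rank. Qed.

Lemma tmxval_ocast (F : fieldType) (D : admissible_datum F) (m s t : nvec (dpred D)) (E : s = t)
    (f : tmx (de D) s m) (u : 'I_(mdim t)) (v : 'I_(mdim m)) (u' : 'I_(mdim s)) :
  u' = u :> nat ->
  tmxval (ocast (C := chat D) E \c (f : chom (m : chat D) s)) u v = tmxval f u' v.
Proof.
by case: t / E u => u /val_inj->; rewrite comp1m.
Qed.

Section PermutationFunctor.
Variables (F : fieldType) (D D' : admissible_datum F).
Variables (En : dn D' = dn D) (s : {perm 'I_(dn D)}).

Local Notation sg := (psig En s).
Local Notation sgV := (psigV En s).
Local Notation pv := (permv En s).
Local Notation e := (de D).
Local Notation e' := (de D').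
Local Notation chom := (@chom F (chat _)).

Lemma permvE m i : pv m (sg i) = m i.
Proof. by rewrite ffunE psigK. Qed.

Lemma permv_ix m i : pv m i = m (sgV i).
Proof. by rewrite ffunE. Qed.

(** The row of an m-indexed matrix that P_sigma moves to position u. *)
Definition unperm m (u : 'I_(mdim (pv m))) : 'I_(mdim m) :=
  idx (cast_ord (permv_ix m (ty u)) (pos u)).

Definition reperm m (v : 'I_(mdim m)) : 'I_(mdim (pv m)) :=
  idx (cast_ord (esym (permvE m (ty v))) (pos v)).

Lemma ty_unperm m (u : 'I_(mdim (pv m))) : sg (ty (unperm u)) = ty u.
Proof. by rewrite ty_idx psigVK. Qed.

Lemma ty_reperm m (v : 'I_(mdim m)) : ty (reperm v) = sg (ty v).
Proof. by rewrite ty_idx. Qed.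

Lemma eq_unperm m (u : 'I_(mdim (pv m))) v :
  (v == unperm u) = (ty v == sgV (ty u)) && (pos u == pos v :> nat).
Proof. by rewrite -{1}(idx_pos v) eq_idx [pos v == _ :> nat]eq_sym. Qed.

Lemma repermK m : cancel (@reperm m) (@unperm m).
Proof.
move=> v; apply/esym/eqP; rewrite eq_unperm; apply/andP; split.
  by rewrite ty_reperm psigK.
by rewrite pos_idx.
Qed.

Lemma unpermK m : cancel (@unperm m) (@reperm m).
Proof.
move=> u; rewrite -[RHS]idx_pos; apply/eqP; rewrite eq_idx; apply/andP; split.
  by rewrite ty_unperm.
by rewrite /= pos_idx.
Qed.

Lemma unperm_bij m : bijective (@unperm m).
Proof. by exists (@reperm m); [apply: unpermK | apply: repermK]. Qed.

Lemma unperm_idx (m : nvec (dpred D)) t (k : 'I_(m t)) (k' : 'I_(pv m (sg t))) :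
  k' = k :> nat -> unperm (idx k') = idx k.
Proof.
move=> Ek; apply/esym/eqP; rewrite eq_unperm; apply/andP; split.
  by rewrite !ty_idx psigK.
by rewrite !pos_idx Ek.
Qed.

Lemma PmxE m u v : Pmx En s m u v = (v == unperm u)%:R.
Proof. by rewrite mxE; rewrite (eq_unperm u v). Qed.

Lemma PmxK m : (Pmx En s m)^T *m Pmx En s m = 1%:M.
Proof.
apply/matrixP=> u v; rewrite mxE [RHS]mxE (bigD1 (reperm u)) //=.
rewrite [_^T _ _]mxE !PmxE repermK eqxx mul1r [v == u]eq_sym big1 ?addr0 // => w nw.
rewrite [_^T _ _]mxE !PmxE; case: eqP => [E|_]; last by rewrite mul0r.
by rewrite E unpermK eqxx in nw.
Qed.

Lemma Pmx_inj m (k : nat) (X Y : 'M[dA D']_(mdim m, k)) :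
  Pmx En s m *m X = Pmx En s m *m Y -> X = Y.
Proof. by move=> E; rewrite -[X]mul1mx -[Y]mul1mx -PmxK -!mulmxA E. Qed.

Lemma permv_ee i : pv (ee i) = ee (sg i).
Proof.
apply/ffunP=> k; rewrite !ffunE; congr nat_of_bool.
by rewrite -(inj_eq (can_inj (psigK En s))) psigVK.
Qed.

Variable delta : {lrmorphism dA D -> dA D'}.
Hypothesis delta_e : forall i, delta (e i) = e' (sg i).

Lemma delta_corner i j x : x \in corner e i j -> delta x \in corner e' (sg i) (sg j).
Proof.
move=> /(cornerP (datum_idem (D := D)))->.
by rewrite !rmorphM /= !delta_e; apply/(cornerP (datum_idem (D := D')));
   rewrite !mulrA datum_idem -[RHS]mulrA datum_idem.
Qed.

Definition perm_mx_fun (m t : nvec (dpred D)) (X : 'M[dA D]_(mdim m, mdim t)) :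
    'M[dA D']_(mdim (pv m), mdim (pv t)) :=
  \matrix_(u, v) delta (X (unperm u) (unperm v)).

Lemma mtyped_perm m t (X : tmx e m t) : mtyped e' (perm_mx_fun X).
Proof.
apply/mtypedP=> u v; rewrite mxE -(ty_unperm u) -(ty_unperm v).
by apply: delta_corner; apply: (mtypedP _ _ (tmxP X)).
Qed.

Definition perm_hom (m t : chat D) (f : chom m t) : chom (pv m : chat D') (pv t) :=
  TMx (mtyped_perm f).

Lemma perm_hom_linear m t : linear (@perm_hom m t).
Proof.
move=> k f g; apply: val_inj; apply/matrixP=> u v; rewrite !mxE /= ?mxE.
by rewrite !mulr_algl linearP.
Qed.

HB.instance Definition _ m t :=
  GRing.isLinear.Build F (chom m t) (chom (pv m : chat D') (pv t)) _
    (@perm_hom m t) (@perm_hom_linear m t).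

Lemma perm_hom_id m : perm_hom (cidm m) = cidm (pv m : chat D').
Proof.
apply: val_inj; apply/matrixP=> u v; rewrite !mxE /= ?mxE.
by rewrite rmorphMn /= delta_e ty_unperm (inj_eq (bij_inj (unperm_bij m))).
Qed.

Lemma perm_hom_comp m t w (f : chom t w) (g : chom m t) :
  perm_hom (f \c g) = perm_hom f \c perm_hom g.
Proof.
apply: val_inj; apply/matrixP=> u v; rewrite !mxE /= ?mxE rmorph_sum /=.
rewrite (reindex (@unperm t)) /=; last exact/onW_bij/unperm_bij.
by apply: eq_bigr => x _; rewrite !mxE rmorphM.
Qed.

Definition perm_functor : lfunctor (chat D) (chat D') :=
  @LFunctor F (chat D) (chat D') pv
    (fun m t => @perm_hom m t : {linear chom m t -> chom (pv m : chat D') (pv t)})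
    perm_hom_id perm_hom_comp.

Local Notation G := perm_functor.

(** [perm_functor] is conjugation by the permutation matrices; the casts allow
    for the identification of the permuted vectors with products of vectors of
    the second datum. *)
Lemma Pmx_conj m t m1 t1 (Em : pv m = m1) (Et : pv t = t1) (X : chom (t : chat D) m) :
  castmx (congr1 (@mdim _) Em, erefl) (Pmx En s m) *m map_mx delta (tmxval X) *m
    (castmx (congr1 (@mdim _) Et, erefl) (Pmx En s t))^T =
  tmxval (ocast (C := chat D') Em \c fm G X \c ocast (C := chat D') (esym Et)).
Proof.
case: m1 / Em; case: t1 / Et; rewrite compm1 comp1m !castmx_id.
apply/matrixP=> u v; rewrite mxE [RHS]mxE (bigD1 (unperm v)) //=.
rewrite [_^T _ _]mxE PmxE eqxx mulr1.
rewrite [X in _ + X]big1 ?addr0 => [|w nw].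
  rewrite mxE (bigD1 (unperm u)) //= PmxE eqxx mul1r [map_mx _ _ _ _]mxE.
  by rewrite big1 ?addr0 // => w nw; rewrite PmxE (negPf nw) mul0r.
by rewrite [_^T _ _]mxE PmxE (negPf nw) mulr0.
Qed.

(** The generator ee (sigma i), identified with the image of ee i. *)
Definition eta i : chom (ee (sg i) : chat D') (G (ee i)) :=
  ocast (C := chat D') (esym (permv_ee i)).

Definition etaV i : chom (G (ee i)) (ee (sg i) : chat D') :=
  ocast (C := chat D') (permv_ee i).

Lemma etaK i : etaV i \c eta i = cidm _.
Proof. exact: ocastVK. Qed.

Lemma etaVK i : eta i \c etaV i = cidm _.
Proof. exact: ocastK. Qed.

End PermutationFunctor.
(** * Tensor structures on the functor of a permutation *)

Section Translation.
Variables (F : fieldType) (D D' : admissible_datum F).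
Variables (En : dn D' = dn D) (s : {perm 'I_(dn D)}).
Variable delta : {lrmorphism dA D -> dA D'}.

Local Notation sg := (psig En s).
Local Notation pv := (permv En s).
Local Notation e := (de D).
Local Notation e' := (de D').
Local Notation chom := (@chom F (chat _)).

Hypothesis delta_e : forall i, delta (e i) = e' (sg i).
Hypothesis H1 : basis_perm_iso En s.

Local Notation G := (perm_functor delta_e).
Local Notation eta := (eta delta_e).
Local Notation etaV := (etaV delta_e).
Local Notation bD := (chat_bifunctorial D).
Local Notation bD' := (chat_bifunctorial D').

Lemma id1E (D0 : admissible_datum F) i : id1 D0 i = Emx (de D0) (ee i).
Proof. by apply/matrixP=> u v; rewrite !mxE ty_ee (ee_uniq u v) eqxx. Qed.

Lemma mtyped_mx1 (D0 : admissible_datum F) i j x :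
  x \in corner (de D0) i j -> mtyped (de D0) (mx1 i j x).
Proof. by move=> Cx; apply/mtypedP=> u v; rewrite mxE !ty_ee. Qed.

Lemma perm_gen i i' (X : chom (ee i : chat D) (ee i')) x
    (X' : chom (ee (sg i) : chat D') (ee (sg i'))) :
  tmxval X = mx1 i' i x -> tmxval X' = mx1 (sg i') (sg i) (delta x) ->
  fm G X \c eta i = eta i' \c X'.
Proof.
move=> EX EX'; apply/esym/ocast_square => u v u' v' _ _.
by rewrite EX' mxE /= mxE EX mxE.
Qed.

Lemma prj_perm (m : nvec (dpred D)) m1 (E : pv m = m1) (k : {i & 'I_(m i)})
    (k1 : 'I_(m1 (sg (tag k)))) (Y : chom (m1 : chat D') (ee (sg (tag k)))) :
  k1 = tagged k :> nat -> tmxval Y = Ymx e' k1 ->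
  Y = etaV (tag k) \c fm G (prj k) \c ocast (C := chat D') (esym E).
Proof.
case: m1 / E k1 Y => k1 Y Ek EY; rewrite compm1; apply: val_inj.
apply/matrixP=> q p /=.
have lt_q : (q < mdim (pv (ee (tag k))))%N by rewrite permv_ee.
rewrite (tmxval_ocast (D := D') _ (perm_hom delta_e (prj k)) p (u' := Ordinal lt_q)) //.
rewrite EY /= !mxE rmorphMn /= delta_e -(unperm_idx Ek).
by rewrite (inj_eq (bij_inj (unperm_bij _ _ _))).
Qed.

Definition iota i j : chom (G (ee i *o[D] ee j)) (ee (sg i) *o[D'] ee (sg j)) :=
  ocast (C := chat D') (permv_hat H1 i j).

Definition iotaV i j : chom (ee (sg i) *o[D'] ee (sg j)) (G (ee i *o[D] ee j)) :=
  ocast (C := chat D') (esym (permv_hat H1 i j)).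

Lemma iotaK i j : iotaV i j \c iota i j = cidm _.
Proof. exact: ocastK. Qed.

Lemma iotaVK i j : iota i j \c iotaV i j = cidm _.
Proof. exact: ocastVK. Qed.

Variable f : forall i j, chom (ee (sg i) *o[D'] ee (sg j)) (ee (sg i) *o[D'] ee (sg j)).

(** The morphism G(ee i) (x) G(ee j) -> G(ee i (x) ee j) that corresponds to an
    endomorphism f i j of ee (sigma i) (x) ee (sigma j). *)
Definition gen_structure i j :
    chom (tob (G (ee i)) (G (ee j))) (G (tob (ee i : chat D) (ee j : chat D))) :=
  iotaV i j \c f i j \c (etaV i \t etaV j).

Local Notation Phi := gen_structure.

Lemma gen_structureK i j : iota i j \c Phi i j \c (eta i \t eta j) = f i j.
Proof.
rewrite /Phi !compA iotaVK comp1m -compA -(tmap_comp bD') !etaK.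
by rewrite (tmap_id bD') compm1.
Qed.

Lemma eta_iso i : is_iso (eta i). Proof. exact: ocast_iso. Qed.
Lemma iota_iso i j : is_iso (iota i j). Proof. exact: ocast_iso. Qed.

(** Both sides of the matrix equation are those of the naturality square,
    composed with the identifications iota and eta. *)
Lemma gen_natural_iff :
  (forall i j i' j' x y, x \in corner e i' i -> y \in corner e j' j ->
     tmxval (f i' j') *m (mx1 (sg i') (sg i) (delta x) *t[D']
                           mx1 (sg j') (sg j) (delta y)) =
     Pc H1 i' j' *m map_mx delta (mx1 i' i x *t[D] mx1 j' j y) *m
               (Pc H1 i j)^T *m tmxval (f i j)) <->
  natural_on_generators (C := chat D) (e := fun i => ee i) Phi.
Proof.
have key i j i' j' x y (X : chom (ee i : chat D) (ee i')) (Y : chom (ee j : chat D) (ee j')) :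
    tmxval X = mx1 i' i x -> tmxval Y = mx1 j' j y ->
    x \in corner e i' i -> y \in corner e j' j ->
    (tmxval (f i' j') *m (mx1 (sg i') (sg i) (delta x) *t[D']
                           mx1 (sg j') (sg j) (delta y)) =
     Pc H1 i' j' *m map_mx delta (mx1 i' i x *t[D] mx1 j' j y) *m
               (Pc H1 i j)^T *m tmxval (f i j)) <->
    (Phi i' j' \c (fm G X \t fm G Y) = fm G (X \t Y) \c Phi i j).
  move=> EX EY Cx Cy.
  pose X' : chom (ee (sg i) : chat D') (ee (sg i')) := TMx (mtyped_mx1 (delta_corner delta_e Cx)).
  pose Y' : chom (ee (sg j) : chat D') (ee (sg j')) := TMx (mtyped_mx1 (delta_corner delta_e Cy)).
  have L : iota i' j' \c (Phi i' j' \c (fm G X \t fm G Y)) \c (eta i \t eta j) =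
           f i' j' \c (X' \t Y').
    rewrite -[in RHS]gen_structureK -!compA -!(tmap_comp bD').
    by rewrite (perm_gen (X' := X') EX) // (perm_gen (X' := Y') EY).
  have R : iota i' j' \c (fm G (X \t Y) \c Phi i j) \c (eta i \t eta j) =
           (iota i' j' \c fm G (X \t Y) \c iotaV i j) \c f i j.
    by rewrite /Phi -!compA -(tmap_comp bD') !etaK (tmap_id bD') compm1.
  rewrite -EX -EY /Pc (Pmx_conj delta_e _ _ (X \t Y)).
  split=> [E|/(congr1 (fun h => iota i' j' \c h \c (eta i \t eta j)))].
    apply: (iso_monic (iota_iso i' j')).
    apply: (iso_epic (iso_tmap bD' (eta_iso i) (eta_iso j))).
    by rewrite L R; apply: val_inj.
  by rewrite L R => /(congr1 (@tmxval _ _ _ _ _ _)).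
split=> [H i j i' j' X Y | H i j i' j' x y Cx Cy].
  have [[x Cx EX] [y Cy EY]] := conj (hom_ee X) (hom_ee Y).
  by apply/(key _ _ _ _ _ _ _ _ EX EY Cx Cy)/H.
by apply/(key _ _ _ _ _ _ (TMx (mtyped_mx1 Cx)) (TMx (mtyped_mx1 Cy))).
Qed.

Definition prj_sg i j (k : {t & 'I_((ee i *o[D] ee j) t)}) :
    chom (ee (sg i) *o[D'] ee (sg j)) (ee (sg (tag k))) :=
  TMx (mtyped_Y (datum_idem (D := D')) (psigk H1 (tagged k))).

Lemma prj_sgE i j (k : {t & 'I_((ee i *o[D] ee j) t)}) :
  prj_sg k = etaV (tag k) \c fm G (prj k) \c iotaV i j.
Proof. exact: (@prj_perm _ _ (permv_hat H1 i j) k (psigk H1 (tagged k)) (prj_sg k)). Qed.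

Lemma Pmx_conj_half (m : nvec (dpred D)) i j
    (X : chom (ee i *o[D] ee j : chat D) m) :
  Pmx En s m *m map_mx delta (tmxval X) *m (Pc H1 i j)^T =
  tmxval (fm G X \c iotaV i j).
Proof.
have := Pmx_conj delta_e (erefl (pv m)) (permv_hat H1 i j) X.
by rewrite castmx_id comp1m.
Qed.

Lemma gen_assoc_left_term i j l (k : {t & 'I_((ee i *o[D] ee j) t)}) :
  fm G (tassoc (ee i : chat D) (ee j : chat D) (ee l : chat D)) \c
    fm G (inc k \t cidm (ee l : chat D)) \c Phi (tag k) l \c
    ((fm G (prj k) \c Phi i j) \t cidm (G (ee l))) \c (eta i \t eta j \t eta l) =
  fm G (tassoc (ee i : chat D) (ee j : chat D) (ee l : chat D) \c
        (inc k \t cidm (ee l : chat D))) \c iotaV (tag k) l \c f (tag k) l \c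
    ((prj_sg k \c f i j) \t cidm (ee (sg l) : chat D')).
Proof.
rewrite -fmap_comp prj_sgE -!compA; congr (_ \c _); rewrite /Phi -!compA.
congr (_ \c (_ \c _)); rewrite -!(tmap_comp bD') comp1m etaK.
by rewrite -!compA -(tmap_comp bD') !etaK (tmap_id bD') compm1.
Qed.

Lemma gen_assoc_right_term i j l (k : {t & 'I_((ee j *o[D] ee l) t)}) :
  fm G (cidm (ee i : chat D) \t inc k) \c Phi i (tag k) \c
    (cidm (G (ee i)) \t (fm G (prj k) \c Phi j l)) \c
    tassoc (G (ee i)) (G (ee j)) (G (ee l)) \c (eta i \t eta j \t eta l) =
  fm G (cidm (ee i : chat D) \t inc k) \c iotaV i (tag k) \c f i (tag k) \c
    (cidm (ee (sg i) : chat D') \t (prj_sg k \c f j l)) \c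
    tassoc (ee (sg i) : chat D') (ee (sg j) : chat D') (ee (sg l) : chat D').
Proof.
rewrite prj_sgE -!compA -(tassoc_nat bD') !compA; congr (_ \c _).
rewrite /Phi -!compA; congr (_ \c (_ \c (_ \c _))); rewrite -!(tmap_comp bD') comp1m etaK.
by rewrite -!compA -(tmap_comp bD') !etaK (tmap_id bD') compm1.
Qed.

(** After multiplication by the injective matrix P_sigma, the two sides of the
    matrix equation are those of the associativity axiom composed with the
    isomorphism (eta i (x) eta j) (x) eta l. *)
Lemma gen_assoc_iff i j l :
  \sum_t \sum_(k < (ee i *o[D] ee j) t)
    map_mx delta (da D i j l) *m
    map_mx delta (Xmx_ D k *t[D] id1 D l) *m
    (Pc H1 t l)^T *m tmxval (f t l) *m
    ((Ymx_ D' (psigk H1 k) *m tmxval (f i j)) *t[D'] id1 D' (sg l)) =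
  \sum_t \sum_(k < (ee j *o[D] ee l) t)
    map_mx delta (id1 D i *t[D] Xmx_ D k) *m
    (Pc H1 i t)^T *m tmxval (f i t) *m
    (id1 D' (sg i) *t[D'] (Ymx_ D' (psigk H1 k) *m tmxval (f j l))) *m
    da D' (sg i) (sg j) (sg l) <->
  \sum_(k : dec_ix (chat_dec (ee i *o[D] ee j)))
    fm G (tassoc (ee i : chat D) (ee j : chat D) (ee l : chat D)) \c
    fm G (dec_in k \t cidm (ee l : chat D)) \c Phi (dec_lab k) l \c
    ((fm G (dec_out k) \c Phi i j) \t cidm (G (ee l))) =
  \sum_(k : dec_ix (chat_dec (ee j *o[D] ee l)))
    fm G (cidm (ee i : chat D) \t dec_in k) \c Phi i (dec_lab k) \c
    (cidm (G (ee i)) \t (fm G (dec_out k) \c Phi j l)) \c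
    tassoc (G (ee i)) (G (ee j)) (G (ee l)).
Proof.
set L := (X in X = _ <-> _); set R := (X in _ = X <-> _).
set L' := (X in _ <-> X = _); set R' := (X in _ <-> _ = X).
have EL : Pmx En s _ *m L = tmxval (L' \c (eta i \t eta j \t eta l)).
  rewrite /L mulmx_sumr comp_suml tmxval_sum [RHS]big_tagged; apply: eq_bigr => t _.
  rewrite mulmx_sumr; apply: eq_bigr => k _.
  rewrite gen_assoc_left_term -map_mxM !mulmxA.
  rewrite !id1E tassoc_ee.
  by rewrite (Pmx_conj_half (da_hom i j l \c (inc (Tagged (fun t => 'I_((ee i *o[D] ee j) t)) k) \t cidm (ee l : chat D)))).
have ER : Pmx En s _ *m R = tmxval (R' \c (eta i \t eta j \t eta l)).
  rewrite /R mulmx_sumr comp_suml tmxval_sum [RHS]big_tagged; apply: eq_bigr => t _.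
  rewrite mulmx_sumr; apply: eq_bigr => k _.
  rewrite gen_assoc_right_term !mulmxA.
  rewrite !id1E tassoc_ee.
  by rewrite (Pmx_conj_half (cidm (ee i : chat D) \t inc (Tagged (fun t => 'I_((ee j *o[D] ee l) t)) k))).
split=> [E|E].
  apply: (iso_epic (iso_tmap bD' (iso_tmap bD' (eta_iso i) (eta_iso j)) (eta_iso l))).
  by apply: val_inj; apply: etrans (etrans (esym EL) _) ER; rewrite E.
by apply: (@Pmx_inj _ _ _ En s); rewrite EL ER E.
Qed.


Lemma dr_inj (D0 : admissible_datum F) : injective (dr D0).
Proof.
move=> i j E; have [z [_ zU]] := zplus_basis (d_ring D0) (dr D0 i).
have zE k : dr D0 k = \sum_t dr D0 t *~ [ffun t => Posz (ee k t)] t.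
  by rewrite -(sum_ee (dr D0) k); apply: eq_bigr => t _; rewrite ffunE.
have /ffunP/(_ i) := etrans (esym (zU _ (zE i))) (zU _ (etrans E (zE j))).
by rewrite !ffunE eqxx; case: eqP.
Qed.

Lemma psig0 : sg ord0 = ord0.
Proof.
have [g [_ gr]] := H1; apply: dr_inj.
by rewrite -gr (zplus_one (d_ring D)) rmorph1 (zplus_one (d_ring D')).
Qed.

Lemma ocast_irr (D0 : admissible_datum F) (m t : nvec (dpred D0)) (E E' : m = t) :
  ocast (C := chat D0) E = ocast (C := chat D0) E'.
Proof. by congr ocast; apply: eq_irrelevance. Qed.

Lemma scalar_const (m : nvec (dpred D')) i a (g : chom (m : chat D') m) :
  m = ee i -> (g = a *: cidm (m : chat D')) <-> (tmxval g = const_mx (a *: e' i)).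
Proof.
move=> Em; have E1 : tmxval (a *: cidm (m : chat D')) = const_mx (a *: e' i).
  rewrite Em; apply/matrixP=> u v.
  by rewrite !mxE /= (ee_uniq u v) eqxx ty_ee mulr_algl.
by split=> [->|E]; [apply: E1 | apply: val_inj; apply: etrans E (esym E1)].
Qed.

Lemma unit_gen_eq : ee ord0 = pv (ee ord0).
Proof. by rewrite permv_ee psig0. Qed.

Definition unit_iso : chom (ee ord0 : chat D') (G (ee ord0)) :=
  ocast (C := chat D') unit_gen_eq.

(** All morphisms in the unit axiom are casts, except for f and the isomorphism
    of unit objects; so the axiom says that their scalars are inverse. *)
Lemma gen_lunit_iff a i : a != 0 ->
  tlunit (G (ee i)) = fm G (tlunit (ee i : chat D)) \c
    (Phi ord0 i \c ((a^-1 *: unit_iso) \t cidm (G (ee i)))) <->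
  f ord0 i = a *: cidm (ee (sg ord0) *o[D'] ee (sg i) : chat D').
Proof.
move=> a0; set A := fm G (tlunit (ee i : chat D)) \c iotaV ord0 i.
pose B := (etaV ord0 \t etaV i) \c (unit_iso \t cidm (G (ee i))).
have isoA : is_iso A.
  apply: iso_comp; last exact: ocast_iso.
  by apply: iso_fmap; rewrite chat_lunitE; apply: ocast_iso.
have isoB : is_iso B.
  apply: iso_comp; apply: (iso_tmap bD'); try exact: ocast_iso.
  exact: iso_id.
have -> : tlunit (G (ee i)) = A \c B.
  rewrite /A /B !chat_lunitE fmap_ocast -[cidm _]/(ocast (erefl _)).
  by rewrite !(ocast_tmap bD') !ocast_comp; apply: ocast_irr.
have -> : fm G (tlunit (ee i : chat D)) \c
    (Phi ord0 i \c ((a^-1 *: unit_iso) \t cidm (G (ee i)))) =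
    a^-1 *: (A \c f ord0 i \c B).
  by rewrite (tmapZl bD') !compZr /A /B /Phi !compA.
split=> [E|->].
  apply: (iso_monic isoA); apply: (iso_epic isoB).
  by rewrite compZr compZl compm1 E scalerA divff // scale1r.
by rewrite compZr compZl compm1 scalerA mulVf // scale1r.
Qed.

Lemma gen_runit_iff a i : a != 0 ->
  trunit (G (ee i)) = fm G (trunit (ee i : chat D)) \c
    (Phi i ord0 \c (cidm (G (ee i)) \t (a^-1 *: unit_iso))) <->
  f i ord0 = a *: cidm (ee (sg i) *o[D'] ee (sg ord0) : chat D').
Proof.
move=> a0; set A := fm G (trunit (ee i : chat D)) \c iotaV i ord0.
pose B := (etaV i \t etaV ord0) \c (cidm (G (ee i)) \t unit_iso).
have isoA : is_iso A.
  apply: iso_comp; last exact: ocast_iso.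
  by apply: iso_fmap; rewrite chat_runitE; apply: ocast_iso.
have isoB : is_iso B.
  apply: iso_comp; apply: (iso_tmap bD'); try exact: ocast_iso.
  exact: iso_id.
have -> : trunit (G (ee i)) = A \c B.
  rewrite /A /B !chat_runitE fmap_ocast -[cidm _]/(ocast (erefl _)).
  by rewrite !(ocast_tmap bD') !ocast_comp; apply: ocast_irr.
have -> : fm G (trunit (ee i : chat D)) \c
    (Phi i ord0 \c (cidm (G (ee i)) \t (a^-1 *: unit_iso))) =
    a^-1 *: (A \c f i ord0 \c B).
  by rewrite (tmapZr bD') !compZr /A /B /Phi !compA.
split=> [E|->].
  apply: (iso_monic isoA); apply: (iso_epic isoB).
  by rewrite compZr compZl compm1 E scalerA divff // scale1r.
by rewrite compZr compZl compm1 scalerA mulVf // scale1r.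
Qed.

Lemma unit_hat_l i : ee (sg ord0) *o[D'] ee (sg i) = ee (sg i).
Proof. by rewrite psig0 (hatv1l (d_ring D')). Qed.

Lemma unit_hat_r i : ee (sg i) *o[D'] ee (sg ord0) = ee (sg i).
Proof. by rewrite psig0 (hatv1r (d_ring D')). Qed.

End Translation.

Section PermutationEquivalence.
Variables (F : fieldType) (D D' : admissible_datum F).
Variables (En : dn D' = dn D) (s : {perm 'I_(dn D)}).
Variable delta : {lrmorphism dA D -> dA D'}.

Local Notation sg := (psig En s).
Local Notation sgV := (psigV En s).
Local Notation pv := (permv En s).
Local Notation e := (de D).
Local Notation e' := (de D').
Local Notation chom := (@chom F (chat _)).

Hypothesis delta_e : forall i, delta (e i) = e' (sg i).
Variable deltaV : dA D' -> dA D.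
Hypothesis deltaK : cancel delta deltaV.
Hypothesis deltaVK : cancel deltaV delta.

Local Notation G := (perm_functor delta_e).

Definition permvV (m : nvec (dpred D')) : nvec (dpred D) := [ffun i => m (sg i)].

Lemma permvVK m : pv (permvV m) = m.
Proof. by apply/ffunP=> i; rewrite !ffunE psigVK. Qed.

Lemma mtyped_permV m t (X : tmx e' (pv m) (pv t)) :
  mtyped e (\matrix_(u, v) deltaV (tmxval X (reperm En s u) (reperm En s v))).
Proof.
apply/mtypedP=> u v; rewrite mxE; apply/(cornerP (datum_idem (D := D))).
apply: (can_inj deltaK); rewrite !rmorphM /= !delta_e deltaVK -!ty_reperm.
exact/(cornerP (datum_idem (D := D')))/(mtypedP _ _ (tmxP X)).
Qed.

Lemma perm_functor_equivalence : is_equivalence G.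
Proof.
apply: (@equivalence_of_fully_faithful F (chat D) (chat D') G permvV
  (fun m => ocast (C := chat D') (permvVK m))
  (fun m => ocast (C := chat D') (esym (permvVK m)))
  (fun t m X => TMx (mtyped_permV X))).
- by move=> m; apply: ocastK.
- by move=> m; apply: ocastVK.
- move=> m t X; apply: val_inj; apply/matrixP=> u v /=.
  by rewrite mxE /= mxE !repermK deltaK.
- move=> m t X; apply: val_inj; apply/matrixP=> u v /=.
  by rewrite mxE /= mxE !unpermK deltaVK.
Qed.

End PermutationEquivalence.

Section Sufficiency.
Variables (F : fieldType) (D D' : admissible_datum F).
Variables (En : dn D' = dn D) (s : {perm 'I_(dn D)}).
Variable delta : {lrmorphism dA D -> dA D'}.

Local Notation sg := (psig En s).
Local Notation e := (de D).
Local Notation e' := (de D').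
Local Notation chom := (@chom F (chat _)).

Hypothesis delta_e : forall i, delta (e i) = e' (sg i).
Hypothesis H1 : basis_perm_iso En s.
Hypothesis delta_bij : bijective delta.
Local Notation G := (perm_functor delta_e).

Variable f : forall i j, chom (ee (sg i) *o[D'] ee (sg j)) (ee (sg i) *o[D'] ee (sg j)).
Local Notation Phi := (gen_structure delta_e H1 f).
Variable a : F.
Hypothesis a_neq0 : a != 0.
Hypothesis f_iso : forall i j, is_iso (f i j).
Hypothesis f_unit : forall i, f ord0 i = a *: cidm (_ : chat D') /\ f i ord0 = a *: cidm (_ : chat D').
Hypothesis Phi_nat : natural_on_generators (C := chat D) (e := fun i => ee i) Phi.
Hypothesis Phi_assoc : forall i j l,
  \sum_(k : dec_ix (chat_dec (ee i *o[D] ee j)))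
    fm G (tassoc (ee i : chat D) (ee j : chat D) (ee l : chat D)) \c
    fm G (dec_in k \t cidm (ee l : chat D)) \c Phi (dec_lab k) l \c
    ((fm G (dec_out k) \c Phi i j) \t cidm (G (ee l))) =
  \sum_(k : dec_ix (chat_dec (ee j *o[D] ee l)))
    fm G (cidm (ee i : chat D) \t dec_in k) \c Phi i (dec_lab k) \c
    (cidm (G (ee i)) \t (fm G (dec_out k) \c Phi j l)) \c
    tassoc (G (ee i)) (G (ee j)) (G (ee l)).

Lemma tensor_equivalent_of_structure : tensor_equivalent (chat D) (chat D').
Proof.
have [bD bD'] := (chat_bifunctorial D, chat_bifunctorial D').
have Phi_iso i j : is_iso (Phi i j).
  apply: iso_comp; last by apply: (iso_tmap bD'); apply: ocast_iso.
  by apply: iso_comp; [apply: ocast_iso | apply: f_iso].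
have [psi psiP] := fin_all_exists (fun i => fin_all_exists (fun j => Phi_iso i j)).
pose phi2 := tensor_ext (chat_dec (D := D)) Phi.
have phi2_nat : natural_tensor phi2 by exact: (tensor_ext_nat bD bD' (chat_dec (D := D)) Phi_nat).
have phi2E i j : phi2 (ee i) (ee j) = Phi i j by exact: (tensor_ext_gen bD' (chat_dec (D := D)) Phi_nat).
have phi2_iso U W : is_iso (phi2 U W).
  apply: (tensor_ext_iso bD bD' (chat_dec (D := D)) Phi_nat (psi := psi)) => i j;
    by case: (psiP i j).
exists G, (a^-1 *: unit_iso delta_e H1), phi2; split; last first.
  by have [g] := delta_bij; apply: perm_functor_equivalence.
split=> //.
- by apply: iso_scale; [rewrite invr_eq0 | apply: ocast_iso].
- move=> U V W.
  apply: (assoc_from_generators bD bD' (chat_dec (D := D)) phi2_nat) => i j l.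
  rewrite (assoc_leftE bD' (chat_dec (D := D))) // (assoc_rightE bD' (chat_dec (D := D))) //.
  have := Phi_assoc i j l; under eq_bigr do rewrite -!phi2E.
  by under [in RHS]eq_bigr do rewrite -!phi2E.
- apply: (lunit_from_generators bD bD' (chat_dec (D := D)) phi2_nat) => i.
  by rewrite phi2E; apply/gen_lunit_iff => //; case: (f_unit i).
- apply: (runit_from_generators bD bD' (chat_dec (D := D)) phi2_nat) => i.
  by rewrite phi2E; apply/gen_runit_iff => //; case: (f_unit i).
Qed.

End Sufficiency.

(** * From a tensor equivalence to the matrices *)

Section CornerMorphisms.
Variables (F : closedFieldType) (D : admissible_datum F).
Local Notation n := (dpred D).
Local Notation A := (dA D).
Local Notation e := (de D).
Local Notation chom := (@chom F (chat D)).

Lemma ee_gt0 i : (0 < mdim (ee i : nvec n))%N.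
Proof. by rewrite mdim_ee. Qed.

Definition entry i j (f : chom (ee j) (ee i)) : A :=
  tmxval f (Ordinal (ee_gt0 i)) (Ordinal (ee_gt0 j)).

Lemma entryE i j (f : chom (ee j) (ee i)) : tmxval f = mx1 i j (entry f).
Proof.
apply/matrixP=> u v; rewrite mxE /entry.
by rewrite (ee_uniq u (Ordinal (ee_gt0 i))) (ee_uniq v (Ordinal (ee_gt0 j))).
Qed.

Lemma entry_inj i j (f g : chom (ee j) (ee i)) : entry f = entry g -> f = g.
Proof. by move=> E; apply: val_inj; rewrite /= !entryE E. Qed.

Lemma entry_corner i j (f : chom (ee j) (ee i)) : entry f \in corner e i j.
Proof. by have := mtypedP _ _ (tmxP f) (Ordinal (ee_gt0 i)) (Ordinal (ee_gt0 j)); rewrite !ty_ee. Qed.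

Lemma entry_linear i j : linear (@entry i j).
Proof. by move=> a f g; rewrite /entry /= !mxE mulr_algl. Qed.

HB.instance Definition _ i j :=
  GRing.isLinear.Build F (chom (ee j) (ee i)) A _ (@entry i j) (@entry_linear i j).

Lemma entry_comp i j k (f : chom (ee j) (ee i)) (g : chom (ee k) (ee j)) :
  entry (f \c g) = entry f * entry g.
Proof. by rewrite {1}/entry /= mxE (big_ee _ _ (Ordinal (ee_gt0 j))). Qed.

Lemma entry_id i : entry (cidm (ee i : chat D)) = e i.
Proof. by rewrite /entry /= mxE eqxx ty_ee. Qed.

Definition corner_hom i j (a : A) : chom (ee j) (ee i) :=
  TMx (mtyped_mx1 (corner_mem (d_adm D) i j a)).

Lemma entry_corner_hom i j a : entry (corner_hom i j a) = e i * a * e j.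
Proof. by rewrite /entry /= mxE. Qed.

Lemma corner_hom_linear i j : linear (corner_hom i j).
Proof.
move=> k a b; apply: entry_inj; rewrite linearP /= !entry_corner_hom.
by rewrite mulrDr mulrDl -scalerAr -scalerAl.
Qed.

HB.instance Definition _ i j :=
  GRing.isLinear.Build F A (chom (ee j) (ee i)) _ (corner_hom i j) (@corner_hom_linear i j).

Lemma corner_hom_entry i j (f : chom (ee j) (ee i)) : corner_hom i j (entry f) = f.
Proof.
apply: entry_inj; rewrite entry_corner_hom.
have Cf := entry_corner f.
by rewrite (corner_l (d_adm D) Cf) (corner_r (d_adm D) Cf).
Qed.

Lemma corner_hom_mul i l a b : \sum_j corner_hom i j a \c corner_hom j l b = corner_hom i l (a * b).
Proof.
apply: entry_inj; rewrite raddf_sum /= entry_corner_hom.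
under eq_bigr do rewrite entry_comp !entry_corner_hom !mulrA -(mulrA _ (e _) (e _)) datum_idem.
rewrite -{2}[a]mulr1 -(adm_complete (d_adm D)) !(mulr_sumr, mulr_suml).
by apply: eq_bigr => j _; rewrite !mulrA.
Qed.

Lemma corner_hom_off i j i' j' x : x \in corner e i' j' -> (i, j) != (i', j') ->
  corner_hom i j x = 0.
Proof.
move=> /(cornerP (datum_idem (D := D)))-> ne; apply: entry_inj.
rewrite entry_corner_hom raddf0 !mulrA.
have [E|ni] := eqVneq i i'; last by rewrite (adm_orthogonal (d_adm D)) // !mul0r.
have nj : j' != j by apply: contra_neq ne => ->; rewrite E.
by rewrite -mulrA (adm_orthogonal (d_adm D) nj) mulr0.
Qed.

Lemma corner_sum a : a = \sum_i \sum_j e i * a * e j.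
Proof.
rewrite -{1}[a]mul1r -{1}[a]mulr1 -(adm_complete (d_adm D)) mulr_suml.
by apply: eq_bigr => i _; rewrite mulrA mulr_sumr.
Qed.

Lemma prj_inc (m : nvec n) (k : {i & 'I_(m i)}) :
  prj k \c inc k = cidm (ee (tag k) : chat D).
Proof.
apply: val_inj; apply/matrixP=> u v; rewrite /= !mxE (bigD1 (idx (tagged k))) //=.
rewrite !mxE eqxx datum_idem big1 ?addr0 => [|w nw].
  by rewrite (ee_uniq u v) eqxx ty_ee.
by rewrite !mxE (negPf nw) mul0r.
Qed.

Lemma id_ee_neq0 i : cidm (ee i : chat D) != 0.
Proof.
apply: contra_neq (_ : e i != 0) => [E|]; last by case: (adm_primitive (d_adm D) i).
by rewrite -entry_id E raddf0.
Qed.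

Lemma idempotent_ee i (q : chom (ee i) (ee i)) : q \c q = q -> q = 0 \/ q = cidm _.
Proof.
move=> qq; have [_ _ prim] := adm_primitive (d_adm D) i.
have xx : entry q * entry q = entry q by rewrite -entry_comp qq.
have lx := corner_l (d_adm D) (entry_corner q).
have rx := corner_r (d_adm D) (entry_corner q).
case: (prim (entry q) (e i - entry q)).
- by [].
- by rewrite mulrBl !mulrBr datum_idem lx rx xx subrr subr0.
- by rewrite mulrBr rx xx subrr.
- by rewrite mulrBl lx xx subrr.
- by rewrite addrC subrK.
- by move=> E; left; apply: entry_inj; rewrite E raddf0.
- by move/eqP; rewrite subr_eq0 => /eqP E; right; apply: entry_inj; rewrite entry_id.
Qed.

End CornerMorphisms.

Section MatchingGenerators.
Variables (F : closedFieldType) (D D' : admissible_datum F).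
Variable G0 : lfunctor (chat D) (chat D').
Hypothesis G0_eq : is_equivalence G0.

Let faithful := (equivalence_fully_faithful G0_eq).1.
Let full := (equivalence_fully_faithful G0_eq).2.

(** The identity of m = G0 (ee i) is a sum of idempotents that factor through
    generators. One of them is nonzero; as e_i is primitive and G0 is fully
    faithful, it is the identity, and then m is isomorphic, hence equal, to the
    generator. *)
Lemma image_of_generator i : exists j, G0 (ee i : nvec (dpred D)) = ee j.
Proof.
set m : nvec (dpred D') := G0 _.
have [/existsP[k nz]|/existsPn all0] := boolP [exists k : {j & 'I_(m j)}, inc k \c prj k != 0].
  exists (tag k); apply/esym/chat_skeletal.
  exists (prj k); split; first exact: prj_inc.
  have [q Eq] := full (inc k \c prj k : chom (G0 (ee i : chat D)) (G0 (ee i : chat D))).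
  have qq : q \c q = q.
    apply: faithful; rewrite fmap_comp Eq -compA (compA (prj k)).
    by rewrite prj_inc comp1m.
  have [q0|q1] := idempotent_ee qq; first by rewrite -Eq q0 raddf0 eqxx in nz.
  by rewrite -Eq q1 fmap_id.
have : cidm (m : chat D') = 0.
  by rewrite -inc_prj big1 // => k _; apply/eqP; have := all0 k; rewrite negbK.
rewrite -(fmap_id G0) => E; have := id_ee_neq0 (D := D) i.
by case/eqP; apply: faithful; rewrite E raddf0.
Qed.

Lemma objects_reflected (U V : chat D) : G0 U = G0 V -> U = V.
Proof.
move=> E; have [w Ew] := full (ocast (C := chat D') E).
have [w' Ew'] := full (ocast (C := chat D') (esym E)).
apply: (chat_skeletal (f := w)); exists w'.
by split; apply: faithful; rewrite fmap_comp Ew Ew' fmap_id (ocastK, ocastVK).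
Qed.

End MatchingGenerators.

Section Matching.
Variables (F : closedFieldType) (D D' : admissible_datum F).
Variable G0 : lfunctor (chat D) (chat D').
Hypothesis G0_eq : is_equivalence G0.

(** i |-> j with G0 (ee i) = ee j is injective since G0 reflects equality of
    objects, and surjective since a quasi-inverse of G0 also maps generators to
    generators. *)
Lemma matching_permutation : exists (En : dn D' = dn D) (s : {perm 'I_(dn D)}),
  forall i, G0 (ee i : nvec (dpred D)) = ee (psig En s i).
Proof.
have [sg sgE] := fin_all_exists (image_of_generator G0_eq).
have sg_inj : injective sg.
  move=> i j E; apply: ee_inj; apply: (objects_reflected G0_eq).
  by rewrite !sgE E.
have [H [[eta [eta_iso eta_nat]] [eps [eps_iso eps_nat]]]] := G0_eq.
have H_eq : is_equivalence H.
  exists G0; split; [by exists eps | by exists eta].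
have sg_surj j : exists i, sg i == j.
  have [i Ei] := image_of_generator H_eq j; exists i; apply/eqP/ee_inj.
  by rewrite -sgE -Ei; apply: (chat_skeletal (f := eps (ee j))).
have sg_bij : bijective sg.
  exists (fun j => xchoose (sg_surj j)) => k; last exact/eqP/(xchooseP (sg_surj k)).
  exact/sg_inj/eqP/(xchooseP (sg_surj (sg k))).
have En : dn D' = dn D by have := bij_eq_card sg_bij; rewrite !card_ord.
have cast_inj : injective (fun i : 'I_(dn D) => cast_ord En (sg i)).
  by move=> i j /cast_ord_inj/sg_inj.
exists En, (perm cast_inj) => i.
by rewrite sgE /psig permE cast_ordK.
Qed.

End Matching.

Section InducedIsomorphism.
Variables (F : closedFieldType) (D D' : admissible_datum F).
Variable G0 : lfunctor (chat D) (chat D').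
Hypothesis G0_eq : is_equivalence G0.
Variables (En : dn D' = dn D) (s : {perm 'I_(dn D)}).
Local Notation sg := (psig En s).
Local Notation e := (de D).
Local Notation e' := (de D').
Local Notation chom := (@chom F (chat _)).
Hypothesis G0_ee : forall i, G0 (ee i : nvec (dpred D)) = ee (sg i).

Let faithful := (equivalence_fully_faithful G0_eq).1.
Let full := (equivalence_fully_faithful G0_eq).2.

Definition gen_cast i : chom (ee (sg i) : chat D') (G0 (ee i)) :=
  ocast (C := chat D') (esym (G0_ee i)).
Definition gen_castV i : chom (G0 (ee i)) (ee (sg i) : chat D') :=
  ocast (C := chat D') (G0_ee i).

Lemma gen_castK i : gen_castV i \c gen_cast i = cidm _. Proof. exact: ocastVK. Qed.
Lemma gen_castVK i : gen_cast i \c gen_castV i = cidm _. Proof. exact: ocastK. Qed.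

Definition gen_conj i j (f : chom (ee j : chat D) (ee i)) :
    chom (ee (sg j) : chat D') (ee (sg i)) :=
  gen_castV i \c fm G0 f \c gen_cast j.

Lemma gen_conj_linear i j : linear (@gen_conj i j).
Proof.
by move=> k f g; rewrite /gen_conj linearP comp_linearr comp_linearl.
Qed.

HB.instance Definition _ i j :=
  GRing.isLinear.Build F (chom (ee j : chat D) (ee i))
    (chom (ee (sg j) : chat D') (ee (sg i))) _ (@gen_conj i j) (@gen_conj_linear i j).

Lemma gen_conj_comp i j k (f : chom (ee j : chat D) (ee i)) (g : chom (ee k : chat D) (ee j)) :
  gen_conj (f \c g) = gen_conj f \c gen_conj g.
Proof.
rewrite /gen_conj fmap_comp !compA; congr (_ \c _ \c _).
by rewrite -(compA _ (gen_cast j)) gen_castVK compm1.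
Qed.

Lemma gen_conj_id i : gen_conj (cidm (ee i : chat D)) = cidm (ee (sg i) : chat D').
Proof. by rewrite /gen_conj fmap_id compm1 gen_castK. Qed.

Lemma gen_conj_inj i j : injective (@gen_conj i j).
Proof.
move=> f g E; apply: faithful.
apply: (iso_monic (f := gen_castV i)); first exact: ocast_iso.
by apply: (iso_epic (f := gen_cast j)); first exact: ocast_iso.
Qed.

Lemma gen_conj_surj i j (h : chom (ee (sg j) : chat D') (ee (sg i))) :
  exists f, @gen_conj i j f = h.
Proof.
have [f Ef] := full (gen_cast i \c h \c gen_castV j); exists f.
by rewrite /gen_conj Ef !compA gen_castK comp1m -compA gen_castK compm1.
Qed.

(** G0 on the corners of A, glued along the Peirce decomposition. *)
Definition induced (a : dA D) : dA D' :=
  \sum_i \sum_j entry (gen_conj (corner_hom i j a)).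

Lemma induced_linear : linear induced.
Proof.
move=> k a b; rewrite /induced scaler_sumr -big_split; apply: eq_bigr => i _ /=.
rewrite scaler_sumr -big_split; apply: eq_bigr => j _ /=.
by rewrite !linearP.
Qed.

Lemma psig_inj : injective sg.
Proof. exact: can_inj (psigK En s). Qed.

Lemma induced_mul a b : induced (a * b) = induced a * induced b.
Proof.
rewrite /induced mulr_suml; apply: eq_bigr => i _.
transitivity (\sum_l \sum_j entry (gen_conj (corner_hom i j a)) * entry (gen_conj (corner_hom j l b))).
  apply: eq_bigr => l _; rewrite -corner_hom_mul !raddf_sum /=; apply: eq_bigr => j _.
  by rewrite gen_conj_comp entry_comp.
rewrite exchange_big mulr_suml; apply: eq_bigr => j _ /=.
rewrite mulr_sumr [RHS](bigD1 j) //= [X in _ + X]big1 ?addr0 => [|k nk].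
  by rewrite mulr_sumr.
rewrite mulr_sumr big1 // => l _.
rewrite -(corner_r (d_adm D') (entry_corner (gen_conj (corner_hom i j a)))).
rewrite -(corner_l (d_adm D') (entry_corner (gen_conj (corner_hom k l b)))).
rewrite mulrA -(mulrA _ (e' _) (e' _)) (adm_orthogonal (d_adm D')) ?mulr0 ?mul0r //.
by rewrite (inj_eq psig_inj) eq_sym.
Qed.

Lemma induced_gen i j (f : chom (ee j : chat D) (ee i)) :
  induced (entry f) = entry (gen_conj f).
Proof.
rewrite /induced (bigD1 i) //= (bigD1 j) //= corner_hom_entry.
rewrite big1 => [|k nk]; last first.
  by rewrite (corner_hom_off (entry_corner f)) ?raddf0 // xpair_eqE (negPf nk) andbF.
rewrite big1 ?addr0 // => k nk; rewrite big1 // => l _.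
by rewrite (corner_hom_off (entry_corner f)) ?raddf0 // xpair_eqE (negPf nk).
Qed.

Lemma induced_e i : induced (e i) = e' (sg i).
Proof. by rewrite -(entry_id i) induced_gen gen_conj_id entry_id. Qed.

Lemma sum_psig : \sum_i e' (sg i) = 1.
Proof.
rewrite -(adm_complete (d_adm D')) [RHS](reindex sg) //.
by exists (psigV En s) => k _; [apply: psigK | apply: psigVK].
Qed.

HB.instance Definition _ :=
  GRing.isLinear.Build F (dA D) (dA D') _ induced induced_linear.

Lemma induced_1 : induced 1 = 1.
Proof.
rewrite -(adm_complete (d_adm D)) -sum_psig.
rewrite raddf_sum.
by apply: eq_bigr => i _; apply: induced_e.
Qed.

HB.instance Definition _ :=
  GRing.isMonoidMorphism.Build (dA D) (dA D') induced (conj induced_1 induced_mul).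

Lemma induced_inj : injective induced.
Proof.
apply: raddf_inj => a a0; rewrite [a]corner_sum big1 // => i _.
rewrite big1 // => j _; rewrite -entry_corner_hom.
suff -> : corner_hom i j a = 0 by rewrite raddf0.
apply: gen_conj_inj; apply: entry_inj; rewrite !raddf0 -induced_gen entry_corner_hom.
by rewrite !rmorphM /= a0 mulr0 mul0r.
Qed.

Lemma induced_surj b : exists a, induced a == b.
Proof.
have [X XE] := fin_all_exists (fun i => fin_all_exists (fun j =>
   gen_conj_surj (corner_hom (sg i) (sg j) b))).
exists (\sum_i \sum_j entry (X i j)); apply/eqP.
rewrite [RHS]corner_sum !raddf_sum [RHS](reindex sg) /=; last first.
  by exists (psigV En s) => k _; [apply: psigK | apply: psigVK].
apply: eq_bigr => i _; rewrite raddf_sum [RHS](reindex sg) /=; last first.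
  by exists (psigV En s) => k _; [apply: psigK | apply: psigVK].
by apply: eq_bigr => j _; rewrite induced_gen XE entry_corner_hom.
Qed.

Lemma induced_bij : bijective induced.
Proof.
exists (fun b => xchoose (induced_surj b)) => x.
  exact/induced_inj/eqP/(xchooseP (induced_surj (induced x))).
exact/eqP/(xchooseP (induced_surj x)).
Qed.

Definition induced_hom : {lrmorphism dA D -> dA D'} := induced.

End InducedIsomorphism.

Section BasisIsomorphism.
Variables (n n' : nat) (R R' : nzRingType).
Variables (r : 'I_n.+1 -> R) (r' : 'I_n'.+1 -> R').
Variables (c : 'I_n.+1 -> 'I_n.+1 -> nvec n) (c' : 'I_n'.+1 -> 'I_n'.+1 -> nvec n').
Hypotheses (zR : zplus_ring r c) (zR' : zplus_ring r' c').
Variables (sg : 'I_n.+1 -> 'I_n'.+1) (sgV : 'I_n'.+1 -> 'I_n.+1).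
Hypotheses (sgK : cancel sg sgV) (sgVK : cancel sgV sg).
Hypothesis sg0 : sg ord0 = ord0.
Hypothesis sg_c : forall i j k, c i j k = c' (sg i) (sg j) (sg k).

Let has_coord (x : R) : exists z : {ffun 'I_n.+1 -> int}, x == \sum_i r i *~ z i.
Proof. by have [z [E _]] := zplus_basis zR x; exists z; apply/eqP. Qed.

Let coords (x : R) := xchoose (has_coord x).

Let coordsP x : x = \sum_i r i *~ coords x i.
Proof. exact/eqP/(xchooseP (has_coord x)). Qed.

Let coords_uniq x (z : 'I_n.+1 -> int) : x = \sum_i r i *~ z i -> coords x =1 z.
Proof.
move=> E i; have [z0 [_ U]] := zplus_basis zR x.
have Ef : x = \sum_i r i *~ [ffun i => z i] i.
  by rewrite {1}E; apply: eq_bigr => k _; rewrite ffunE.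
by have /ffunP/(_ i) := etrans (esym (U _ (coordsP x))) (U _ Ef); rewrite !ffunE.
Qed.

Definition basis_map (x : R) : R' := \sum_i r' (sg i) *~ coords x i.

Lemma basis_mapE x (z : 'I_n.+1 -> int) :
  x = \sum_i r i *~ z i -> basis_map x = \sum_i r' (sg i) *~ z i.
Proof. by move=> E; apply: eq_bigr => i _; rewrite (coords_uniq E). Qed.

Lemma basis_map_basis i : basis_map (r i) = r' (sg i).
Proof.
rewrite (@basis_mapE _ (fun k => (k == i)%:Z)).
  rewrite (bigD1 i) //= eqxx big1 ?addr0 // => k nk.
  by rewrite (negPf nk) mulr0z.
rewrite (bigD1 i) //= eqxx big1 ?addr0 // => k nk.
by rewrite (negPf nk) mulr0z.
Qed.

Lemma basis_map_sub : {morph basis_map : x y / x - y}.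
Proof.
move=> x y; rewrite (@basis_mapE _ (fun k => coords x k - coords y k)).
  by rewrite -sumrB; apply: eq_bigr => i _; rewrite mulrzBr.
rewrite {1}(coordsP x) {1}(coordsP y) -sumrB; apply: eq_bigr => i _.
by rewrite mulrzBr.
Qed.

Lemma mul_combination (S : nzRingType) m (b : 'I_m.+1 -> S)
    (d : 'I_m.+1 -> 'I_m.+1 -> nvec m) (z w : 'I_m.+1 -> int) :
  (forall i j, b i * b j = \sum_k b k *+ d i j k) ->
  (\sum_i b i *~ z i) * (\sum_j b j *~ w j) =
  \sum_k b k *~ (\sum_i \sum_j z i * w j * (d i j k)%:Z).
Proof.
move=> mulb; under [RHS]eq_bigr => k _.
  rewrite mulrz_sumr; under eq_bigr do rewrite mulrz_sumr.
  over.
rewrite exchange_big mulr_suml; apply: eq_bigr => i _ /=.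
rewrite exchange_big mulr_sumr; apply: eq_bigr => j _ /=.
rewrite mulrzAl mulrzAr mulb -mulrzA !mulrz_suml; apply: eq_bigr => k _.
by rewrite pmulrn -mulrzA mulrC [w j * _]mulrC.
Qed.

Lemma basis_map_mul : {morph basis_map : x y / x * y}.
Proof.
move=> x y.
rewrite (@basis_mapE _ (fun k => \sum_i \sum_j coords x i * coords y j * (c i j k)%:Z)); last first.
  by rewrite {1}(coordsP x) {1}(coordsP y) (mul_combination _ _ (zplus_mul zR)).
rewrite /basis_map.
have re (V : nmodType) (g : 'I_n'.+1 -> V) : \sum_k g k = \sum_k g (sg k).
  by rewrite (reindex sg) //; exists sgV => k _.
transitivity ((\sum_i r' i *~ coords x (sgV i)) * (\sum_j r' j *~ coords y (sgV j))).
  rewrite (mul_combination _ _ (zplus_mul zR')) re; apply: eq_bigr => k _.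
  congr (_ *~ _); rewrite re; apply: eq_bigr => i _; rewrite re.
  by apply: eq_bigr => j _; rewrite !sgK sg_c.
by rewrite !re; congr (_ * _); apply: eq_bigr => i _; rewrite sgK.
Qed.

Lemma basis_map1 : basis_map 1 = 1.
Proof. by rewrite -(zplus_one zR) basis_map_basis sg0 (zplus_one zR'). Qed.

HB.instance Definition _ :=
  GRing.isZmodMorphism.Build R R' basis_map basis_map_sub.
HB.instance Definition _ :=
  GRing.isMonoidMorphism.Build R R' basis_map (conj basis_map1 basis_map_mul).

Definition basis_rmorphism : {rmorphism R -> R'} := basis_map.

Lemma basis_map_bij : bijective basis_map.
Proof.
have has_coord' (y : R') : exists z : {ffun 'I_n'.+1 -> int}, y == \sum_i r' i *~ z i.
  by have [z [E _]] := zplus_basis zR' y; exists z; apply/eqP.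
have re (V : nmodType) (g : 'I_n'.+1 -> V) : \sum_k g k = \sum_k g (sg k).
  by rewrite (reindex sg) //; exists sgV => k _.
have inj : injective basis_map.
  move=> x y Exy; rewrite (coordsP x) (coordsP y); apply: eq_bigr => i _; congr (_ *~ _).
  have [z [_ U]] := zplus_basis zR' (basis_map x).
  have Ez t : basis_map x = basis_map t -> z = [ffun k => coords t (sgV k)].
    move=> E; apply: U; rewrite E re; apply: eq_bigr => k _.
    by rewrite ffunE sgK.
  have /ffunP/(_ (sg i)) := etrans (esym (Ez x erefl)) (Ez y Exy).
  by rewrite !ffunE sgK.
pose g y := \sum_i r i *~ xchoose (has_coord' y) (sg i).
have gK y : basis_map (g y) = y.
  rewrite (@basis_mapE _ (fun i => xchoose (has_coord' y) (sg i))) //.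
  by rewrite [RHS](eqP (xchooseP (has_coord' y))) re.
by exists g => // x; apply: inj; rewrite gK.
Qed.

End BasisIsomorphism.

Section Necessity.
Variables (F : closedFieldType) (D D' : admissible_datum F).
Variable G0 : lfunctor (chat D) (chat D').
Variable phi0 : chom (tunit (chat D')) (G0 (tunit (chat D))).
Variable phi2 : forall U W : chat D, chom (tob (G0 U) (G0 W)) (G0 (tob U W)).
Hypothesis tf : tensor_functor phi0 phi2.
Hypothesis G0_eq : is_equivalence G0.
Variables (En : dn D' = dn D) (s : {perm 'I_(dn D)}).
Local Notation sg := (psig En s).
Local Notation e := (de D).
Local Notation e' := (de D').
Local Notation chom := (@chom F (chat _)).
Hypothesis G0_ee : forall i, G0 (ee i : nvec (dpred D)) = ee (sg i).

Local Notation delta := (induced_hom G0_ee).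
Local Notation delta_e := (induced_e G0_ee).
Local Notation G := (perm_functor delta_e).
Local Notation bD := (chat_bifunctorial D).
Local Notation bD' := (chat_bifunctorial D').

Definition gen_iso i : chom (G (ee i)) (G0 (ee i)) := gen_cast G0_ee i \c etaV delta_e i.
Definition gen_isoV i : chom (G0 (ee i)) (G (ee i)) := eta delta_e i \c gen_castV G0_ee i.

Lemma gen_isoK i : gen_isoV i \c gen_iso i = cidm _.
Proof. by rewrite /gen_iso /gen_isoV !compA -(compA (eta _ _)) gen_castK compm1 etaVK. Qed.

Lemma gen_isoVK i : gen_iso i \c gen_isoV i = cidm _.
Proof. by rewrite /gen_iso /gen_isoV !compA -(compA (gen_cast _ _)) etaK compm1 gen_castVK. Qed.

Lemma gen_iso_nat i j (x : chom (ee i : chat D) (ee j)) :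
  gen_iso j \c fm G x = fm G0 x \c gen_iso i.
Proof.
have E : fm G x \c eta delta_e i = eta delta_e j \c gen_conj G0_ee x.
  by apply: (perm_gen delta_e (entryE x)); rewrite entryE -induced_gen.
rewrite -[LHS]compm1 -(etaVK delta_e i) /gen_iso !compA -(compA _ (fm G x)) E.
rewrite /gen_conj !compA -(compA _ (etaV _ j)) etaK compm1 gen_castVK.
by rewrite comp1m.
Qed.

Definition full_iso U : chom (G U) (G0 U) := nat_ext (chat_dec (D := D)) gen_iso U.
Definition full_isoV U : chom (G0 U) (G U) := nat_ext (chat_dec (D := D)) gen_isoV U.

Lemma gen_isoV_nat i j (x : chom (ee i : chat D) (ee j)) :
  gen_isoV j \c fm G0 x = fm G x \c gen_isoV i.
Proof.
exact: (inverse_natural gen_iso_nat gen_isoVK gen_isoK).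
Qed.

Lemma full_isoK U : full_isoV U \c full_iso U = cidm _.
Proof. exact: (nat_extK (chat_dec (D := D)) gen_iso_nat gen_isoVK gen_isoK). Qed.

Lemma full_isoVK U : full_iso U \c full_isoV U = cidm _.
Proof. exact: (nat_extK (chat_dec (D := D)) gen_isoV_nat gen_isoK gen_isoVK). Qed.

Lemma full_iso_nat U V (f : chom (U : chat D) V) :
  full_iso V \c fm G f = fm G0 f \c full_iso U.
Proof. exact: (nat_ext_natural (chat_dec (D := D)) gen_iso_nat). Qed.

Lemma permvG0 (m : nvec (dpred D)) : permv En s m = G0 (m : chat D).
Proof.
apply: (chat_skeletal (f := full_iso m)); exists (full_isoV m).
by rewrite full_isoK full_isoVK.
Qed.

Lemma matching_unit : sg ord0 = ord0.
Proof.
have /chat_skeletal E := tf_iso0 tf; apply: ee_inj.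
by rewrite -G0_ee -[RHS]/(tunit (chat D')) E.
Qed.

Lemma matching_product i j :
  permv En s (ee i *o[D] ee j) = ee (sg i) *o[D'] ee (sg j).
Proof.
have /chat_skeletal /= := tf_iso2 tf (ee i) (ee j).
by rewrite !G0_ee => ->; rewrite permvG0.
Qed.

Lemma matching_basis : basis_perm_iso En s.
Proof.
have sg_c i j k : dc D i j k = dc D' (sg i) (sg j) (sg k).
  by rewrite -!hatv_ee -matching_product permvE.
exists (basis_rmorphism (d_ring D) (d_ring D') (psigK En s) (psigVK En s) matching_unit sg_c).
split; last by move=> i; apply: basis_map_basis.
exact: (basis_map_bij (d_ring D) (d_ring D') (psigK En s) (psigVK En s)).
Qed.

(** The tensor structure of G0, transported to the functor of sigma and delta and
    restricted to generators. The isomorphism of unit objects is an endomorphism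
    of the unit object up to a cast, hence a scalar b, and a = b^-1. *)
Lemma matching_structure (H1 : basis_perm_iso En s) :
  exists (a : F) (f : forall i j, chom (ee (sg i) *o[D'] ee (sg j)) (ee (sg i) *o[D'] ee (sg j))),
  [/\ a != 0, forall i j, is_iso (f i j),
      forall i, f ord0 i = a *: cidm (_ : chat D') /\ f i ord0 = a *: cidm (_ : chat D'),
      natural_on_generators (C := chat D) (e := fun i => ee i) (gen_structure delta_e H1 f) &
      forall i j l,
        \sum_(k : dec_ix (chat_dec (ee i *o[D] ee j)))
          fm G (tassoc (ee i : chat D) (ee j : chat D) (ee l : chat D)) \c
          fm G (dec_in k \t cidm (ee l : chat D)) \c
          gen_structure delta_e H1 f (dec_lab k) l \c
          ((fm G (dec_out k) \c gen_structure delta_e H1 f i j) \t cidm (G (ee l))) =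
        \sum_(k : dec_ix (chat_dec (ee j *o[D] ee l)))
          fm G (cidm (ee i : chat D) \t dec_in k) \c
          gen_structure delta_e H1 f i (dec_lab k) \c
          (cidm (G (ee i)) \t (fm G (dec_out k) \c gen_structure delta_e H1 f j l)) \c
          tassoc (G (ee i)) (G (ee j)) (G (ee l))].
Proof.
have := tensor_functor_transport bD' full_isoK full_isoVK full_iso_nat tf.
set p0 := _ \c phi0; set p2 := fun U W => _.
case=> iso0 iso2 nat2 ass lu ru.
have [a [a0 Ea]] : exists a, a != 0 /\ p0 = a^-1 *: unit_iso delta_e H1.
  pose q : chom (ee ord0 : chat D') (ee ord0) :=
    ocast (C := chat D') (esym (unit_gen_eq H1)) \c p0.
  have q_iso : is_iso q by apply: iso_comp; [apply: ocast_iso | apply: iso0].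
  have [b Eb] := corner0_scalar (entry_corner q).
  have Eq : q = b *: cidm (ee ord0 : chat D').
    by apply: entry_inj; rewrite Eb linearZ /= entry_id.
  exists b^-1; rewrite invrK invr_eq0; split.
    apply: contra_neq (id_ee_neq0 (D := D') ord0) => b0.
    by case: q_iso => g [<- _]; rewrite Eq b0 scale0r raddf0.
  have -> : p0 = unit_iso delta_e H1 \c q by rewrite /q compA ocastVK comp1m.
  by rewrite Eq compZr compm1.
pose f i j := iota delta_e H1 i j \c p2 (ee i) (ee j) \c (eta delta_e i \t eta delta_e j).
have fE i j : gen_structure delta_e H1 f i j = p2 (ee i) (ee j).
  rewrite /gen_structure /f !compA iotaK comp1m -compA -(tmap_comp bD') !etaVK.
  by rewrite (tmap_id bD') compm1.
exists a, f; split=> //.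
- move=> i j; apply: iso_comp; last by apply: (iso_tmap bD'); apply: ocast_iso.
  by apply: iso_comp; [apply: ocast_iso | apply: iso2].
- move=> i; split.
    by apply/(gen_lunit_iff delta_e H1 f i a0); rewrite fE -Ea; apply: lu.
  by apply/(gen_runit_iff delta_e H1 f i a0); rewrite fE -Ea; apply: ru.
- by move=> i j i' j' x y; rewrite !fE; apply: nat2.
- move=> i j l.
  have := ass (ee i) (ee j) (ee l).
  rewrite -/(assoc_left p2 _ _ _) -/(assoc_right p2 _ _ _).
  rewrite (assoc_leftE bD' (chat_dec (D := D))) // (assoc_rightE bD' (chat_dec (D := D))) //.
  under eq_bigr do rewrite -!fE.
  by under [in RHS]eq_bigr do rewrite -!fE.
Qed.

End Necessity.

Theorem theorem3p18 (F : closedFieldType) (D D' : admissible_datum F) :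
  tensor_equivalent (chat D) (chat D') <->
  exists (En : dn D' = dn D) (s : {perm 'I_(dn D)}),
  let sg := psig En s in
  exists H1 : basis_perm_iso En s,
  let P := Pc H1 in
  exists delta : {lrmorphism dA D -> dA D'},
  [/\ bijective delta,
      forall i, delta (de D i) = de D' (sg i) &
      exists (alpha : F)
        (phi : forall i j, 'M[dA D']_(mdim (ee (sg i) *o[D'] ee (sg j)))),
      [/\ alpha != 0,
          forall i j, minvertible (de D') (phi i j),
          (forall i, phi ord0 i = const_mx (alpha *: de D' (sg i)) /\
                     phi i ord0 = const_mx (alpha *: de D' (sg i))),
          (forall i j i' j' x y,
             x \in corner (de D) i' i -> y \in corner (de D) j' j ->
             phi i' j' *m (mx1 (sg i') (sg i) (delta x) *t[D']
                           mx1 (sg j') (sg j) (delta y)) =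
             P i' j' *m map_mx delta (mx1 i' i x *t[D] mx1 j' j y) *m
               (P i j)^T *m phi i j) &
          forall i j l,
            \sum_t \sum_(k < (ee i *o[D] ee j) t)
              map_mx delta (da D i j l) *m
              map_mx delta (Xmx_ D k *t[D] id1 D l) *m
              (P t l)^T *m phi t l *m
              ((Ymx_ D' (psigk H1 k) *m phi i j) *t[D'] id1 D' (sg l)) =
            \sum_t \sum_(k < (ee j *o[D] ee l) t)
              map_mx delta (id1 D i *t[D] Xmx_ D k) *m
              (P i t)^T *m phi i t *m
              (id1 D' (sg i) *t[D'] (Ymx_ D' (psigk H1 k) *m phi j l)) *m
              da D' (sg i) (sg j) (sg l)]].
Proof.
split=> [[G0 [phi0 [phi2 [tf G0_eq]]]]|].
  have [En [s G0_ee]] := matching_permutation G0_eq.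
  exists En, s => sg.
  have H1 := matching_basis tf G0_ee.
  exists H1 => P; exists (induced_hom G0_ee).
  have delta_e := induced_e G0_ee.
  have [a [f [a0 f_iso f_unit f_nat f_assoc]]] := matching_structure tf G0_ee H1.
  split; [exact: induced_bij | exact: induced_e |].
  exists a, (fun i j => tmxval (f i j)); split=> //.
  - move=> i j; have [g [gf fg]] := f_iso i j; split; first exact: tmxP.
    exists (tmxval g); split; first exact: tmxP.
      exact: (congr1 (@tmxval _ _ _ _ _ _) fg).
    exact: (congr1 (@tmxval _ _ _ _ _ _) gf).
  - move=> i; have [fl fr] := f_unit i; split.
      exact: (proj1 (scalar_const _ _ (unit_hat_l H1 i)) fl).
    exact: (proj1 (scalar_const _ _ (unit_hat_r H1 i)) fr).
  - exact: (proj2 (gen_natural_iff _ H1 f) f_nat).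
  - move=> i j l; exact: (proj2 (gen_assoc_iff _ H1 f i j l) (f_assoc i j l)).
case=> En [s [H1 [delta [delta_bij delta_e [a [phi [a0 phi_inv phi_unit phi_nat phi_assoc]]]]]]].
pose f i j : chom (ee (psig En s i) *o[D'] ee (psig En s j) : chat D') _ :=
  TMx (proj1 (phi_inv i j)).
apply: (tensor_equivalent_of_structure (H1 := H1) delta_bij (f := f) a0).
- move=> i j; have [_ [g [tg fg gf]]] := phi_inv i j.
  by exists (TMx tg); split; apply: val_inj.
- move=> i; have [fl fr] := phi_unit i; split.
    exact: (proj2 (scalar_const a (f ord0 i) (unit_hat_l H1 i)) fl).
  exact: (proj2 (scalar_const a (f i ord0) (unit_hat_r H1 i)) fr).
- exact: (proj1 (gen_natural_iff delta_e H1 f) phi_nat).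
- move=> i j l; exact: (proj1 (gen_assoc_iff delta_e H1 f i j l) (phi_assoc i j l)).
Qed.
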